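(* For every $d\in\mathbb{N}$ there exist a weak Hardy computer $S_d$ for $\Omega_{d+1}$ that is complete and a weak Hardy computer $S_d^{-1}$ for $\Omega_{d+1}$ that is inv-complete. Furthermore, $S_d$ and $S_d^{-1}$ can be generated uniformly from $d$ in $\mathrm{DSPACE}(\log d)$.
   Context: Ordinal terms: $\alpha::=0\mid\omega^\alpha\mid\alpha+\beta$, with $+$ associative with neutral element $0$ (terms need not be in Cantor normal form); $1=\omega^0$. A nonzero term $\sum_{i=1}^k\omega^{\alpha_i}$ is a successor if $\alpha_k=0$ and a limit otherwise. Terms are compared through the set-theoretic ordinals they denote. $\Omega_0=1$, $\Omega_{n+1}=\omega^{\Omega_n}$. Fundamental sequences: $(\gamma+\omega^{\beta+1})_n=\gamma+\omega^\beta\cdot n$ (with $\omega^\beta\cdot n=\omega^\beta+\cdots+\omega^\beta$, $n$ summands), $(\gamma+\omega^{\lambda'})_n=\gamma+\omega^{\lambda'_n}$ for limit $\lambda'$. Hardy functions: $H^0(n)=n$, $H^{\alpha+1}(n)=H^\alpha(n+1)$, $H^\lambda(n)=H^{\lambda_n}(n)$ for limit terms $\lambda$. Codes: $\Sigma_d=\{0,\ldots,d\}$; $C_{-1}=\{\epsilon\}$ and $C_a=(C_{a-1}\,a)^*$ for $0\le a\le d$. For a term $\alpha<\Omega_{a+1}$ the code $s_a(\alpha)\in C_a$ is given by $s_a(\gamma_1+\cdots+\gamma_p)=s_a(\gamma_1)\cdots s_a(\gamma_p)$ for summands $\gamma_i=\omega^{\alpha_i}$, $s_a(\omega^\alpha)=s_{a-1}(\alpha)\,a$,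 $s_a(0)=\epsilon$ (also $s_{-1}(0)=\epsilon$). Write $s=s_d$. A $(d+1)$-PCS is a tuple $(\Sigma_{d+1},\mathrm{Ch},Q,\Delta)$ with $\mathrm{Ch}=\{c_1,\ldots,c_m\}$ a finite set of channels, $Q$ a finite set of states, and $\Delta\subseteq Q\times\mathrm{Ch}\times\{!,?\}\times\Sigma_{d+1}\times Q$. Configurations are elements of $Q\times(\Sigma_{d+1}^* )^m$. Write-superseding steps $\to_{\mathrm w}$: a read rule $(q,c_i?a,q')$ gives $(q,x_1,\ldots,x_m)\to_{\mathrm w}(q',y_1,\ldots,y_m)$ if $x_i=a\,y_i$ and $x_j=y_j$ for $j\ne i$; a write rule $(q,c_i!a,q')$ gives such a step if $x_j=y_j$ for $j\neq i$ and $y_i=z\,a$ for some factorization $x_i=z\,z'$ with all letters of $z'$ at most $a$. The letter $d+1$ is written $\$$. A weak Hardy computer for $\Omega_{d+1}$ is a $(d+1)$-PCS with three channels (whose contents are listed in the order $\mathsf o,\mathsf c,\mathsf t$) and two distinguished states $p_{\mathrm{beg}}$, $p_{\mathrm{end}}$ such that: (safety) for $x,y,z\in\Sigma_d^*$, if $(p_{\mathrm{beg}},x\$,y\$,z\$)\to_{\mathrm w}^*(p_{\mathrm{end}},u,v,w)$ then $x\in C_d$, $y\in 0^+$, $z=\epsilon$ and $u,v,w\in\Sigma_d^*\$$; (robustness) if $(p_{\mathrm{beg}},s(\alpha)\$,0^n\$,\$)\to_{\mathrm w}^*(p_{\mathrm{end}},s(\beta)\$,0^m\$,\$)$ then $H^\alpha(n)\ge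 H^\beta(m)$. It is complete if for every term $\alpha<\Omega_{d+1}$ and $n>0$, with $m=H^\alpha(n)$, $(p_{\mathrm{beg}},s(\alpha)\$,0^n\$,\$)\to_{\mathrm w}^*(p_{\mathrm{end}},\$,0^m\$,\$)$; it is inv-complete if for every term $\alpha<\Omega_{d+1}$ and $n>0$, with $m=H^\alpha(n)$, $(p_{\mathrm{beg}},\$,0^m\$,\$)\to_{\mathrm w}^*(p_{\mathrm{end}},s(\alpha)\$,0^n\$,\$)$. *)

(* Defs.v *)
From Stdlib Require Export Relation_Operators.
From mathcomp Require Export all_boot.

Set Implicit Arguments.
Unset Strict Implicit.
Unset Printing Implicit Defensive.

(* [Tcons a b] is the term omega^a + b.  As + is associative with neutral
   element 0, a term is the same thing as the list of the exponents of its
   summands; no condition is put on their order. *)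
Inductive oterm := Tzero | Tcons (a b : oterm).

Fixpoint tadd (a b : oterm) : oterm :=
  if a is Tcons e r then Tcons e (tadd r b) else b.

Definition wexp (a : oterm) : oterm := Tcons a Tzero.

Definition tone : oterm := wexp Tzero.

Definition tmul (a : oterm) (n : nat) : oterm := iter n (tadd a) Tzero.

Fixpoint is_succ (a : oterm) : bool :=
  match a with
  | Tzero => false
  | Tcons Tzero Tzero => true
  | Tcons (Tcons _ _) Tzero => false
  | Tcons _ r => is_succ r
  end.

Definition is_limit (a : oterm) : bool :=
  if a is Tzero then false else ~~ is_succ a.

Fixpoint Omega (n : nat) : oterm :=
  if n is n'.+1 then wexp (Omega n') else tone.

(* Set-theoretic ordinals: [Osup f] is the least ordinal strictly above all
   the [f i].  Different trees may represent the same ordinal; [ole] and [olt]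
   are the order on the represented ordinals. *)
Inductive Ord := Osup (I : Type) (f : I -> Ord).

Fixpoint ole (x y : Ord) {struct x} : Prop :=
  match x, y with
  | Osup _ f, Osup _ g => forall i, exists j, ole (f i) (g j)
  end.

Definition olt (x y : Ord) : Prop :=
  match y with Osup _ g => exists j, ole x (g j) end.

Definition Ozero : Ord := Osup (fun i : void => match i with end).

(* x + y is the least ordinal above all z < x and all x + z with z < y. *)
Fixpoint oadd (x y : Ord) {struct y} : Ord :=
  match x, y with
  | Osup A f, Osup B g =>
      Osup (fun k : A + B =>
              match k with inl i => f i | inr j => oadd x (g j) end)
  end.

Definition omuln (x : Ord) (n : nat) : Ord := iter n (oadd^~ x) Ozero.

(* omega^y is the least ordinal above 0 and all omega^z * n with z < y. *)
Fixpoint owexp (y : Ord) : Ord :=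
  match y with
  | Osup B g =>
      Osup (fun k : option (B * nat) =>
              if k is Some (j, n) then omuln (owexp (g j)) n else Ozero)
  end.

Fixpoint denote (a : oterm) : Ord :=
  if a is Tcons e r then oadd (owexp (denote e)) (denote r) else Ozero.

Definition tlt (a b : oterm) : Prop := olt (denote a) (denote b).

(* The term without its last summand: b when a is b + 1. *)
Fixpoint tpred (a : oterm) : oterm :=
  match a with
  | Tcons _ Tzero => Tzero
  | Tcons e r => Tcons e (tpred r)
  | Tzero => Tzero
  end.

(* Only meaningful on limit terms. *)
Fixpoint fund (a : oterm) (n : nat) : oterm :=
  match a with
  | Tzero => Tzero
  | Tcons e Tzero =>
      if is_succ e then tmul (wexp (tpred e)) n else wexp (fund e n)
  | Tcons e r => Tcons e (fund r n)
  end.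

Lemma tadd0 a : tadd a Tzero = a.
Proof. by elim: a => //= e _ r ->. Qed.

Lemma taddA a b c : tadd a (tadd b c) = tadd (tadd a b) c.
Proof. by elim: a => //= e _ r ->. Qed.

Lemma tadd_neq0 a e r : exists e' r', tadd a (Tcons e r) = Tcons e' r'.
Proof. by case: a => [|e' r'] /=; [exists e, r | exists e', (tadd r' (Tcons e r))]. Qed.

Lemma is_succ_wexp g e :
  is_succ (tadd g (wexp e)) = if e is Tzero then true else false.
Proof.
elim: g => [|e' _ r IH] /=; first by case: e.
by move: IH; have [e1 [r1 ->]] := tadd_neq0 r e Tzero; case: e'.
Qed.

Lemma tpred_wexp g e : tpred (tadd g (wexp e)) = g.
Proof.
elim: g => [|e' _ r IH] //=.
by move: IH; have [e1 [r1 ->]] := tadd_neq0 r e Tzero => ->.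
Qed.

Lemma is_succP a : is_succ a -> a = tadd (tpred a) tone.
Proof.
elim: a => [|e _ r] //; case: r => [_|e' r' IH]; first by case: e.
by rewrite /= => h; rewrite -IH //; case: e h.
Qed.

Lemma fund_wexp_succ g b n :
  fund (tadd g (wexp (tadd b tone))) n = tadd g (tmul (wexp b) n).
Proof.
elim: g => [|e _ r IH] /=; first by rewrite is_succ_wexp tpred_wexp.
by move: IH; have [e1 [r1 ->]] := tadd_neq0 r (tadd b tone) Tzero => ->.
Qed.

Lemma fund_wexp_limit g l n :
  is_limit l -> fund (tadd g (wexp l)) n = tadd g (wexp (fund l n)).
Proof.
move=> hl; elim: g => [|e _ r IH] /=.
  by case: l hl => // e r /negbTE ->.
by move: IH; have [e1 [r1 ->]] := tadd_neq0 r l Tzero => ->.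
Qed.

Inductive hardy_graph : oterm -> nat -> nat -> Prop :=
| Hardy0 n : hardy_graph Tzero n n
| HardyS a n m : hardy_graph a n.+1 m -> hardy_graph (tadd a tone) n m
| HardyL a n m :
    is_limit a -> hardy_graph (fund a n) n m -> hardy_graph a n m.

Lemma hardy_graph_inv a n m : hardy_graph a n m ->
  [\/ a = Tzero /\ m = n,
      exists b, a = tadd b tone /\ hardy_graph b n.+1 m |
      is_limit a /\ hardy_graph (fund a n) n m].
Proof.
case=> {a n m} [n|b n m h|a n m la h].
- by constructor 1.
- by constructor 2; exists b.
- by constructor 3.
Qed.

Lemma hardy_graph_fun a n m m' :
  hardy_graph a n m -> hardy_graph a n m' -> m = m'.
Proof.
have S0 b : is_succ (tadd b tone) by rewrite is_succ_wexp.
have L0 b : is_limit (tadd b tone) = false by case: (tadd b tone) (S0 b) => //= e r ->.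
move=> h; elim: h m' => {a n m} [n|a n m _ IH|a n m la _ IH] m' /hardy_graph_inv [].
- by case.
- by case=> b [e _]; have := S0 b; rewrite -e.
- by case.
- by case=> e; have := S0 a; rewrite e.
- by case=> b [/(congr1 tpred)]; rewrite !tpred_wexp => <- /IH.
- by rewrite L0; case.
- by case=> e; rewrite e in la.
- by case=> b [e _]; rewrite e L0 in la.
- by case=> _ /IH.
Qed.

Definition hardy_step (b a : oterm) : Prop :=
  a = tadd b tone \/ is_limit a /\ exists n, b = fund a n.

Lemma hardy_step_wf : well_founded hardy_step.
Proof.
have acc0 : Acc hardy_step Tzero.
  apply: Acc_intro => b [/(congr1 is_succ)|[//]]; first by rewrite is_succ_wexp.
have good e : Acc hardy_step e ->
    forall g, Acc hardy_step g -> Acc hardy_step (tadd g (wexp e)).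
  elim=> {}e _ IH g hg; apply: Acc_intro => b [|[lim [n ->]]].
    by move=> /(congr1 tpred); rewrite !tpred_wexp => <-.
  have [se|nse] := boolP (is_succ e).
    rewrite (is_succP se) fund_wexp_succ.
    elim: n g hg {lim} => [|n IHn] g hg; first by rewrite tadd0.
    rewrite (taddA g (wexp (tpred e)) (tmul (wexp (tpred e)) n)).
    exact: IHn _ (IH _ (or_introl (is_succP se)) g hg).
  have le : is_limit e.
    case: e nse lim {IH} => //= _.
    have [e1 [r1 E]] := tadd_neq0 g Tzero Tzero.
    by have := is_succ_wexp g Tzero; rewrite /wexp E /= => ->.
  rewrite (fund_wexp_limit g n le).
  exact: (IH (fund e n) (or_intror (conj le (ex_intro _ n erefl))) g hg).
have main a : forall g, Acc hardy_step g -> Acc hardy_step (tadd g a).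
  elim: a => [|e IHe r IHr] g hg; first by rewrite tadd0.
  rewrite (taddA g (wexp e) r).
  exact: IHr _ (good e (IHe Tzero acc0) g hg).
move=> a; exact: main a Tzero acc0.
Qed.

Definition hardy_sig (a : oterm) (n : nat) : {m | hardy_graph a n m}.
Proof.
elim/(well_founded_induction_type hardy_step_wf): a n => a IH n.
have [sa|nsa] := boolP (is_succ a).
  have ea := is_succP sa.
  have [m hm] := IH (tpred a) (or_introl ea) n.+1.
  by exists m; rewrite ea; apply: HardyS.
case: a IH nsa => [_ _|e r IH nsa]; first by exists n; apply: Hardy0.
have la : is_limit (Tcons e r) by [].
have st : hardy_step (fund (Tcons e r) n) (Tcons e r).
  by right; split=> //; exists n.
by have [m hm] := IH _ st n; exists m; apply: HardyL.
Qed.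

Definition hardy (a : oterm) (n : nat) : nat := proj1_sig (hardy_sig a n).

Lemma hardyP a n : hardy_graph a n (hardy a n).
Proof. exact: proj2_sig (hardy_sig a n). Qed.

Lemma hardy_0 n : hardy Tzero n = n.
Proof. exact: hardy_graph_fun (hardyP _ _) (Hardy0 n). Qed.

Lemma hardy_succ a n : hardy (tadd a tone) n = hardy a n.+1.
Proof. exact: hardy_graph_fun (hardyP _ _) (HardyS (hardyP _ _)). Qed.

Lemma hardy_limit a n : is_limit a -> hardy a n = hardy (fund a n) n.
Proof.
by move=> la; apply: hardy_graph_fun (hardyP _ _) (HardyL la (hardyP _ _)).
Qed.

(* Sigma_d is ['I_d.+1]. *)
Notation word d := (seq 'I_d.+1).

Definition chan_op := bool.
Definition op_write : chan_op := true.  (* ! *)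
Definition op_read : chan_op := false.  (* ? *)

Definition pcs_rule (Q : Type) (d m : nat) : Type :=
  (Q * 'I_m * chan_op * 'I_d.+1 * Q)%type.

Record pcs (d m : nat) := Pcs {
  pcs_state :> finType;
  pcs_rules : {set pcs_rule pcs_state d m}
}.

Definition pcs_config (d m : nat) (S : pcs d m) : Type :=
  (S * m.-tuple (word d))%type.

(* Write-superseding steps; channels are read at their left end. *)
Inductive wstep (d m : nat) (S : pcs d m) :
    pcs_config S -> pcs_config S -> Prop :=
| WRead (q q' : S) (i : 'I_m) (a : 'I_d.+1) (x y : m.-tuple (word d)) :
    (q, i, op_read, a, q') \in pcs_rules S ->
    tnth x i = a :: tnth y i ->
    (forall j, j != i -> tnth x j = tnth y j) ->
    wstep (q, x) (q', y)
| WWrite (q q' : S) (i : 'I_m) (a : 'I_d.+1) (x y : m.-tuple (word d))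
    (z z' : word d) :
    (q, i, op_write, a, q') \in pcs_rules S ->
    tnth x i = z ++ z' ->
    all (fun b : 'I_d.+1 => b <= a) z' ->
    tnth y i = rcons z a ->
    (forall j, j != i -> tnth x j = tnth y j) ->
    wstep (q, x) (q', y).

Definition wsteps (d m : nat) (S : pcs d m) :
    pcs_config S -> pcs_config S -> Prop :=
  clos_refl_trans (pcs_config S) (@wstep d m S).

(* Levels start at -1 in the mathematics and at 0 here: [in_code k] is C_(k-1)
   and [code k] is s_(k-1), over the alphabet Sigma_N. *)
Fixpoint in_code (N k : nat) (w : word N) : Prop :=
  if k is k'.+1 then
    exists us : seq (word N),
      (forall u, u \in us -> in_code k' u) /\
      w = flatten [seq rcons u (inord k') | u <- us]
  else w = [::].

(* Only meaningful for terms below Omega k, and for k <= N.+1. *)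
Fixpoint code (N k : nat) (a : oterm) {struct a} : word N :=
  match a, k with
  | Tcons e r, k'.+1 => code N k' e ++ inord k' :: code N k r
  | _, _ => [::]
  end.

Record hardy_system (d : nat) := HardySystem {
  hs_pcs :> pcs d.+1 3;
  hs_beg : hs_pcs;
  hs_end : hs_pcs
}.

Section WeakHardy.

Variables (d : nat) (S : hardy_system d).

Let letter : Type := 'I_d.+2.

Definition dollar : letter := ord_max.

Definition s_code (a : oterm) : word d.+1 := code d.+1 d.+1 a.

(* Words over Sigma_d, as words over Sigma_(d+1). *)
Definition lowword (w : word d.+1) : Prop := forall a, a \in w -> a <= d.

(* Configurations; channel contents are listed in the order o, c, t. *)
Definition conf (p : S) (x y z : word d.+1) : pcs_config S :=
  (p, [tuple x; y; z]).

Definition hardy_conf (p : S) (a : oterm) (n : nat) : pcs_config S :=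
  conf p (rcons (s_code a) dollar) (rcons (nseq n ord0) dollar) [:: dollar].

Definition safe : Prop :=
  forall x y z u v w : word d.+1,
    lowword x -> lowword y -> lowword z ->
    wsteps (conf (hs_beg S) (rcons x dollar) (rcons y dollar) (rcons z dollar))
           (conf (hs_end S) u v w) ->
    [/\ in_code d.+1 x,
        exists n, 0 < n /\ y = nseq n ord0,
        z = [::] &
        exists u' v' w',
          [/\ lowword u', lowword v' & lowword w'] /\
          [/\ u = rcons u' dollar, v = rcons v' dollar & w = rcons w' dollar]].

Definition robust : Prop :=
  forall (a b : oterm) (n m : nat),
    tlt a (Omega d.+1) -> tlt b (Omega d.+1) ->
    wsteps (hardy_conf (hs_beg S) a n) (hardy_conf (hs_end S) b m) ->
    hardy b m <= hardy a n.

Definition weak_hardy : Prop := safe /\ robust.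

Definition complete : Prop :=
  forall (a : oterm) (n : nat), tlt a (Omega d.+1) -> 0 < n ->
    wsteps (hardy_conf (hs_beg S) a n)
           (hardy_conf (hs_end S) Tzero (hardy a n)).

Definition inv_complete : Prop :=
  forall (a : oterm) (n : nat), tlt a (Omega d.+1) -> 0 < n ->
    wsteps (hardy_conf (hs_beg S) Tzero (hardy a n))
           (hardy_conf (hs_end S) a n).

End WeakHardy.

Inductive move := MoveL | Stay | MoveR.

Inductive incell (In : Type) := LeftEnd | RightEnd | Letter of In.
Arguments LeftEnd {In}.
Arguments RightEnd {In}.

(* Deterministic Turing machines with a two-way read-only input tape with end
   markers, [tm_tapes] work tapes unbounded to the right, and a one-way
   write-only output tape.  A transition to [None] means halting. *)
Record transducer (In Out : finType) := Transducer {
  tm_state : finType;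
  tm_sym : finType;
  tm_blank : tm_sym;
  tm_tapes : nat;
  tm_start : tm_state;
  tm_delta : tm_state -> incell In -> tm_tapes.-tuple tm_sym ->
    option (tm_state * move * tm_tapes.-tuple (tm_sym * move) * option Out)
}.

Section Runs.

Variables (In Out : finType) (M : transducer In Out) (x : seq In).

(* Head position and content; the cells beyond the content are blank. *)
Definition tape : Type := (nat * seq (tm_sym M))%type.

Record tm_config := TMConfig {
  tc_state : tm_state M;
  tc_in : nat;
  tc_work : (tm_tapes M).-tuple tape;
  tc_out : seq Out
}.

Definition read_input (p : nat) : incell In :=
  if p is p'.+1 then nth RightEnd (map (@Letter In) x) p' else LeftEnd.

Definition move_input (mv : move) (p : nat) : nat :=
  match mv with
  | MoveL => p.-1
  | Stay => p
  | MoveR => minn p.+1 (size x).+1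
  end.

Definition read_tape (t : tape) : tm_sym M := nth (tm_blank M) t.2 t.1.

Definition write_tape (t : tape) (a : tm_sym M * move) : tape :=
  (match a.2 with MoveL => t.1.-1 | Stay => t.1 | MoveR => t.1.+1 end,
   set_nth (tm_blank M) t.2 t.1 a.1).

Definition tm_init : tm_config :=
  TMConfig (tm_start M) 0 (nseq_tuple (tm_tapes M) (0, [::])) [::].

Definition tm_step (c : tm_config) : option tm_config :=
  if @tm_delta _ _ M (tc_state c) (read_input (tc_in c))
       (map_tuple read_tape (tc_work c)) is Some (q, mv, acts, o)
  then Some (TMConfig q (move_input mv (tc_in c))
         [tuple write_tape (tnth (tc_work c) i) (tnth acts i)
           | i < tm_tapes M]
         (if o is Some b then rcons (tc_out c) b else tc_out c))
  else None.

(* [None] once the machine has halted. *)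
Definition tm_run (t : nat) : option tm_config :=
  iter t (obind tm_step) (Some tm_init).

Definition tm_outputs (w : seq Out) : Prop :=
  exists t c, [/\ tm_run t = Some c, tm_step c = None & tc_out c = w].

(* Only the cells 0, ..., s - 1 of each work tape are visited; neither the
   input nor the output tape counts. *)
Definition tm_space (s : nat) : Prop :=
  forall t c, tm_run t = Some c -> all (fun tp : tape => tp.1 < s) (tc_work c).

End Runs.

(* [inl b] is a bit, [inr false] ends a field and [inr true] ends a record. *)
Definition out_sym : finType := (bool + bool)%type.

Definition write_word (u : seq bool) : seq out_sym :=
  rcons (map inl u) (inr false).

Definition write_nat (n : nat) : seq out_sym := write_word (nseq n true).

Definition end_record : seq out_sym := [:: inr true].

Definition write_rule (Q : Type) (name : Q -> seq bool) (d m : nat)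
    (r : pcs_rule Q d m) : seq out_sym :=
  let: (q, i, o, a, q') := r in
  write_word (name q) ++ write_nat i ++ write_word [:: o] ++ write_nat a ++
  write_word (name q') ++ end_record.

(* w is a written form of S: the largest letter, the number of channels, the
   two distinguished states, the list of the states and the list of the rules.
   States are named by distinct binary words; numbers, which are here at most
   max(d+1, 3), are in unary.  The enumeration orders are irrelevant. *)
Definition describes (d : nat) (S : hardy_system d) (w : seq out_sym) : Prop :=
  exists (name : S -> seq bool) (qs : seq S) (rs : seq (pcs_rule S d.+1 3)),
    [/\ injective name, qs =i [set: S], rs =i pcs_rules S &
        w = write_nat d.+1 ++ write_nat 3 ++
            write_word (name (hs_beg S)) ++ write_word (name (hs_end S)) ++
            end_record ++
            flatten [seq write_word (name q) | q <- qs] ++ end_record ++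
            flatten [seq write_rule name r | r <- rs]].

(* One machine generates all the S d; d is given to it in unary. *)
Definition logspace_uniform (S : forall d, hardy_system d) : Prop :=
  exists (M : transducer unit out_sym) (c : nat), forall d : nat,
    tm_space M (nseq d tt) (c * (trunc_log 2 d).+1) /\
    exists w, tm_outputs M (nseq d tt) w /\ describes (S d) w.

(* Main.v *)
(** One channel system serves in both roles.  On the channels, codes are the words
    in which a letter exceeds its predecessor by at most one, and superseding only
    produces words that embed in the intended one for the priority embedding; on
    codes this embedding refines the structural order of terms, for which Hardy
    functions are monotone.  The system nondeterministically performs, forwards or
    backwards, one Hardy step: (a+1, n) <-> (a, n+1), or the limit step, which on
    codes exchanges w u (e-1) e (e+1) ... d and w (u e)^n (e+1) ... d, where u has
    letters below e and w is empty or ends with a letter at least e.  The counter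
    channel drives n passes over a copy of u held in the temporary channel.  Since
    every step preserves H^a(n) up to losses that can only decrease it, the system
    is safe and robust, and its lossless runs make it both complete and
    inv-complete.  Its rules are the instances, at letters x, y and z, of finitely
    many templates guarded by inequalities between x, y, z and d+1, so three nested
    loops over binary counters list them in logarithmic space. *)
Require Import Defs.
From mathcomp Require Import all_boot.
From HB Require Import structures.
From mathcomp Require Import zify.

Set Implicit Arguments.
Unset Strict Implicit.
Unset Printing Implicit Defensive.

(** * Hardy functions and the structural order on terms *)

(** Hardy functions are not monotone in the ordinal (for [m > n] the value of [m] at [n] exceeds
    that of omega), so losses have to be measured by a finer order. They are one-sided: with
    [E = d+1] as terminator, a smaller letter cannot supersede [E], hence a write damages only what
    lies behind the terminator, and only writing [E] again can cut off the end of a word. The actual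
    contents are never tracked. With [M] the Hardy value of the start, a control state promises
    [ok x k]: every code that could remain of [x], at every argument up to [k], has value at most
    [M]. This passes to embedded words, so only the four exact steps [ok_pred], [ok_succ],
    [ok_unfold], [ok_fold] need ordinals. Folding is the hardest: the guessed copy in channel t may
    shrink while it is compared with the copies in o. The remedy is a bound for all words below the
    current content of t, used at the end for the word that is emitted. Monotonicity in the term
    fails at argument 0 (the term 1 has value 1 there, omega has value 0). Unfolding at 0 is rescued
    by a direct embedding; folding is made to require at least one zero on the counter. *)

Inductive tle : oterm -> oterm -> Prop :=
| tle0 b : tle Tzero b
| tle_cons e e' r r' : tle e e' -> tle r r' -> tle (Tcons e r) (Tcons e' r')
| tle_skip a e r : tle a r -> tle a (Tcons e r).

#[local] Hint Constructors tle : core.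

Lemma tle_refl a : tle a a.
Proof. by elim: a => //= e he r hr; apply: tle_cons. Qed.
#[local] Hint Resolve tle_refl : core.

Lemma tle_inv a e r : tle a (Tcons e r) ->
  [\/ a = Tzero, exists e' r', [/\ a = Tcons e' r', tle e' e & tle r' r] | tle a r].
Proof.
move=> h; inversion h; subst; first by constructor 1.
- by constructor 2; eexists; eexists; split.
- by constructor 3.
Qed.

Lemma tle_trans b a c : tle a b -> tle b c -> tle a c.
Proof.
move=> ab bc; elim: bc a ab => {b c} [b|e e' r r' _ IHe _ IHr|b e r _ IH] a ab.
- by inversion ab.
- have [->//|[e1 [r1 [-> h1 h2]]]|h] := tle_inv ab.
    by apply: tle_cons; [apply: IHe|apply: IHr].
  by apply: tle_skip; apply: IHr.
- by apply: tle_skip; apply: IH.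
Qed.

Lemma tle_add a a' b b' : tle a a' -> tle b b' -> tle (tadd a b) (tadd a' b').
Proof.
move=> ha hb; elim: ha => {a a'} [a|e e' r r' he _ _ hr|a e r _ IH] /=; last by apply: tle_skip.
  by elim: a => //= e _ r IH; apply: tle_skip.
by apply: tle_cons.
Qed.

Lemma tle_addr a b : tle a (tadd a b).
Proof. by rewrite -{1}(tadd0 a); apply: tle_add. Qed.

Lemma tle_mul a b n m : tle a b -> n <= m -> tle (tmul a n) (tmul b m).
Proof.
move=> ab; elim: n m => [|n IH] [|m] //= h; rewrite /tmul /=; apply: tle_add => //.
exact: IH.
Qed.

Lemma tle_wexp a b : tle a b -> tle (wexp a) (wexp b).
Proof. by move=> h; apply: tle_cons. Qed.

Lemma oterm_last a : a = Tzero \/ exists g e, a = tadd g (wexp e).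
Proof.
elim: a => [|e _ r [->|[g [e' ->]]]]; first by left.
- by right; exists Tzero, e.
- by right; exists (Tcons e g), e'.
Qed.

Lemma tle_last a g e : tle a (tadd g (wexp e)) ->
  tle a g \/ exists g' e', [/\ a = tadd g' (wexp e'), tle g' g & tle e' e].
Proof.
elim: g a => [|e1 _ r IH] a /= /tle_inv [->|[e' [r' [-> h1 h2]]]|h]; try by left.
- by inversion h2; subst; right; exists Tzero, e'.
- have [h|[g' [e2 [-> h3 h4]]]] := IH _ h2; first by left; apply: tle_cons.
  by right; exists (Tcons e' g'), e2; split => //; apply: tle_cons.
- have [h3|[g' [e2 [-> h3 h4]]]] := IH _ h; first by left; apply: tle_skip.
  by right; exists g', e2; split => //; apply: tle_skip.
Qed.

Lemma is_limit_wexp g e : is_limit (tadd g (wexp e)) = (if e is Tzero then false else true).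
Proof.
rewrite /is_limit; have [e' [r' E]] := tadd_neq0 g e Tzero.
by have := is_succ_wexp g e; rewrite /wexp E => ->; case: e {E}.
Qed.

Lemma succ_or_limit e : e <> Tzero ->
  (exists b, e = tadd b tone) \/ is_limit e.
Proof.
case: (boolP (is_succ e)) => [/is_succP -> _|h he]; first by left; exists (tpred e).
by right; case: e h he.
Qed.

Fixpoint osize (a : oterm) : nat :=
  if a is Tcons e r then (osize e + osize r).+1 else 0.

Lemma osize_add a b : osize (tadd a b) = osize a + osize b.
Proof. by elim: a => //= e _ r ->; rewrite addnA. Qed.

(** Induction along the two clauses of the fundamental sequences, so that [fund] never has to be
    unfolded on lists of exponents. *)
Lemma limit_ind (P : oterm -> Prop) :
  (forall g b, P (tadd g (wexp (tadd b tone)))) ->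
  (forall g l, is_limit l -> P l -> P (tadd g (wexp l))) ->
  forall l, is_limit l -> P l.
Proof.
move=> h1 h2 l; have [n] := ubnP (osize l); elim: n l => // n IH l hn hl.
have [E|[g [e E]]] := oterm_last l; first by rewrite E in hl.
have ne : e <> Tzero by move=> E'; move: hl; rewrite E is_limit_wexp E'.
have [[b Eb]|le] := succ_or_limit ne; first by rewrite E Eb.
rewrite E; apply: h2 => //; apply: IH => //.
by move: hn; rewrite E osize_add /=; lia.
Qed.

Lemma fund_mono l n m : is_limit l -> n <= m -> tle (fund l n) (fund l m).
Proof.
move=> hl nm; move: l hl; apply: limit_ind => [g b|g l hl IH].
- by rewrite !fund_wexp_succ; apply: tle_add => //; apply: tle_mul.
- by rewrite !fund_wexp_limit //; apply: tle_add => //; apply: tle_wexp.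
Qed.

Lemma tle_fund l n : is_limit l -> 0 < n -> forall a, tle a l ->
  tle a (fund l n) \/ is_limit a /\ tle (fund a n) (fund l n).
Proof.
move=> hl n0; move: l hl; apply: limit_ind => [g b|g l hl IH] a /tle_last.
- rewrite fund_wexp_succ => -[h|[g' [e' [-> hg he]]]].
    by left; apply: tle_trans h (tle_addr _ _).
  have [h|[g2 [e2 [Ee h1 h2]]]] := tle_last he.
    left; apply: tle_add => //; case: n n0 => // n _.
    by rewrite /tmul /=; apply: tle_cons.
  inversion h2; subst e2; right; rewrite Ee is_limit_wexp; split.
    by case: (g2).
  by rewrite (fund_wexp_succ g' g2); apply: tle_add => //; apply: tle_mul => //; apply: tle_wexp.
- rewrite fund_wexp_limit // => -[h|[g' [e' [-> hg /IH]]]].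
    by left; apply: tle_trans h (tle_addr _ _).
  case=> [h|[le h]]; first by left; apply: tle_add => //; apply: tle_wexp.
  right; rewrite is_limit_wexp fund_wexp_limit //; split; first by case: (e') le.
  by apply: tle_add => //; apply: tle_wexp.
Qed.

(** Monotonicity in the argument and in the term need each other: at a limit, passing from [n] to
    [n.+1] also replaces [fund b n] by the larger term [fund b n.+1]. The induction follows the
    Hardy steps of the larger term [b] only. *)
Lemma hardy_mono_aux b :
  (forall n, hardy b n <= hardy b n.+1) /\
  (forall a n, tle a b -> 0 < n -> hardy a n <= hardy b n).
Proof.
elim/(well_founded_ind hardy_step_wf): b => b IH.
have H0 a n : tle a Tzero -> hardy a n <= hardy Tzero n by move=> h; inversion h.
have [->|nb] : b = Tzero \/ b <> Tzero by case: (b); [left|right].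
  by split=> [n|a n h _]; [rewrite !hardy_0|apply: H0].
have [[g Eg]|lb] := succ_or_limit nb.
  have [IH1 IH2] := IH g (or_introl Eg); rewrite Eg; split=> [n|a n].
    by rewrite !hardy_succ.
  rewrite hardy_succ => /tle_last [h|[g' [e' [-> h1 h2]]]] n0.
    exact: leq_trans (IH2 _ _ h n0) (IH1 n).
  by inversion h2; subst; rewrite hardy_succ; apply: IH2.
have st n : hardy_step (fund b n) b by right; split => //; exists n.
split=> [n|a n h n0].
  rewrite !(hardy_limit _ lb); have [IH1 _] := IH _ (st n); have [_ IH2] := IH _ (st n.+1).
  by apply: leq_trans (IH1 _) _; apply: IH2 => //; apply: fund_mono.
rewrite (hardy_limit _ lb); have [_ IH2] := IH _ (st n).
have [h1|[la h1]] := tle_fund lb n0 h; first exact: IH2.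
by rewrite (hardy_limit _ la); apply: IH2.
Qed.

Lemma hardy_mono a n m : n <= m -> hardy a n <= hardy a m.
Proof.
move=> /subnKC <-; elim: (m - n) => [|k IH]; first by rewrite addn0.
by rewrite addnS; apply: leq_trans IH (proj1 (hardy_mono_aux a) _).
Qed.

Lemma hardy_tle a b n : tle a b -> 0 < n -> hardy a n <= hardy b n.
Proof. exact: (proj2 (hardy_mono_aux b)). Qed.

(** * Set-theoretic bounds replaced by the nesting depth of terms *)

Fixpoint height (a : oterm) : nat :=
  if a is Tcons e r then maxn (height e).+1 (height r) else 0.

Lemma ole_refl x : ole x x.
Proof. by elim: x => I f IH /= i; exists i. Qed.

Lemma ole_trans x y z : ole x y -> ole y z -> ole x z.
Proof.
elim: x y z => I f IH [J g] [K h] /= xy yz i.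
by have [j fj] := xy i; have [k gk] := yz j; exists k; apply: IH fj gk.
Qed.

Lemma ole_olt_trans x y z : ole x y -> olt y z -> olt x z.
Proof. by case: z => K h xy [k hk]; exists k; apply: ole_trans xy hk. Qed.

Lemma olt_irr x : ~ olt x x.
Proof.
elim: x => I f IH [i fi]; apply: (IH i).
move: fi; move E: (f i) => y; case: y E => K h E /=.
by move=> /(_ i) [j hj]; exists j; move: hj; rewrite E.
Qed.

Lemma oadd_lel x y : ole x (oadd x y).
Proof. by case: x y => A f [B g] /= i; exists (inl i); apply: ole_refl. Qed.

Lemma oadd_ler x y : ole y (oadd x y).
Proof. by elim: y => B g IH; case: x IH => A f IH /= j; exists (inr j); apply: IH. Qed.

Lemma oadd_le x x' y y' : ole x x' -> ole y y' -> ole (oadd x y) (oadd x' y').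
Proof.
elim: y y' => B g IH [B' g'] hx hy.
case: x x' hx IH => A f [A' f'] hx IH /= [i|j].
  by have [i' h] := hx i; exists (inl i').
by have [j' h] := hy j; exists (inr j'); apply: IH.
Qed.

Lemma omuln_le x y n : ole x y -> ole (omuln x n) (omuln y n).
Proof. by move=> h; elim: n => [|n IH]; [apply: ole_refl|apply: oadd_le]. Qed.

Lemma owexp_le x y : ole x y -> ole (owexp x) (owexp y).
Proof.
elim: x y => A f IH [B g] h /= [[i n]|]; last by exists None => /= -[].
by have [j fj] := h i; exists (Some (j, n)) => /=; apply: omuln_le; apply: IH.
Qed.

Lemma ole_oadd0 x : ole (oadd x Ozero) x.
Proof. by case: x => A f /= [i|[]]; exists i; apply: ole_refl. Qed.

(** A branch of nesting depth [k.+1] is a tower of [k] exponentials over a summand 1, and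
    neighbouring summands on either side only increase the ordinal. *)
Lemma ole_Omega a k : k < height a -> ole (denote (Omega k)) (denote a).
Proof.
elim: a k => // e IHe r IHr k /=; rewrite leq_max => /orP[h|h]; last first.
  exact: ole_trans (IHr _ h) (oadd_ler _ _).
apply: ole_trans (oadd_lel _ _).
have main x : ole x (denote e) -> ole (oadd (owexp x) Ozero) (owexp (denote e)).
  by move=> hx; apply: ole_trans (ole_oadd0 _) (owexp_le hx).
case: k h => [|k] h; apply: main; first by case: (denote e) => I f [].
exact: IHe.
Qed.

Lemma tlt_height a k : tlt a (Omega k) -> height a <= k.
Proof.
move=> h; rewrite leqNgt; apply/negP => /ole_Omega h2.
exact: olt_irr (ole_olt_trans h2 h).
Qed.

(** * Priority embedding and codes *)

Inductive emb : seq nat -> seq nat -> Prop :=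
| emb_nil : emb [::] [::]
| emb_cons a x y : emb x y -> emb (a :: x) (a :: y)
| emb_del a b x y : b <= a -> emb (a :: x) y -> emb (a :: x) (b :: y).

Lemma emb_refl x : emb x x.
Proof. by elim: x => [|a x IH]; constructor. Qed.
#[local] Hint Resolve emb_refl : core.

Lemma emb_consI x b y : emb x (b :: y) ->
  exists a x', x = a :: x' /\ ((a = b /\ emb x' y) \/ (b <= a /\ emb x y)).
Proof. by move=> h; inversion h; subst; do 2 eexists; split; eauto. Qed.

Lemma emb_nilI x : emb x [::] -> x = [::].
Proof. by move=> h; inversion h. Qed.

Lemma emb_trans y x z : emb x y -> emb y z -> emb x z.
Proof.
move=> xy yz; elim: yz x xy => {y z} [|a y z _ IH|a b y z ba _ IH] x // xy.
- have [c [x' [E [[e h]|[e h]]]]] := emb_consI xy; rewrite E.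
    by rewrite e; apply/emb_cons/IH.
  by apply: emb_del => //; rewrite -E; apply: IH.
- have [c [x' [E h]]] := emb_consI xy; rewrite E; apply: emb_del; last by rewrite -E; apply: IH.
  by case: h => -[]; lia.
Qed.

Lemma emb_cat x y x' y' : emb x y -> emb x' y' -> emb (x ++ x') (y ++ y').
Proof.
by move=> xy h; elim: xy => //= [a {}x {}y _ IH|a b {}x {}y ba _ IH]; constructor.
Qed.

Lemma emb_rcons x y a : emb x y -> emb (rcons x a) (rcons y a).
Proof. by move=> h; rewrite -!cats1; apply: emb_cat. Qed.

(** The origin of the embedding: a write that supersedes [z'] yields a word below the one obtained
    by merely appending. *)
Lemma emb_supersede z z' a : all (fun b => b <= a) z' -> emb (rcons z a) (rcons (z ++ z') a).
Proof.
move=> h; rewrite -!cats1 -catA; apply: emb_cat => //.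
by elim: z' h => //= b z' IH /andP[ba /IH h]; apply: emb_del.
Qed.

Lemma emb_all p x y : emb x y -> all p y -> all p x.
Proof.
elim=> //= [a {}x {}y _ IH|a b {}x {}y _ _ IH] /andP[pa /IH] //.
by rewrite pa.
Qed.

Lemma emb_size x y : emb x y -> size x <= size y.
Proof. by elim=> //= a b {}x {}y _ _; lia. Qed.

(* A word cut by a large terminator is, up to its last letter, an embedding of
   a prefix, so any large enough letter can replace the terminator. *)
Lemma emb_term s e x y : emb (rcons x s) (rcons y s) -> all (fun b => b <= e) y ->
  emb (rcons x e) (rcons y e).
Proof.
elim: y x => [|b y IH] x /=.
  by move/emb_size; rewrite size_rcons /=; case: x.
case: x => [|c x] h /andP[be ye].
  by apply: (@emb_supersede [::] (b :: y)); rewrite /= be.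
have [c' [x' [[<- <-] [[<- h']|[le h']]]]] := emb_consI h.
  by apply/emb_cons/IH.
by apply: emb_del => //; apply: (IH (c :: x)).
Qed.

(** The letters of [u], being below [k], can neither match the right [k] nor jump over it, so the
    prefixes embed in every case. The left [k] either meets the right one or is matched inside [Y],
    which gives the two alternatives for the tails. *)
Lemma emb_split k u X v Y : emb (u ++ k :: X) (v ++ k :: Y) ->
  all (fun b => b < k) u -> all (fun b => b < k) v ->
  emb (rcons u k) (rcons v k) /\ (emb X Y \/ emb (k :: X) Y).
Proof.
elim: v u => [|b v IH] u /=.
  case: u => [|a u] h /=.
    have [c [x' [[<- <-] [[_ h']|[le h']]]]] := emb_consI h; first by split; auto.
    by split; auto.
  move=> /andP[ak _] _.
  by have [c [x' [[<- _] [[E h']|[le h']]]]] := emb_consI h; lia.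
case: u => [|a u] h hu /andP[bk vk].
  split; first by apply: (@emb_supersede [::] (b :: v)); rewrite /= (ltnW bk) /=; apply: sub_all vk => i /ltnW.
  have [c [x' [[<- <-] [[E _]|[_ h']]]]] := emb_consI h; first by move: bk; rewrite E ltnn.
  by have [] := IH [::] h' isT vk.
have [c [x' [[<- <-] [[E h']|[le h']]]]] := emb_consI h.
  case/andP: hu => _ hu; have [h1 h2] := IH _ h' hu vk.
  by split => //; rewrite E; apply: emb_cons.
have [h1 h2] := IH (a :: u) h' hu vk; split => //.
by apply: emb_del.
Qed.

Fixpoint ncode (k : nat) (a : oterm) {struct a} : seq nat :=
  match a, k with
  | Tcons e r, k'.+1 => ncode k' e ++ k' :: ncode k r
  | _, _ => [::]
  end.

Lemma map_code N k a : k <= N.+1 -> map val (code N k a) = ncode k a.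
Proof.
elim: a k => [|e IHe r IHr] [|k] //= kN.
by rewrite map_cat /= inordK ?ltnS // IHe ?IHr // ltnW.
Qed.

Lemma ncode_add k a b : ncode k (tadd a b) = ncode k a ++ ncode k b.
Proof. by elim: a => //= e _ r IH; case: k IH => [|k] IH; [case: b {IH}|rewrite IH -catA]. Qed.

Lemma ncode_wexp k a : ncode k.+1 (wexp a) = rcons (ncode k a) k.
Proof. by rewrite /= cats1. Qed.

Lemma ncode_mul k a n : ncode k (tmul a n) = flatten (nseq n (ncode k a)).
Proof. by rewrite /tmul; elim: n => [|n IH] //=; rewrite ncode_add IH. Qed.

Lemma height_add a b : height (tadd a b) = maxn (height a) (height b).
Proof. by elim: a => [|e _ r IH] /=; rewrite ?max0n // IH maxnA. Qed.

Lemma height_mul a n : height (tmul a n) <= height a.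
Proof. by rewrite /tmul; elim: n => [|n IH] //=; rewrite height_add geq_max leqnn. Qed.

Lemma ncode_lt k a : all (fun b => b < k) (ncode k a).
Proof.
elim: a k => [|e IHe r IHr] [|k] //=.
rewrite all_cat /= ltnSn IHr !andbT; apply: sub_all (IHe k) => i /=; lia.
Qed.

(* Codes are the words in which a letter exceeds the previous one by at most
   one, and whose last letter is maximal. *)
Definition ascends (p q : nat) : bool := q <= p.+1.

Lemma ncode_path k a p : height a <= k -> k <= p.+1 ->
  path ascends p (ncode k a) /\ k <= (last p (ncode k a)).+1.
Proof.
elim: a k p => [|e IHe r IHr] k p /=; first by case: k.
case: k => [|k]; first by rewrite geq_max.
rewrite geq_max => /andP[he hr] kp.
have [h1 h2] := IHe k p he (ltnW kp); have [h3 h4] := IHr k.+1 k hr (leqnn _).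
by rewrite cat_path last_cat /= h1 h3 /ascends h2.
Qed.

Lemma ascends_base p q w : all (fun b => b <= q.+1) w -> path ascends p w -> path ascends q w.
Proof. by case: w => //= a w /andP[h _] /andP[_ ->]; rewrite /ascends h. Qed.

Lemma split_first (x : nat) w : x \in w -> exists u v, w = u ++ x :: v /\ x \notin u.
Proof.
elim: w => // b w IH; rewrite inE; case: eqVneq => [<- _|nb /IH [u [v [-> h]]]].
  by exists [::], w.
by exists (b :: u), v; rewrite inE negb_or nb.
Qed.

Lemma split_last (x : nat) w : exists u v,
  [/\ w = u ++ v, x \notin v & last x u = x].
Proof.
elim/last_ind: w => [|w b [u [v [-> h1 h2]]]]; first by exists [::], [::].
have [->|nb] := eqVneq x b.
  by exists (rcons (u ++ v) b), [::]; rewrite cats0 last_rcons.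
by exists u, (rcons v b); rewrite rcons_cat mem_rcons inE negb_or nb.
Qed.

(** The first top letter closes the leading summand. That it exceeds its predecessor by at most one
    says precisely that the prefix ends with a maximal letter one level down, so the prefix codes
    the exponent. Starting the path at [k] leaves the first letter free and admits the empty
    word. *)
Lemma decode k w : path ascends k w -> all (fun b => b < k) w -> k <= (last k w).+1 ->
  exists a, height a <= k /\ ncode k a = w.
Proof.
have [n] := ubnP (size w); elim: n k w => // n IH k w; rewrite ltnS => hn hp ha hl.
have [->|nw] := eqVneq w [::]; first by exists Tzero.
case: k hp ha hl => [|k] hp ha hl; first by case: w ha nw {hp hn hl}.
have kw : k \in w.
  case: w {hp hn} ha hl nw => // b w ha hl _; have m := mem_last b w.
  have h1 := allP ha _ m; rewrite (_ : k = last b w) //.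
  by move: h1 hl => /=; lia.
have [u [v [E ku]]] := split_first kw.
move: hp ha hl hn; rewrite E cat_path all_cat last_cat size_cat /=.
move=> /and3P[pu sk pv] /and3P[au _ av] hl hn.
have au' : all (fun b => b < k) u.
  apply/allP => b bu; have := allP au _ bu; rewrite /= ltnS leq_eqVlt => /orP[/eqP Eb|//].
  by rewrite -Eb bu in ku.
have [e [he Ee]] : exists a, height a <= k /\ ncode k a = u.
  apply: IH => //; first by lia.
    by apply: ascends_base pu; apply: sub_all au' => i /=; lia.
  by case: (u) sk; rewrite /= /ascends; lia.
have [r [hr Er]] : exists a, height a <= k.+1 /\ ncode k.+1 a = v.
  apply: IH => //; first by lia.
    by apply: ascends_base pv; apply: sub_all av => i /=; lia.
  by case: (v) hl; rewrite /=; lia.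
by exists (Tcons e r); rewrite /= Ee -/ncode Er geq_max ltnS he hr.
Qed.

(** The terminator [K] is kept apart from the level [k]: exponents are closed by the letter of their
    own summand, while the remaining summands keep the outer terminator. *)
Lemma emb_tle K k b a : k <= K -> height b <= k -> height a <= k ->
  emb (rcons (ncode k b) K) (rcons (ncode k a) K) -> tle b a.
Proof.
have [n] := ubnP (osize b + osize a); elim: n K k b a => // n IH K k b a hn kK hb ha.
case: b hn hb => [|e r] // hn hb.
case: k kK hb ha => [|k] kK hb ha; first by move: hb => /=; lia.
case: a hn ha => [|e' r'] hn ha h.
  by have := emb_size h; rewrite size_rcons /= size_cat /=; lia.
have aux x : all (fun b => b < k) (ncode k x) by apply: ncode_lt.
move: h; rewrite /= -!/(ncode k.+1 _) !rcons_cat /= => /emb_split /(_ (aux _) (aux _)) [h1 h2].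
move: hb ha hn; rewrite /= !geq_max => /andP[h3 h4] /andP[h5 h6] hn.
apply: tle_cons; first by apply: (IH k k) => //; lia.
case: h2 => h2; first by apply: (IH K k.+1) => //; lia.
(* Here the closing letter of [b] is matched further right. Together with the code of [r] it reads
   as the code of omega^0 + [r], which therefore lies below [r']. *)
apply: (@tle_trans (Tcons Tzero r)); first by apply: tle_skip.
apply: (IH K k.+1) => //=; first by lia.
by rewrite geq_max h4.
Qed.

(** * The limit step as a rewriting of codes *)

Section Limits.

Variables (e : nat) (u : seq nat).

(* The limit step sends [peak k w] to [spread k w n]. *)
Definition peak (k : nat) (w : seq nat) : seq nat := w ++ u ++ e.-1 :: iota e (k - e).
Definition spread (k : nat) (w : seq nat) (n : nat) : seq nat :=
  w ++ flatten (nseq n (rcons u e)) ++ iota e.+1 (k - e.+1).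

(** The last condition makes [w] stop at the end of a summand of level at least [e] (or be empty),
    so that [u] starts a fresh exponent. *)
Definition limit_word (k : nat) (w : seq nat) : Prop :=
  [/\ all (fun b => b < k) w, path ascends k w & e <= last e w].

Definition exponent_word : Prop :=
  [/\ all (fun b => b < e) u, path ascends e u & e <= (last e u).+1].

(** If [u] codes [b], then [e.-1] adds 1 to this exponent, [e] closes omega^(b+1), and each letter
    from [e.+1] on closes one surrounding power; [w] collects the left-hand summands of all the
    levels. The fundamental sequence acts only on the innermost power. *)
Lemma peak_limit k w : 0 < e < k -> exponent_word -> limit_word k w ->
  exists l, [/\ is_limit l, height l <= k, ncode k l = peak k w &
    forall n, height (fund l n) <= k /\ ncode k (fund l n) = spread k w n].
Proof.
move=> /andP[e0 ek] [u1 u2 u3]; rewrite /peak /spread.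
have [b [hb Eb]] := decode u2 u1 u3.
rewrite -(subnKC ek); elim: (k - e.+1) w => [|m IH] w [w1 w2 w3].
  have [g [hg Eg]] : exists a, height a <= (e.+1 + 0) /\ ncode (e.+1 + 0) a = w.
    apply: decode => //; case: (w) w3 => //=; lia.
  exists (tadd g (wexp (tadd b tone))); rewrite is_limit_wexp; split.
  - by case: (b).
  - by rewrite height_add /= height_add /=; lia.
  - rewrite ncode_add Eg addn0 ncode_wexp ncode_add Eb subSnn /= -(prednK e0) /=.
    by rewrite -cats1 -catA.
  - move=> n; rewrite fund_wexp_succ height_add ncode_add ncode_mul Eg addn0 ncode_wexp Eb.
    rewrite subnn cats0; split => //; rewrite geq_max -{1}(addn0 e.+1) hg /=.
    by apply: leq_trans (height_mul _ _) _ => /=; lia.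
(* The last top letter in [w] separates the outermost summands [w'] from what already belongs to the
   exponent of the final summand. *)
have [w' [w2' [E n2 l2]]] := split_last (e.+1 + m) w.
have w2lt : all (fun b => b < e.+1 + m) w2'.
  move: w1; rewrite E all_cat => /andP[_ h]; apply/allP => x xw; have := allP h _ xw.
  rewrite /= addnS ltnS leq_eqVlt => /orP[/eqP Ex|//]; by rewrite -Ex xw in n2.
have [g [hg Eg]] : exists a, height a <= (e.+1 + m.+1) /\ ncode (e.+1 + m.+1) a = w'.
  move: w1 w2; rewrite E all_cat cat_path => /andP[h1 _] /andP[h2 _].
  by apply: decode => //; move: l2; case: (w') => //=; lia.
have [l [l1 l3 l4 l5]] : exists l, [/\ is_limit l, height l <= e.+1 + m,
    ncode (e.+1 + m) l = w2' ++ u ++ e.-1 :: iota e (e.+1 + m - e) &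
    forall n, height (fund l n) <= e.+1 + m /\ ncode (e.+1 + m) (fund l n) =
      w2' ++ flatten (nseq n (rcons u e)) ++ iota e.+1 (e.+1 + m - e.+1)].
  apply: IH; split => //.
    move: w2; rewrite E cat_path => /andP[_]; apply: ascends_base.
    by apply: sub_all w2lt => i /=; lia.
  by move: w3; rewrite E last_cat; case: (w2') => [|//] _; apply: leqnn.
exists (tadd g (wexp l)); rewrite is_limit_wexp; split.
- by case: (l) l1.
- by rewrite height_add /=; lia.
- rewrite ncode_add Eg addnS ncode_wexp l4 E -cats1 -!catA /=.
  by rewrite (_ : (e.+1 + m).+1 - e = (e.+1 + m - e) + 1) ?iotaD /=; [rewrite subnKC //; lia|lia].
- move=> n; have [l6 l7] := l5 n.
  rewrite fund_wexp_limit // height_add ncode_add Eg; split; first by rewrite /=; lia.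
  rewrite addnS ncode_wexp l7 E -cats1 -!catA /=.
  by rewrite (_ : (e.+1 + m).+1 - e.+1 = (e.+1 + m - e.+1) + 1) ?iotaD /=; [rewrite subnKC //; lia|lia].
Qed.

End Limits.

(** The converse reading: descending through limit exponents reaches a successor exponent, whose
    level is [e]; on the way back every level puts its own summands in front of [w]. *)
Lemma limit_peak l k : is_limit l -> height l <= k -> exists e u w,
  [/\ 0 < e < k, exponent_word e u, limit_word e k w, ncode k l = peak e u k w &
    forall n, ncode k (fund l n) = spread e u k w n].
Proof.
move=> hl; move: l hl k; apply: limit_ind => [g b|g l hl IH] [|k]; rewrite height_add; try (by move=> /=; lia).
  rewrite /= height_add /= => hk.
  have [hg hb k0] : [/\ height g <= k.+1, height b <= k & 0 < k] by split; lia.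
  have [p1 p2] := ncode_path hg (leqnSn k.+1); have [q1 q2] := ncode_path hb (leqnSn k).
  exists k, (ncode k b), (ncode k.+1 g); split => //.
  - by rewrite k0 ltnSn.
  - by split => //; apply: ncode_lt.
  - split => //; first exact: ncode_lt.
    by case: (ncode k.+1 g) p2 => [|b0 w0] /=; lia.
  - rewrite /peak ncode_add ncode_wexp ncode_add subSnn /=.
    by case: (k) k0 => //= k1 _; rewrite -cats1 -catA.
  - by move=> n; rewrite /spread fund_wexp_succ ncode_add ncode_mul ncode_wexp subnn cats0.
rewrite /= => hk.
have [hg hlk] : height g <= k.+1 /\ height l <= k by lia.
have [p1 p2] := ncode_path hg (leqnSn k.+1).
have [e [u [w [/andP[e0 ek] h1 [h2 h3 h4] h5 h6]]]] := IH k hlk.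
exists e, u, (ncode k.+1 g ++ w); split => //.
- by rewrite e0 ltnW.
- split.
  + by rewrite all_cat ncode_lt /=; apply: sub_all h2 => i /=; lia.
  + rewrite cat_path p1 /=; apply: ascends_base h3.
    by apply: sub_all h2 => i /=; lia.
  + by rewrite last_cat; case: (w) h4 => //= _; case: (ncode k.+1 g) p2 => [|b0 w0] /=; lia.
- rewrite /peak ncode_add ncode_wexp h5 /peak -cats1 -!catA /=.
  by rewrite (_ : k.+1 - e = (k - e) + 1) ?iotaD /=; [rewrite subnKC //; lia|lia].
- move=> n; rewrite fund_wexp_limit // ncode_add ncode_wexp h6 /spread -cats1 -!catA /=.
  by rewrite (_ : k.+1 - e.+1 = (k - e.+1) + 1) ?iotaD /=; [rewrite subnKC //; lia|lia].
Qed.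

(** * Upper bounds that survive losses *)

Section Bounded.

Variables (E M : nat).

Definition low (w : seq nat) : bool := all (fun b => b < E) w.

(** The word [x] need not be a code: superseding or a wrong guess may have spoilt it, but only codes
    that still embed in it can ever be accepted as final output. [M] stands for the Hardy value at
    the start of the run. *)
Definition ok (x : seq nat) (k : nat) : Prop :=
  forall b n, height b <= E -> emb (rcons (ncode E b) E) (rcons x E) -> n <= k ->
  hardy b n <= M.

Lemma ok_down x x' k k' : ok x k -> emb (rcons x' E) (rcons x E) -> k' <= k -> ok x' k'.
Proof.
move=> h xx kk b n hb hx hn; apply: h => //; first exact: emb_trans hx xx.
exact: leq_trans hn kk.
Qed.

Lemma ok_emb x x' k : ok x k -> emb x' x -> ok x' k.
Proof. by move=> h xx; apply: ok_down h _ (leqnn _); apply: emb_rcons. Qed.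

Lemma low_emb x y : emb x y -> low y -> low x.
Proof. exact: emb_all. Qed.

Lemma complete_word w : low w -> path ascends E w -> E <= (last E w).+1 ->
  exists g, height g <= E /\ ncode E g = w.
Proof. by move=> h1 h2 h3; apply: decode. Qed.

Lemma ncode_succ g : 0 < E -> ncode E (tadd g tone) = rcons (ncode E g) E.-1.
Proof. by case: E => // d _; rewrite ncode_add /= cats1. Qed.

Lemma ok_pred w k : 0 < E -> low w -> path ascends E w -> E <= (last E w).+1 ->
  ok (rcons w E.-1) k -> ok w k.+1.
Proof.
move=> E0 h1 h2 h3 h b n hb hx hn; have [g [hg Eg]] := complete_word h1 h2 h3.
apply: leq_trans (hardy_mono b hn) _.
apply: (@leq_trans (hardy g k.+1)).
  by apply: hardy_tle => //; apply: (@emb_tle E E) => //; rewrite Eg.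
rewrite -hardy_succ; apply: (h _ k) => //; first by rewrite height_add /= geq_max hg maxn0.
by rewrite ncode_succ // Eg.
Qed.

Lemma ok_succ w k : 0 < E -> low w -> path ascends E w -> E <= (last E w).+1 ->
  ok w k.+1 -> ok (rcons w E.-1) k.
Proof.
move=> E0 h1 h2 h3 h b n hb hx hn; have [g [hg Eg]] := complete_word h1 h2 h3.
apply: leq_trans (hardy_mono b hn) _.
(* A code below [g] + 1 may have lost its final summand and lie below [g], or may be [b'] + 1 with
   [b'] below [g]; the two cases are bounded separately by the value of [g] at [k.+1]. *)
have : tle b (tadd g tone).
  apply: (@emb_tle E E) => //; first by rewrite height_add /= geq_max hg maxn0.
  by rewrite ncode_succ // Eg.
have hM : hardy g k.+1 <= M by apply: h => //; rewrite Eg.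
case/tle_last => [bg|[b' [e' [Eb bg et]]]]; apply: leq_trans hM.
  by apply: leq_trans (hardy_mono b (leqnSn k)) _; apply: hardy_tle.
by inversion et; subst; rewrite hardy_succ; apply: hardy_tle.
Qed.

Lemma ok_unfold e u w n : 0 < e < E -> exponent_word e u -> limit_word e E w ->
  ok (peak e u E w) n -> ok (spread e u E w n) n.
Proof.
move=> he hu hw h; case: n h => [|n] h.
  apply: ok_down h _ (leqnn 0).
  rewrite /spread /peak /= -!cats1 -!catA; apply: emb_cat => //.
  case/andP: he => e0 eE; rewrite (_ : E - e = (E - e.+1).+1) /=; last by lia.
  have : exists a s, iota e.+1 (E - e.+1) ++ [:: E] = a :: s /\ e < a.
    by case: (E - e.+1) => [|m] /=; do 2 eexists; split; eauto.
  case=> a [s [-> ea]]; case: hu => hu _ _.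
  rewrite -[_ :: _ :: _ :: _]/([:: e.-1; e] ++ a :: s) catA.
  rewrite -(cat1s a s) -[X in emb X _]/([:: a] ++ s) [X in emb _ X]catA; apply: emb_cat => //.
  rewrite cats1; apply: (@emb_supersede [::]); rewrite all_cat /=; apply/and4P; split => //; try lia.
  by apply: sub_all hu => i /=; lia.
have [l [ll hl El hf]] := peak_limit he hu hw.
move=> b m hb hx hm; have [h1 h2] := hf n.+1.
apply: leq_trans (hardy_mono b hm) _.
apply: (@leq_trans (hardy (fund l n.+1) n.+1)).
  by apply: hardy_tle => //; apply: (@emb_tle E E) => //; rewrite h2.
by rewrite -hardy_limit //; apply: h => //; rewrite El.
Qed.

(** With [n = 0] the spread word would retain nothing of [u], and folding could invent an arbitrary
    exponent; hence the condition on [n], enforced in the control by the separate phase [Ky0]. *)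
Lemma ok_fold e u w n : 0 < e < E -> exponent_word e u -> limit_word e E w -> 0 < n ->
  ok (spread e u E w n) n -> ok (peak e u E w) n.
Proof.
move=> he hu hw n0 h; have [l [ll hl El hf]] := peak_limit he hu hw.
move=> b m hb hx hm; have [h1 h2] := hf n.
apply: leq_trans (hardy_mono b hm) _.
apply: (@leq_trans (hardy l n)).
  by apply: hardy_tle => //; apply: (@emb_tle E E) => //; rewrite El.
by rewrite hardy_limit //; apply: h => //; rewrite h2.
Qed.

End Bounded.

(** * The channel system *)

(* Phases of the control.  Kbeg to Kc0 check the initial contents; Ko, Kow rotate
   channel o and Kc, Kcw rotate channel c; Kp1-3 remove and Ks1-3 add a last
   summand 1; Ku* and Kx* replace w u (e-1) e by w (u e)^n; Kf*, Ky* and Kg* do the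
   converse; Kz, Kzw rotate the remaining letters e+1 ... d.  The parameters of a
   state are the last letter read, or e followed by the last letter read. *)
Inductive kind :=
  | Kbeg | Ktbeg | Kchk | Kchkw | Kcbeg | Kcw0 | Kc0
  | Kcw | Kc | Kcend | Ko | Kow | Kfin
  | Kp1 | Kp2 | Kp3 | Ks1 | Ks2 | Ks3
  | Ku | Kuw | Ku1 | Ku2 | Ku3 | Kx | Kxc | Kxr | Kxt | Kxo | Kx1 | Kx2 | Kxe | Kclr | Kclr1
  | Kf | Kf1 | Ky0 | Ky | Kyc | Kyo | Kyt | Kytw | Ky1 | Ky2 | Kye
  | Kg | Kgw | Kg1 | Kg2 | Kg3 | Kz | Kzw.

Inductive var := Zero | X | Y | Z | Top.

Definition env (E x y z : nat) (v : var) : nat :=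
  match v with Zero => 0 | X => x | Y => y | Z => z | Top => E end.

Inductive atom := Atom (v : var) (i : nat) (w : var) (j : nat).

Definition holds (e : var -> nat) (a : atom) : bool :=
  let: Atom v i w j := a in e v + i <= e w + j.

Record family := Family {
  f_src : kind; f_src1 : var; f_src2 : var;
  f_chan : 'I_3; f_op : chan_op; f_letter : var;
  f_dst : kind; f_dst1 : var; f_dst2 : var;
  f_guard : seq atom }.

Definition chO : 'I_3 := @Ordinal 3 0 isT.
Definition chC : 'I_3 := @Ordinal 3 1 isT.
Definition chT : 'I_3 := @Ordinal 3 2 isT.

Definition rd src s1 s2 ch v dst d1 d2 g := Family src s1 s2 ch op_read v dst d1 d2 g.
Definition wr src s1 s2 ch v dst d1 d2 g := Family src s1 s2 ch op_write v dst d1 d2 g.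

Definition isE := Atom Top 0 Y 0.
Definition is0 := Atom Y 0 Zero 0.
Definition ltE := Atom Y 1 Top 0.
Definition step_XY := Atom Y 0 X 1.
Definition step_ZY := Atom Y 0 Z 1.
Definition ltYX := Atom Y 1 X 0.
(** The level [e = X] is guessed when the letter [Y] has just been read: [w] then ends with a letter
    at least [e], or is empty when [Y] is the terminator. *)
Definition peak_XY := [:: Atom X 0 Y 0; Atom Zero 1 X 0; Atom X 1 Top 0].

Definition init_families : seq family := [::
  rd Kbeg Zero Zero chT Y Ktbeg Zero Zero [:: isE];
  wr Ktbeg Zero Zero chT Y Kchk Y Zero [:: isE];
  rd Kchk X Zero chO Y Kchkw Y Zero [:: step_XY];
  wr Kchkw Y Zero chO Y Kchk Y Zero [:: ltE];
  wr Kchkw Y Zero chO Y Kcbeg Zero Zero [:: isE];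
  rd Kcbeg Zero Zero chC Y Kcw0 Zero Zero [:: is0];
  wr Kcw0 Zero Zero chC Y Kc0 Zero Zero [:: is0];
  rd Kc0 Zero Zero chC Y Kcw0 Zero Zero [:: is0];
  rd Kc0 Zero Zero chC Y Kcend Zero Zero [:: isE] ].

Definition pass_families : seq family := [::
  wr Kcw Zero Zero chC Y Kc Zero Zero [:: is0];
  rd Kc Zero Zero chC Y Kcw Zero Zero [:: is0];
  rd Kc Zero Zero chC Y Kcend Zero Zero [:: isE];
  wr Kcend Zero Zero chC Y Ko Y Zero [:: isE];
  rd Ko X Zero chO Y Kow Y Zero [:: step_XY];
  wr Kow Y Zero chO Y Ko Y Zero [::];
  wr Kow Y Zero chO Y Kfin Zero Zero [:: isE];
  rd Ko X Zero chO Y Kp1 Zero Zero [:: Atom Y 1 Top 0; Atom Top 0 Y 1; Atom Y 0 X 0];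
  rd Kp1 Zero Zero chO Y Kp2 Zero Zero [:: isE];
  wr Kp2 Zero Zero chO Y Kp3 Zero Zero [:: isE];
  wr Kp3 Zero Zero chC Y Kc Zero Zero [:: is0];
  rd Ko X Zero chO Y Ks1 Zero Zero [:: isE; step_XY];
  wr Ks1 Zero Zero chO Y Ks2 Zero Zero [:: Atom Y 1 Top 0; Atom Top 0 Y 1];
  wr Ks2 Zero Zero chO Y Ks3 Zero Zero [:: isE];
  rd Ks3 Zero Zero chC Y Kc Zero Zero [:: is0];
  rd Kz X Zero chO Y Kzw Y Zero [:: step_XY; Atom X 1 Y 0; ltE];
  wr Kzw Y Zero chO Y Kz Y Zero [::];
  rd Kz X Zero chO Y Kow Y Zero [:: step_XY; isE] ].

Definition unfold_families : seq family := [::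
  wr Kow Y Zero chO Y Ku X Z (Atom Top 0 Z 0 :: peak_XY);
  rd Ku X Z chO Y Kuw X Y [:: step_ZY; ltYX];
  wr Kuw X Y chT Y Ku X Y [::];
  rd Ku X Z chO Y Ku1 X Zero [:: ltYX; Atom X 0 Y 1; Atom Y 0 Z 0];
  rd Ku1 X Zero chO X Ku2 X Zero [::];
  rd Ku2 X Zero chT Y Ku3 X Zero [:: isE];
  wr Ku3 X Zero chT Y Kx X Zero [:: isE];
  rd Kx X Zero chC Y Kxc X Zero [:: is0];
  wr Kxc X Zero chC Y Kxr X Zero [:: is0];
  rd Kxr X Zero chT Y Kxt X Y [:: ltE];
  wr Kxt X Y chT Y Kxo X Y [::];
  wr Kxo X Y chO Y Kxr X Zero [::];
  rd Kxr X Zero chT Y Kx1 X Zero [:: isE];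
  wr Kx1 X Zero chT Y Kx2 X Zero [:: isE];
  wr Kx2 X Zero chO X Kx X Zero [::];
  rd Kx X Zero chC Y Kxe X Zero [:: isE];
  wr Kxe X Zero chC Y Kclr X Zero [:: isE];
  rd Kclr X Zero chT Y Kclr X Zero [:: ltE];
  rd Kclr X Zero chT Y Kclr1 X Zero [:: isE];
  wr Kclr1 X Zero chT Y Kz X Zero [:: isE] ].

Definition fold_families : seq family := [::
  wr Kow Y Zero chO Y Kf X Zero peak_XY;
  wr Kf X Zero chT Y Kf X Zero [:: ltYX];
  rd Kf X Zero chT Y Kf1 X Zero [:: isE];
  wr Kf1 X Zero chT Y Ky0 X Zero [:: isE];
  rd Ky0 X Zero chC Y Kyc X Zero [:: is0];
  rd Ky X Zero chC Y Kyc X Zero [:: is0];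
  wr Kyc X Zero chC Y Kyo X Zero [:: is0];
  rd Kyo X Zero chO Y Kyt X Y [:: ltYX];
  rd Kyt X Y chT Y Kytw X Y [::];
  wr Kytw X Y chT Y Kyo X Zero [::];
  rd Kyo X Zero chT Y Ky1 X Zero [:: isE];
  wr Ky1 X Zero chT Y Ky2 X Zero [:: isE];
  rd Ky2 X Zero chO X Ky X Zero [::];
  rd Ky X Zero chC Y Kye X Zero [:: isE];
  wr Kye X Zero chC Y Kg X Y [:: isE];
  rd Kg X Z chT Y Kgw X Y [:: step_ZY; ltYX];
  wr Kgw X Y chO Y Kg X Y [::];
  rd Kg X Z chT Y Kg1 X Zero [:: isE; Atom X 0 Z 1];
  wr Kg1 X Zero chT Y Kg2 X Zero [:: isE];
  wr Kg2 X Zero chO Y Kg3 X Zero [:: Atom X 0 Y 1; ltYX];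
  wr Kg3 X Zero chO X Kz X Zero [::] ].

Definition main_families := pass_families ++ unfold_families ++ fold_families.

Definition chans : Type := (seq nat * seq nat * seq nat)%type.

Definition get (i : nat) (s : chans) : seq nat :=
  match i with 0 => s.1.1 | 1 => s.1.2 | _ => s.2 end.

Definition put (i : nat) (w : seq nat) (s : chans) : chans :=
  match i with 0 => (w, s.1.2, s.2) | 1 => (s.1.1, w, s.2) | _ => (s.1.1, s.1.2, w) end.

Definition act (op : chan_op) (i a : nat) (s s' : chans) : Prop :=
  if op then exists z z', [/\ get i s = z ++ z', all (fun b => b <= a) z' & s' = put i (rcons z a) s]
  else exists w, get i s = a :: w /\ s' = put i w s.

Section Words.

Variable E : nat.

(** A letter below [E] cannot supersede the terminator, so neither it nor the unread part in front
    of it is affected. *)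
Lemma write_low r w a z z' : r ++ E :: w = z ++ z' -> a < E ->
  all (fun b => b <= a) z' ->
  exists w', rcons z a = r ++ E :: w' /\ emb w' (rcons w a).
Proof.
move=> e aE hz; have [w1 [Ew Ez]] : exists w1, w = w1 ++ z' /\ z = r ++ E :: w1.
  have nE : E \notin z' by apply/negP => h; have := allP hz _ h; lia.
  elim: r z e => [|b r IH] [|c z] /=.
  - by move=> e; rewrite -e inE eqxx in nE.
  - by case=> <- ->; exists z.
  - by move=> e; rewrite -e inE mem_cat inE eqxx !orbT in nE.
  - by case=> <- /IH [w1 [-> ->]]; exists w1.
exists (rcons w1 a); split; first by rewrite Ez rcons_cat.
by rewrite Ew; apply: emb_supersede.
Qed.

Lemma write_end x z z' : x = z ++ z' -> low E x -> low E z /\ emb (rcons z E) (rcons x E).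
Proof.
move=> ->; rewrite /low all_cat => /andP[h1 h]; split => //.
by apply: emb_supersede; apply: sub_all h => i /=; apply: ltnW.
Qed.

Lemma read_low r w a o : r ++ E :: w = a :: o -> a < E ->
  exists r', r = a :: r' /\ o = r' ++ E :: w.
Proof. by case: r => [|b r] /= [-> <-]; [rewrite ltnn|exists r]. Qed.

Lemma read_end r w o : r ++ E :: w = E :: o -> low E r -> r = [::] /\ o = w.
Proof. by case: r => [|b r] /=; [case=> ->|case=> -> _ /andP[]; rewrite ltnn]. Qed.

End Words.

(** * What each control state guarantees *)

Section Invariant.

Variables (E M : nat).
Hypothesis E0 : 0 < E.

Notation ok := (ok E M).

(* The channel holds the unread word r, its terminator, and what superseding
   left of the words W written behind it. *)
Definition out (W r x : seq nat) : Prop :=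
  exists w, [/\ x = r ++ E :: w, low E r, low E W & emb w W].

Definition part (W x : seq nat) : Prop := low E W /\ emb x W.

Definition rest (k : nat) (c t : seq nat) : Prop := out [::] (nseq k 0) c /\ out [::] [::] t.

Definition reps (v : seq nat) (p n : nat) : seq nat := flatten (nseq n (rcons v p)).

Definition spot (p : nat) (w : seq nat) : Prop := 0 < p < E /\ limit_word p E w.

Definition zok (W r : seq nat) (p k : nat) : Prop :=
  r = iota p.+1 (E - p.+1) -> ok (W ++ r) k.

(* The copies of u read so far are only known up to losses: all that is used
   of them is that they dominate N copies of any v below the word tau kept in t. *)
Definition fok (p : nat) (w s tau : seq nat) (N k : nat) : Prop :=
  forall v, all (fun b => b < p) v -> emb (rcons v E) (rcons tau E) ->
  ok (w ++ reps v p N ++ s) k.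

(** The relation between a word and what is left of it when [E] is written behind it: a whole final
    segment may disappear. *)
Definition cut (x y : seq nat) : Prop := emb (rcons x E) (rcons y E).

(* In the loops on channel c, N zeros have been processed and i remain. *)
Definition inv (k : kind) (p q : nat) (s : chans) : Prop :=
  let: (o, c, t) := s in
  match k with
  | Kcw => exists x i j, [/\ out [::] x o, out (nseq j 0) (nseq i 0) c, out [::] [::] t
      & ok x (i + j).+1]
  | Kc => exists x i j, [/\ out [::] x o, out (nseq j 0) (nseq i 0) c, out [::] [::] t
      & ok x (i + j)]
  | Kcend => exists x j, [/\ out [::] x o, part (nseq j 0) c, out [::] [::] t & ok x j]
  | Ko => exists w r k, [/\ out w r o, rest k c t, path ascends E w, last E w = p
      & ok (w ++ r) k]
  | Kow => (exists w r k, [/\ p < E, out w r o, rest k c t,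
        path ascends E (rcons w p) & ok (w ++ p :: r) k])
      \/ exists W k, [/\ p = E, part W o, rest k c t & ok W k]
  | Kfin => exists x k, [/\ out [::] x o, rest k c t & ok x k]
  | Kp1 => exists w r k, [/\ out w r o, rest k c t, path ascends E w,
      E <= (last E w).+1 & ok (w ++ E.-1 :: r) k]
  | Kp2 => exists W k, [/\ part W o, rest k c t & ok W k.+1]
  | Kp3 => exists x k, [/\ out [::] x o, rest k c t & ok x k.+1]
  | Ks1 => exists w k, [/\ part w o, rest k c t, path ascends E w,
      E <= (last E w).+1 & ok w k]
  | Ks2 => exists W k, [/\ part W o, rest k c t & forall k', k = k'.+1 -> ok W k']
  | Ks3 => exists x k, [/\ out [::] x o, rest k c t & forall k', k = k'.+1 -> ok x k']
  | Kz => exists W r k, [/\ p < E, out W r o, rest k c t & zok W r p k]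
  | Kzw => exists W r k, [/\ p < E, out W r o, rest k c t & zok (rcons W p) r p k]
  | Ku => exists w r u k, [/\ spot p w, out w r o, out [::] (nseq k 0) c, out u [::] t &
      [/\ all (fun b => b < p) u, path ascends E u, last E u = q & ok (w ++ u ++ r) k]]
  | Kuw => exists w r u k, [/\ spot p w, out w r o, out [::] (nseq k 0) c, out u [::] t &
      [/\ all (fun b => b < p) (rcons u q), path ascends E (rcons u q)
        & ok (w ++ u ++ q :: r) k]]
  | Ku1 => exists w r u k, [/\ spot p w, out w r o, out [::] (nseq k 0) c, out u [::] t &
      exponent_word p u /\ ok (w ++ u ++ p.-1 :: r) k]
  | Ku2 => exists w r u k, [/\ spot p w, out w r o, out [::] (nseq k 0) c, out u [::] t &
      exponent_word p u /\ ok (w ++ u ++ p.-1 :: p :: r) k]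
  | Ku3 => exists w r u k, [/\ spot p w, out w r o, out [::] (nseq k 0) c, part u t &
      exponent_word p u /\ ok (w ++ u ++ p.-1 :: p :: r) k]
  | Kx => exists w r u x N i, [/\ spot p w, out (w ++ reps u p N) r o,
      out (nseq N 0) (nseq i 0) c, out [::] x t &
      [/\ exponent_word p u, cut x u & ok (w ++ u ++ p.-1 :: p :: r) (N + i)]]
  | Kxc => exists w r u x N i, [/\ spot p w, out (w ++ reps u p N) r o,
      out (nseq N 0) (nseq i 0) c, out [::] x t &
      [/\ exponent_word p u, cut x u & ok (w ++ u ++ p.-1 :: p :: r) (N + i).+1]]
  | Kxr => exists w r u x y N i, [/\ spot p w, out (w ++ reps u p N ++ x) r o,
      out (nseq N.+1 0) (nseq i 0) c, out x y t &
      [/\ exponent_word p u, cut (x ++ y) u & ok (w ++ u ++ p.-1 :: p :: r) (N + i).+1]]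
  | Kxt => exists w r u x y N i, [/\ spot p w, out (w ++ reps u p N ++ x) r o,
      out (nseq N.+1 0) (nseq i 0) c, q < E /\ out x y t &
      [/\ exponent_word p u, cut (x ++ q :: y) u & ok (w ++ u ++ p.-1 :: p :: r) (N + i).+1]]
  | Kxo => exists w r u x y N i, [/\ spot p w, out (w ++ reps u p N ++ x) r o,
      out (nseq N.+1 0) (nseq i 0) c, q < E /\ out (rcons x q) y t &
      [/\ exponent_word p u, cut (x ++ q :: y) u & ok (w ++ u ++ p.-1 :: p :: r) (N + i).+1]]
  | Kx1 => exists w r u x N i, [/\ spot p w, out (w ++ reps u p N ++ x) r o,
      out (nseq N.+1 0) (nseq i 0) c, part x t &
      [/\ exponent_word p u, cut x u & ok (w ++ u ++ p.-1 :: p :: r) (N + i).+1]]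
  | Kx2 => exists w r u x y N i, [/\ spot p w, out (w ++ reps u p N ++ x) r o,
      out (nseq N.+1 0) (nseq i 0) c, out [::] y t &
      [/\ exponent_word p u, cut x u, cut y u & ok (w ++ u ++ p.-1 :: p :: r) (N + i).+1]]
  | Kxe => exists W r x k, [/\ p < E, out W r o, part (nseq k 0) c, out [::] x t
      & zok W r p k]
  | Kclr => exists W r x k, [/\ p < E, out W r o, out [::] (nseq k 0) c, out [::] x t
      & zok W r p k]
  | Kclr1 => exists W r k, [/\ p < E, out W r o, out [::] (nseq k 0) c, part [::] t
      & zok W r p k]
  | Kf => exists w r x k, [/\ spot p w, out w r o, out [::] (nseq k 0) c, out x [::] t
      & ok (w ++ r) k]
  | Kf1 => exists w r x k, [/\ spot p w, out w r o, out [::] (nseq k 0) c, part x t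
      & ok (w ++ r) k]
  | Ky0 => exists w r x k, [/\ spot p w, out w r o, out [::] (nseq k 0) c, out [::] x t
      & ok (w ++ r) k]
  | Ky => exists w r x N i, [/\ spot p w /\ 0 < N, out w r o, out (nseq N 0) (nseq i 0) c,
      out [::] x t & fok p w r x N (N + i)]
  | Kyc => exists w r x N i, [/\ spot p w, out w r o, out (nseq N 0) (nseq i 0) c,
      out [::] x t & fok p w r x N (N + i).+1]
  | Kyo => exists w r x y N i, [/\ spot p w, out w r o, out (nseq N.+1 0) (nseq i 0) c,
      out x y t & all (fun b => b < p) x /\ fok p w (x ++ r) (x ++ y) N (N + i).+1]
  | Kyt => exists w r x y N i, [/\ spot p w, out w r o, out (nseq N.+1 0) (nseq i 0) c,
      out x y t &
      all (fun b => b < p) (rcons x q) /\ fok p w (x ++ q :: r) (x ++ y) N (N + i).+1]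
  | Kytw => exists w r x y N i, [/\ spot p w, out w r o, out (nseq N.+1 0) (nseq i 0) c,
      out x y t &
      all (fun b => b < p) (rcons x q) /\ fok p w (x ++ q :: r) (x ++ q :: y) N (N + i).+1]
  | Ky1 => exists w r x N i, [/\ spot p w, out w r o, out (nseq N.+1 0) (nseq i 0) c,
      part x t & all (fun b => b < p) x /\ fok p w (x ++ r) x N (N + i).+1]
  | Ky2 => exists w r x y N i, [/\ spot p w, out w r o, out (nseq N.+1 0) (nseq i 0) c,
      out [::] y t & [/\ all (fun b => b < p) x, cut y x & fok p w (x ++ r) x N (N + i).+1]]
  | Kye => exists w r x N, [/\ spot p w /\ 0 < N, out w r o, part (nseq N 0) c,
      out [::] x t & fok p w r x N N]
  | Kg => exists w r x y N k, [/\ [/\ spot p w, 0 < N & k <= N], out (w ++ x) r o,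
      out [::] (nseq k 0) c, out [::] y t &
      [/\ all (fun b => b < p) x, path ascends E x, last E x = q & fok p w r (x ++ y) N N]]
  | Kgw => exists w r x y N k, [/\ [/\ spot p w, 0 < N & k <= N], out (w ++ x) r o,
      out [::] (nseq k 0) c, out [::] y t &
      [/\ all (fun b => b < p) (rcons x q), path ascends E (rcons x q)
        & fok p w r (x ++ q :: y) N N]]
  | Kg1 => exists W r k, [/\ p < E, out W r o, out [::] (nseq k 0) c, part [::] t
      & zok (rcons (rcons W p.-1) p) r p k]
  | Kg2 => exists W r k, [/\ p < E, out W r o, rest k c t
      & zok (rcons (rcons W p.-1) p) r p k]
  | Kg3 => exists W r k, [/\ p < E, out W r o, rest k c t & zok (rcons W p) r p k]
  | _ => False
  end.

Lemma out_write W r x a z z' : out W r x -> x = z ++ z' ->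
  all (fun b => b <= a) z' -> a < E -> out (rcons W a) r (rcons z a).
Proof.
move=> [w [-> lr lW h]] e hz aE; have [w' [-> h']] := write_low e aE hz.
exists w'; split => //; first by rewrite /low all_rcons aE.
by apply: emb_trans h' _; apply: emb_rcons.
Qed.

Lemma out_read W r x a : out W r (a :: x) -> a < E -> exists r', r = a :: r' /\ out W r' x.
Proof.
move=> [w [/esym e lr lW h]] aE; have [r' [er ex]] := read_low e aE.
by exists r'; split => //; exists w; split => //; move: lr; rewrite er => /andP[].
Qed.

Lemma out_end W r x : out W r (E :: x) -> r = [::] /\ part W x.
Proof. by move=> [w [/esym e lr lW h]]; have [-> ->] := read_end e lr. Qed.

Lemma part_write W x z z' : part W x -> x = z ++ z' ->
  exists y, out [::] y (rcons z E) /\ cut y W.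
Proof.
move=> [lW h] e; have [lz hz] := write_end e (low_emb h lW).
exists z; split; last by apply: emb_trans hz _; apply: emb_rcons.
by exists [::]; rewrite cats1; split => //; constructor.
Qed.

Lemma part_write0 x z z' : part [::] x -> x = z ++ z' -> out [::] [::] (rcons z E).
Proof.
move=> h e; have [y [h1 h2]] := part_write h e.
by have := emb_size h2; rewrite size_rcons /=; case: y h1 {h2}.
Qed.

Lemma out_nseq_read W i x : out W (nseq i 0) (0 :: x) ->
  exists i', i = i'.+1 /\ out W (nseq i' 0) x.
Proof.
move=> h; have [r [e h']] := out_read h E0.
by case: i e {h} => [|i] //= [e]; exists i; split => //; rewrite e.
Qed.

Lemma out_nseq_end W i x : out W (nseq i 0) (E :: x) -> i = 0 /\ part W x.
Proof. by move=> /out_end [e h]; split => //; case: i e. Qed.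

(** Closing the counter may lose zeros. This is harmless because [ok] covers all smaller
    arguments. *)
Lemma part_nseq_write k x z z' : part (nseq k 0) x -> x = z ++ z' ->
  exists2 k', k' <= k & out [::] (nseq k' 0) (rcons z E).
Proof.
move=> h e; have [y [h1 h2]] := part_write h e.
have ly : low E y by case: h1 => w [].
have hs := emb_size h2; rewrite !size_rcons size_nseq in hs.
exists (size y) => //.
have : all (fun b => (b == 0) || (b == E)) (rcons y E).
  apply: emb_all h2 _; rewrite all_rcons eqxx orbT /=; apply/allP => b.
  by rewrite mem_nseq => /andP[_ ->].
rewrite all_rcons => /andP[_ hy].
suff <- : y = nseq (size y) 0 by [].
apply/all_pred1P/allP => b hb; have := allP hy _ hb; have := allP ly _ hb.
by rewrite /= => bE /orP[//|/eqP eb]; rewrite eb ltnn in bE.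
Qed.

Lemma ok_cut x y k : ok x k -> cut y x -> ok y k.
Proof. by move=> h c; apply: ok_down h c _. Qed.

Lemma rcons_nseq n (a : nat) : rcons (nseq n a) a = nseq n.+1 a.
Proof. by elim: n => //= n ->. Qed.

Definition preserves (f : family) : Prop := forall x y z s s',
  x <= E -> y <= E -> z <= E -> all (holds (env E x y z)) (f_guard f) ->
  inv (f_src f) (env E x y z (f_src1 f)) (env E x y z (f_src2 f)) s ->
  act (f_op f) (f_chan f) (env E x y z (f_letter f)) s s' ->
  inv (f_dst f) (env E x y z (f_dst1 f)) (env E x y z (f_dst2 f)) s'.

(** Gives one goal per rule family; the bullets of the preservation proofs below follow the order of
    the lists. *)
Lemma all_preserve l : foldr (fun f Q => preserves f /\ Q) True l ->
  forall f, List.In f l -> preserves f.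
Proof. by elim: l => //= g l IH [hg /IH h] f [<-|/h]. Qed.

Ltac families := repeat match goal with |- _ /\ _ => split end.
Ltac pin y := first
  [(have ? : y = E by lia); subst y | (have ? : y = 0 by lia); subst y | idtac].
Ltac setup := move=> x y z [[o c] t] s' xE yE zE; rewrite /= ?addn0 ?add0n ?addn1 ?andbT => g.
Ltac fread := setup; move=> /[swap] -[x1 [/= -> ->]] /=.
Ltac fwrite := setup; move=> /[swap] -[z1 [z2 [/= er hz ->]]] /=.

Lemma pass_write y o c t z z' : inv Kow y 0 (o, c, t) -> o = z ++ z' ->
  all (fun b => b <= y) z' -> inv Ko y 0 (rcons z y, c, t).
Proof.
move=> [[w [r [k [h1 h2 h3 h4 h5]]]]|[W [k [ey h2 h3 h4]]]] er hz.
  by exists (rcons w y), r, k; split; [exact: out_write h2 er hz h1| |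
    |rewrite last_rcons|rewrite cat_rcons].
have [x' [h5 h6]] := part_write h2 er; subst y.
by exists [::], x', k; split => //; apply: ok_cut h4 h6.
Qed.

(** Common start of unfolding and folding. After the write, the part read in this pass becomes [w];
    the terminator as last letter means that a new pass begins with [w] empty. *)
Lemma pass_spot y p o c t z z' : inv Kow y 0 (o, c, t) -> o = z ++ z' ->
  all (fun b => b <= y) z' -> p <= y -> 0 < p < E ->
  exists w r k, [/\ spot p w, out w r (rcons z y), rest k c t & ok (w ++ r) k].
Proof.
move=> h e hz py pE; have [w [r [k [h1 h2 h3 h4 h5]]]] := pass_write h e hz.
exists w, r, k; split => //; split => //; split => //; first by case: h1 => ? [].
by case: (w) h4 => //= a w' ->.
Qed.

Lemma pass_preserves f : List.In f pass_families -> preserves f.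
Proof.
move: f; apply: all_preserve; rewrite /pass_families /=; families; last by [].
- fwrite; pin y; move=> [x0 [i [j [h1 h2 h3 h4]]]]; exists x0, i, j.+1; split => //.
    by rewrite -rcons_nseq; apply: out_write h2 er hz E0.
  by rewrite addnS.
- fread; pin y; move=> [x0 [i [j [h1 /out_nseq_read [i' [-> h2]] h3 h4]]]].
  by exists x0, i', j.
- fread; pin y; move=> [x0 [i [j [h1 /out_nseq_end [-> h2] h3 h4]]]].
  by exists x0, j.
- fwrite; pin y; move=> [x0 [j [h1 h2 h3 h4]]].
  have [k kj h5] := part_nseq_write h2 er.
  exists [::], x0, k; split => //; last by apply: ok_down h4 _ kj.
- fread; pin y; move=> [w [r [k [h1 h2 h3 h4 h5]]]].
  have [yE'|yE'] : y = E \/ y < E by lia.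
    right; subst y; have [er h6] := out_end h1; exists w, k; split => //.
    by rewrite er cats0 in h5.
  left; have [r' [er h6]] := out_read h1 yE'; exists w, r', k; split => //; last by rewrite -er.
  by rewrite rcons_path h3 /ascends h4.
- by fwrite; pin y; move/pass_write; apply; eauto.
- fwrite; pin y; move=> [[w [r [k [h1 h2 h3 h4 h5]]]]|[W [k [ey h2 h3 h4]]]]; first by rewrite ltnn in h1.
  have [x' [h5 h6]] := part_write h2 er.
  by exists x', k; split => //; apply: ok_cut h4 h6.
- fread; pin y; move=> [w [r [k [h1 h2 h3 h4 h5]]]].
  have yE' : y < E by lia.
  have [r' [er h6]] := out_read h1 yE'; exists w, r', k; split => //; first by lia.
  by rewrite (_ : E.-1 = y) -?er //; lia.
(* Meeting the terminator right after the letter [E.-1] certifies that this letter was a last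
   summand 1. *)
- fread; pin y; move=> [w [r [k [/out_end [-> [h1 h1']] h2 h3 h4 h5]]]].
  exists w, k; split => //; apply: ok_pred => //.
  by rewrite -cats1.
- fwrite; pin y; move=> [W [k [h1 h2 h3]]]; have [x' [h5 h6]] := part_write h1 er.
  by exists x', k; split => //; apply: ok_cut h3 h6.
(* The new zero is written behind the terminator of the counter, hence counts as one zero already
   rotated. *)
- fwrite; pin y; move=> [W [k [h1 [h2 h3] h4]]]; exists W, k, 1; split => //; last by rewrite addn1.
  exact: (out_write h2 er hz E0).
- fread; pin y; move=> [w [r [k [h1 h2 h3 h4 h5]]]].
  have [er h6] := out_end h1; exists w, k; split => //; first by lia.
  by rewrite er cats0 in h5.
- fwrite; pin y; move=> [w [k [[h1 h1'] h2 h3 h4 h5]]].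
  have ey : y = E.-1 by lia.
  exists (rcons w E.-1), k; split => //.
    split; first by rewrite /low all_rcons prednK // leqnn.
    rewrite er ey in h1' *; rewrite ey in hz; apply: emb_trans (emb_rcons _ h1').
    exact: emb_supersede.
  by move=> k' ek; apply: ok_succ => //; rewrite -ek.
- fwrite; pin y; move=> [W [k [h1 h2 h3]]]; have [x' [h5 h6]] := part_write h1 er.
  by exists x', k; split => // k' ek; apply: ok_cut h6; apply: h3.
(* The summand was added before the counter was known to be positive; this read supplies the
   predecessor on which the bound was made conditional. *)
- fread; pin y; move=> [W [k [h1 [/out_nseq_read [k' [ek h2]] h3] h4]]].
  by exists W, k', 0; split => //; rewrite addn0; apply: h4.
- fread; pin y; move=> [W [r [k [h1 h2 h3 h4]]]].
  have yE' : y < E by lia.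
  have [r' [er h5]] := out_read h2 yE'; exists W, r', k; split => // er'.
  rewrite cat_rcons -er; apply: h4; rewrite er er' (_ : E - x.+1 = (E - y.+1).+1) /=; last by lia.
  by have -> : y = x.+1 by lia.
- fwrite; pin y; move=> [W [r [k [h1 h2 h3 h4]]]].
  by exists (rcons W y), r, k; split => //; apply: out_write h2 er hz h1.
- fread; pin y; move=> [W [r [k [h1 h2 h3 h4]]]].
  have [er h5] := out_end h2; right; exists W, k; split => //.
  have := h4; rewrite /zok er cats0; apply.
  by rewrite (_ : E - x.+1 = 0) //; lia.
Qed.

Lemma reps_rcons v p n : reps v p n.+1 = reps v p n ++ rcons v p.
Proof. by rewrite /reps -addn1 nseqD flatten_cat /= cats0. Qed.

(** The copy kept in t is closed by [E], those in o by the letter [p]; losses in t thus carry over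
    to the copies in o. *)
Lemma cut_term p x u : cut x u -> all (fun b => b < p) u -> emb (rcons x p) (rcons u p).
Proof. by move=> h hu; apply: emb_term h _; apply: sub_all hu => i /=; apply: ltnW. Qed.

Lemma peak_zok e u w r n : 0 < e < E -> r = iota e.+1 (E - e.+1) ->
  w ++ u ++ e.-1 :: e :: r = peak e u E w /\ w ++ reps u e n ++ r = spread e u E w n.
Proof.
move=> he er; rewrite /peak /spread (_ : E - e = (E - e.+1).+1) /=; last by lia.
by rewrite -er.
Qed.

Lemma unfold_zok e u w r n : spot e w -> exponent_word e u ->
  ok (w ++ u ++ e.-1 :: e :: r) n -> zok (w ++ reps u e n) r e n.
Proof.
move=> [he hw] hu h er; have [e1 e2] := @peak_zok e u w r n he er.
by rewrite -catA e2; apply: ok_unfold => //; rewrite -e1.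
Qed.

(** The [n] copies are counted before the counter is closed by [E], which may lower it to [k]. *)
Lemma fold_zok e u w r n k : spot e w -> exponent_word e u -> 0 < n -> k <= n ->
  ok (w ++ reps u e n ++ r) n -> zok (rcons (rcons (w ++ u) e.-1) e) r e k.
Proof.
move=> [he hw] hu n0 kn h er; have [e1 e2] := @peak_zok e u w r n he er.
rewrite !cat_rcons -catA e1; apply: (@ok_down _ _ (peak e u E w) _ n) => //.
by apply: ok_fold => //; rewrite -e2.
Qed.

Lemma unfold_preserves f : List.In f unfold_families -> preserves f.
Proof.
move: f; apply: all_preserve; rewrite /unfold_families /=; families; last by [].
- fwrite; move=> h; have ez : z = E by lia.
  have [|//|w [r [k [h1 h2 [h3 h4] h5]]]] := @pass_spot y x o c t z1 z2 h er hz; try lia.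
  by exists w, r, [::], k.
- fread; move=> [w [r [u [k [h1 h2 h3 h4 [h5 h6 h7 h8]]]]]].
  have yE' : y < E by lia.
  have [r' [er h]] := out_read h2 yE'; exists w, r', u, k; split => //; split; last by rewrite -er.
    by rewrite all_rcons h5 andbT; lia.
  by rewrite rcons_path h6 /ascends h7; lia.
- fwrite; move=> [w [r [u [k [h1 h2 h3 h4 [h5 h6 h7]]]]]].
  have yE' : y < E by move: h5; rewrite all_rcons; case: h1; lia.
  exists w, r, (rcons u y), k; split => //; first exact: out_write h4 er hz yE'.
  by rewrite last_rcons cat_rcons.
- fread; move=> [w [r [u [k [h1 h2 h3 h4 [h5 h6 h7 h8]]]]]].
  have yE' : y < E by lia.
  have [r' [er h]] := out_read h2 yE'; exists w, r', u, k; split => //; split.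
    split => //; last by case: (u) h7 => //= a l ->; lia.
    by apply: ascends_base h6; apply: sub_all h5 => i /=; lia.
  by rewrite (_ : x.-1 = y) -?er //; lia.
- fread; move=> [w [r [u [k [h1 h2 h3 h4 [h5 h6]]]]]].
  have xE' : x < E by case: h1; lia.
  by have [r' [er h]] := out_read h2 xE'; exists w, r', u, k; rewrite -er.
- fread; pin y; move=> [w [r [u [k [h1 h2 h3 h4 [h5 h6]]]]]].
  by have [_ h] := out_end h4; exists w, r, u, k.
- fwrite; pin y; move=> [w [r [u [k [h1 h2 h3 h4 [h5 h6]]]]]].
  have [y [h7 h8]] := part_write h4 er.
  by exists w, r, u, y, 0, k; rewrite /reps /= cats0.
- fread; pin y; move=> [w [r [u [y [N [i [h1 h2 h3 h4 [h5 h6 h7]]]]]]]].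
  have [i' [ei h]] := out_nseq_read h3; exists w, r, u, y, N, i'.
  by rewrite -addnS -ei.
- fwrite; pin y; move=> [w [r [u [y [N [i [h1 h2 h3 h4 [h5 h6 h7]]]]]]]].
  exists w, r, u, [::], y, N, i; rewrite cats0; split => //.
  by rewrite -[_ :: _]/(nseq N.+1 0) -rcons_nseq; apply: out_write h3 er hz E0.
- fread; move=> [w [r [u [a [b [N [i [h1 h2 h3 h4 [h5 h6 h7]]]]]]]]].
  have yE' : y < E by lia.
  have [r' [er h]] := out_read h4 yE'; exists w, r, u, a, r', N, i; split => //.
  by rewrite -er.
- fwrite; move=> [w [r [u [a [b [N [i [h1 h2 h3 [yE' h4] [h5 h6 h7]]]]]]]]].
  exists w, r, u, a, b, N, i; split => //; split => //.
  exact: out_write h4 er hz yE'.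
- fwrite; move=> [w [r [u [a [b [N [i [h1 h2 h3 [yE' h4] [h5 h6 h7]]]]]]]]].
  exists w, r, u, (rcons a y), b, N, i; split => //; last by rewrite cat_rcons.
  by rewrite -!rcons_cat; apply: out_write h2 er hz yE'.
- fread; pin y; move=> [w [r [u [a [b [N [i [h1 h2 h3 h4 [h5 h6 h7]]]]]]]]].
  by have [eb h] := out_end h4; exists w, r, u, a, N, i; rewrite eb cats0 in h6.
- fwrite; pin y; move=> [w [r [u [a [N [i [h1 h2 h3 h4 [h5 h6 h7]]]]]]]].
  have [b [h8 h9]] := part_write h4 er.
  exists w, r, u, a, b, N, i; split => //; split => //.
  exact: emb_trans h9 h6.
- fwrite; move=> [w [r [u [a [b [N [i [h1 h2 h3 h4 [h5 h6 h8 h7]]]]]]]]].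
  have xE' : x < E by case: h1; lia.
  exists w, r, u, b, N.+1, i; split => //.
  have := out_write h2 er hz xE'; move=> [wr' [h9 h10 h11 h12]].
  exists wr'; split => //.
    case: h1 => _ [lw _ _]; case: h5 => lu _ _.
    rewrite /low all_cat lw /=; apply/allP => v /flattenP[l /nseqP[-> _]].
    rewrite mem_rcons inE => /orP[/eqP-> //|vu]; have := allP lu _ vu => /=; lia.
  apply: emb_trans h12 _; rewrite reps_rcons !rcons_cat; apply: emb_cat => //.
  apply: emb_cat => //; apply: cut_term h6 _; by case: h5.
- fread; pin y; move=> [w [r [u [a [N [i [h1 h2 h3 h4 [h5 h6 h7]]]]]]]].
  have [ei h] := out_nseq_end h3; exists (w ++ reps u x N), r, a, N; split => //.
    by case: h1; lia.
  by apply: unfold_zok; rewrite // -[X in ok _ X]addn0 -ei.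
- fwrite; pin y; move=> [W [r [a [k [h1 h2 h3 h4 h5]]]]].
  have [k' kk h6] := part_nseq_write h3 er.
  exists W, r, a, k'; split => // er'; apply: ok_down (h5 er') _ kk; exact: emb_refl.
- fread; move=> [W [r [a [k [h1 h2 h3 h4 h5]]]]].
  have yE' : y < E by lia.
  by have [r' [er h]] := out_read h4 yE'; exists W, r, r', k.
- fread; pin y; move=> [W [r [a [k [h1 h2 h3 h4 h5]]]]].
  by have [er h] := out_end h4; exists W, r, k.
- fwrite; pin y; move=> [W [r [k [h1 h2 h3 h4 h5]]]].
  by exists W, r, k; split => //; split => //; apply: part_write0 h4 er.
Qed.

Lemma fold_preserves f : List.In f fold_families -> preserves f.
Proof.
move: f; apply: all_preserve; rewrite /fold_families /=; families; last by [].
- fwrite; move=> h.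
  have [|//|w [r [k [h1 h2 [h3 h4] h5]]]] := @pass_spot y x o c t z1 z2 h er hz; try lia.
  by exists w, r, [::], k.
- fwrite; move=> [w [r [a [k [h1 h2 h3 h4 h5]]]]].
  have yE' : y < E by lia.
  exists w, r, (rcons a y), k; split => //; exact: out_write h4 er hz yE'.
- fread; pin y; move=> [w [r [a [k [h1 h2 h3 h4 h5]]]]].
  by have [_ h] := out_end h4; exists w, r, a, k.
- fwrite; pin y; move=> [w [r [a [k [h1 h2 h3 h4 h5]]]]].
  by have [b [h8 h9]] := part_write h4 er; exists w, r, b, k.
- fread; pin y; move=> [w [r [a [k [h1 h2 h3 h4 h5]]]]].
  (* With no copy read yet, the guessed word does not occur in the bounded word, so an arbitrary
     guess is safe. *)
  have [i' [ei h]] := out_nseq_read h3; exists w, r, a, 0, i'; split => // v _ _.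
  by rewrite add0n -ei.
- fread; pin y; move=> [w [r [a [N [i [[h1 N0] h2 h3 h4 h5]]]]]].
  have [i' [ei h]] := out_nseq_read h3; exists w, r, a, N, i'; split => //.
  by rewrite -addnS -ei.
- fwrite; pin y; move=> [w [r [a [N [i [h1 h2 h3 h4 h5]]]]]].
  exists w, r, [::], a, N, i; split => //.
  by rewrite -[_ :: _]/(nseq N.+1 0) -rcons_nseq; apply: out_write h3 er hz E0.
- fread; move=> [w [r [a [b [N [i [h1 h2 h3 h4 [h5 h6]]]]]]]].
  have yE' : y < E by lia.
  have [r' [er h]] := out_read h2 yE'; exists w, r', a, b, N, i; split => //; split.
    by rewrite all_rcons h5 andbT; lia.
  by rewrite -er.
- fread; move=> [w [r [a [b [N [i [h1 h2 h3 h4 [h5 h6]]]]]]]].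
  have yE' : y < E by move: h5; rewrite all_rcons; case: h1; lia.
  have [b' [eb h]] := out_read h4 yE'; exists w, r, a, b', N, i; split => //; split => //.
  by rewrite -eb.
- fwrite; move=> [w [r [a [b [N [i [h1 h2 h3 h4 [h5 h6]]]]]]]].
  have yE' : y < E by move: h5; rewrite all_rcons; case: h1; lia.
  exists w, r, (rcons a y), b, N, i; split => //; first exact: out_write h4 er hz yE'.
  by rewrite !cat_rcons.
- fread; pin y; move=> [w [r [a [b [N [i [h1 h2 h3 h4 [h5 h6]]]]]]]].
  by have [eb h] := out_end h4; exists w, r, a, N, i; rewrite eb cats0 in h6.
- fwrite; pin y; move=> [w [r [a [N [i [h1 h2 h3 h4 [h5 h6]]]]]]].
  by have [b [h8 h9]] := part_write h4 er; exists w, r, a, b, N, i.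
- fread; move=> [w [r [a [b [N [i [h1 h2 h3 h4 [h5 h6 h7]]]]]]]].
  have xE' : x < E by case: h1; lia.
  have [r' [er h]] := out_read h2 xE'; exists w, r', b, N.+1, i; split => //.
  move=> v hv vb; rewrite addSn.
  (* A word [v] below the possibly shrunken content of t is below the copy just read from o; closed
     by the letter [e], it can replace that copy as number [N.+1]. *)
  have va := emb_trans vb h6; apply: ok_emb (h7 v hv va) _.
  rewrite reps_rcons er -!catA; do 2 (apply: emb_cat => //).
  by rewrite -[_ :: r']/([:: x] ++ r') catA cats1; apply: emb_cat => //; apply: cut_term.
- fread; pin y; move=> [w [r [a [N [i [[h1 N0] h2 h3 h4 h5]]]]]].
  by have [ei h] := out_nseq_end h3; exists w, r, a, N; rewrite ei addn0 in h5.
- fwrite; pin y; move=> [w [r [a [N [[h1 N0] h2 h3 h4 h5]]]]].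
  have [k kN h6] := part_nseq_write h3 er.
  by exists w, r, [::], a, N, k; rewrite cats0.
- fread; move=> [w [r [a [b [N [k [[h1 N0 kN] h2 h3 h4 [h5 h6 h7 h8]]]]]]]].
  have yE' : y < E by lia.
  have [b' [eb h]] := out_read h4 yE'; exists w, r, a, b', N, k; split => //; split.
  + by rewrite all_rcons h5 andbT; lia.
  + by rewrite rcons_path h6 /ascends h7; lia.
  + by rewrite -eb.
- fwrite; move=> [w [r [a [b [N [k [[h1 N0 kN] h2 h3 h4 [h5 h6 h7]]]]]]]].
  have yE' : y < E by move: h5; rewrite all_rcons; case: h1; lia.
  exists w, r, (rcons a y), b, N, k; split => //.
    by rewrite -rcons_cat; apply: out_write h2 er hz yE'.
  by rewrite last_rcons cat_rcons.
- fread; pin y; move=> [w [r [a [b [N [k [[h1 N0 kN] h2 h3 h4 [h5 h6 h7 h8]]]]]]]].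
  have [eb h] := out_end h4; rewrite eb cats0 in h8.
  exists (w ++ a), r, k; split => //; first by case: h1; lia.
  (* The bound over all words below t is used once, for the word [a] that has been emitted from t as
     the new exponent. *)
  apply: fold_zok (h8 a h5 _) => //.
  split => //; last by case: (a) h7 => //= c' l ->; lia.
  by apply: ascends_base h6; apply: sub_all h5 => i /=; lia.
- fwrite; pin y; move=> [W [r [k [h1 h2 h3 h4 h5]]]].
  by exists W, r, k; split => //; split => //; apply: part_write0 h4 er.
- fwrite; move=> [W [r [k [h1 h2 h3 h4]]]].
  have yE' : y < E by lia.
  exists (rcons W y), r, k; split => //; first exact: out_write h2 er hz yE'.
  by rewrite (_ : y = x.-1) //; lia.
- fwrite; move=> [W [r [k [h1 h2 h3 h4]]]].
  by exists (rcons W x), r, k; split => //; apply: out_write h2 er hz h1.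
Qed.

Lemma main_preserves f : List.In f main_families -> preserves f.
Proof.
move=> /(@List.in_app_or _ pass_families _ _) [|]; first exact: pass_preserves.
move=> /(@List.in_app_or _ unfold_families _ _) [|]; first exact: unfold_preserves.
exact: fold_preserves.
Qed.

End Invariant.

(** * The finite system for a given alphabet: safety and robustness *)

Definition kinds : seq kind :=
  [:: Kbeg; Ktbeg; Kchk; Kchkw; Kcbeg; Kcw0; Kc0;
      Kcw; Kc; Kcend; Ko; Kow; Kfin;
      Kp1; Kp2; Kp3; Ks1; Ks2; Ks3;
      Ku; Kuw; Ku1; Ku2; Ku3; Kx; Kxc; Kxr; Kxt; Kxo; Kx1; Kx2; Kxe; Kclr; Kclr1;
      Kf; Kf1; Ky0; Ky; Kyc; Kyo; Kyt; Kytw; Ky1; Ky2; Kye;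
      Kg; Kgw; Kg1; Kg2; Kg3; Kz; Kzw].

Definition kind_index (k : kind) : nat :=
  match k with
  | Kbeg => 0 | Ktbeg => 1 | Kchk => 2 | Kchkw => 3 | Kcbeg => 4 | Kcw0 => 5 | Kc0 => 6
  | Kcw => 7 | Kc => 8 | Kcend => 9 | Ko => 10 | Kow => 11 | Kfin => 12
  | Kp1 => 13 | Kp2 => 14 | Kp3 => 15 | Ks1 => 16 | Ks2 => 17 | Ks3 => 18
  | Ku => 19 | Kuw => 20 | Ku1 => 21 | Ku2 => 22 | Ku3 => 23 | Kx => 24 | Kxc => 25
  | Kxr => 26 | Kxt => 27 | Kxo => 28 | Kx1 => 29 | Kx2 => 30 | Kxe => 31 | Kclr => 32
  | Kclr1 => 33 | Kf => 34 | Kf1 => 35 | Ky0 => 36 | Ky => 37 | Kyc => 38 | Kyo => 39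
  | Kyt => 40 | Kytw => 41 | Ky1 => 42 | Ky2 => 43 | Kye => 44 | Kg => 45 | Kgw => 46
  | Kg1 => 47 | Kg2 => 48 | Kg3 => 49 | Kz => 50 | Kzw => 51
  end.

Lemma kind_indexK : cancel kind_index (nth Kbeg kinds).
Proof. by case. Qed.

HB.instance Definition _ := Countable.copy kind (can_type kind_indexK).

Lemma kinds_enum : Finite.axiom kinds.
Proof. by case. Qed.

HB.instance Definition _ := isFinite.Build kind kinds_enum.

Definition families : seq family := init_families ++ main_families.

Definition state (d : nat) : finType := (kind * 'I_d.+2 * 'I_d.+2)%type.

Section Machine.

Variable d : nat.

Definition val_of (x y z : 'I_d.+2) (v : var) : 'I_d.+2 := inord (env d.+1 x y z v).

Definition rule_of (f : family) (x y z : 'I_d.+2) : pcs_rule (state d) d.+1 3 :=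
  let v := val_of x y z in
  ((f_src f, v (f_src1 f), v (f_src2 f)), f_chan f, f_op f, v (f_letter f),
   (f_dst f, v (f_dst1 f), v (f_dst2 f))).

Definition machine_rules : {set pcs_rule (state d) d.+1 3} :=
  [set r | [exists x : 'I_d.+2, exists y : 'I_d.+2, exists z : 'I_d.+2,
     has (fun f => all (holds (env d.+1 x y z)) (f_guard f) && (r == rule_of f x y z)) families]].

Definition machine : hardy_system d :=
  @HardySystem d (@Pcs d.+1 3 (state d) machine_rules)
    (Kbeg, ord0, ord0) (Kfin, ord0, ord0).

Lemma val_ofE x y z v : val_of x y z v = env d.+1 x y z v :> nat.
Proof. by rewrite inordK //; case: v => /=. Qed.

Lemma has_In (T : Type) (p : pred T) (l : seq T) : has p l -> exists f, List.In f l /\ p f.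
Proof.
elim: l => //= f l IH /orP[h|/IH [g [h1 h2]]]; first by exists f; split; first by left.
by exists g; split; first by right.
Qed.

Definition view (x : 3.-tuple (word d.+1)) : chans :=
  (map val (tnth x chO), map val (tnth x chC), map val (tnth x chT)).

Lemma chanP (P : 'I_3 -> Prop) : P chO -> P chC -> P chT -> forall i, P i.
Proof.
move=> h0 h1 h2 [[|[|[|]]] hi] //.
- by rewrite (_ : Ordinal hi = chO) //; apply: val_inj.
- by rewrite (_ : Ordinal hi = chC) //; apply: val_inj.
- by rewrite (_ : Ordinal hi = chT) //; apply: val_inj.
Qed.

Lemma get_view x (i : 'I_3) : get i (view x) = map val (tnth x i).
Proof. by move: i; apply: chanP. Qed.

Lemma put_view x y (i : 'I_3) : (forall j, j != i -> tnth x j = tnth y j) ->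
  view y = put i (map val (tnth y i)) (view x).
Proof.
by move: i; apply: chanP => h; rewrite /view /put /= !h.
Qed.

(** Passage from bounded letters and tuples to numbers and triples, so that guards become plain
    arithmetic. *)
Lemma wstep_act (c c' : pcs_config machine) : wstep c c' ->
  exists f (x y z : nat), [/\ List.In f families, [/\ x <= d.+1, y <= d.+1 & z <= d.+1],
    all (holds (env d.+1 x y z)) (f_guard f) &
    [/\ c.1.1.1 = f_src f, c'.1.1.1 = f_dst f,
        c.1.1.2 = env d.+1 x y z (f_src1 f) :> nat /\ c.1.2 = env d.+1 x y z (f_src2 f) :> nat,
        c'.1.1.2 = env d.+1 x y z (f_dst1 f) :> nat /\ c'.1.2 = env d.+1 x y z (f_dst2 f) :> nat &
        act (f_op f) (f_chan f) (env d.+1 x y z (f_letter f)) (view c.2) (view c'.2)]].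
Proof.
have main q i o a q' : (q, i, o, a, q') \in pcs_rules machine ->
  exists f (x y z : 'I_d.+2), [/\ List.In f families,
    all (holds (env d.+1 x y z)) (f_guard f) & (q, i, o, a, q') = rule_of f x y z].
  rewrite inE => /existsP[x /existsP[y /existsP[z /has_In [f [h /andP[h1 /eqP h2]]]]]].
  by exists f, x, y, z.
case=> [q q' i a x y hr ex ej|q q' i a x y z z' hr ex hz ey ej];
  have [f [x1 [y1 [z1 [h1 h2 e]]]]] := main _ _ _ _ _ hr;
  exists f, x1, y1, z1; split => //; try (by split; rewrite -ltnS ltn_ord).
- case: e => -> ei eo ea ->; split => //=; try by rewrite !val_ofE.
  rewrite -eo -ei /act /=; exists (map val (tnth y i)).
  by rewrite get_view ex /= ea val_ofE; split => //; apply: put_view.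
- case: e => -> ei eo ea ->; split => //=; try by rewrite !val_ofE.
  rewrite -eo -ei /act /=; exists (map val z), (map val z').
  rewrite get_view ex map_cat; split => //.
    by rewrite all_map; apply: sub_all hz => b /=; rewrite ea val_ofE.
  by rewrite (put_view ej) ey map_rcons ea /= val_ofE.
Qed.

Section Runs.

Variables (x0 y0 z0 : seq nat).

Notation E := d.+1.

Definition starts (a : oterm) (n : nat) : Prop :=
  [/\ height a <= E, ncode E a = x0, 0 < n, y0 = nseq n 0 & z0 = [::]].

(** The bound [M] exists only once the inputs are known to be a code and a nonempty block of zeros.
    Up to [Kc0] the invariant therefore relates the channels to the initial words and verifies
    these; from then on it is [inv] with the Hardy value of the decoded input as bound. *)
Definition init_inv (k : kind) (p q : nat) (s : chans) : Prop :=
  let: (o, c, t) := s in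
  match k with
  | Kbeg => [/\ o = x0 ++ [:: E], c = y0 ++ [:: E] & t = z0 ++ [:: E]]
  | Ktbeg => [/\ z0 = [::], o = x0 ++ [:: E], c = y0 ++ [:: E] & t = [::]]
  | Kchk => [/\ z0 = [::], c = y0 ++ [:: E], out E [::] [::] t &
      exists w r, [/\ x0 = w ++ r, out E w r o, path ascends E w & last E w = p]]
  | Kchkw => [/\ z0 = [::], c = y0 ++ [:: E], out E [::] [::] t &
      (exists w r, [/\ p < E, x0 = w ++ p :: r, out E w r o & path ascends E (rcons w p)])
      \/ [/\ p = E, part E x0 o, path ascends E x0 & E <= (last E x0).+1]]
  | Kcbeg => [/\ z0 = [::], c = y0 ++ [:: E], out E [::] [::] t &
      exists a x, [/\ height a <= E, ncode E a = x0, out E [::] x o & cut E x x0]]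
  | Kcw0 => [/\ z0 = [::], out E [::] [::] t,
      exists a x, [/\ height a <= E, ncode E a = x0, out E [::] x o & cut E x x0] &
      exists n r, y0 = nseq n.+1 0 ++ r /\ out E (nseq n 0) r c]
  | Kc0 => [/\ z0 = [::], out E [::] [::] t,
      exists a x, [/\ height a <= E, ncode E a = x0, out E [::] x o & cut E x x0] &
      exists n r, y0 = nseq n.+1 0 ++ r /\ out E (nseq n.+1 0) r c]
  | _ => exists a n, starts a n /\ inv E (hardy a n) k p q s
  end.

Hypotheses (lx : low E x0) (ly : low E y0) (lz : low E z0).

Definition init_preserves (f : family) : Prop := forall x y z s s',
  x <= E -> y <= E -> z <= E -> all (holds (env E x y z)) (f_guard f) ->
  init_inv (f_src f) (env E x y z (f_src1 f)) (env E x y z (f_src2 f)) s ->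
  act (f_op f) (f_chan f) (env E x y z (f_letter f)) s s' ->
  init_inv (f_dst f) (env E x y z (f_dst1 f)) (env E x y z (f_dst2 f)) s'.

Lemma init_all_preserve l : foldr (fun f Q => init_preserves f /\ Q) True l ->
  forall f, List.In f l -> init_preserves f.
Proof. by elim: l => //= g l IH [hg /IH h] f [<-|/h]. Qed.

Ltac families := repeat match goal with |- _ /\ _ => split end.
Ltac pin y := first
  [(have ? : y = d.+1 by lia); subst y | (have ? : y = 0 by lia); subst y | idtac].
Ltac setup := move=> x y z [[o c] t] s' xE yE zE; rewrite /= ?addn0 ?add0n ?addn1 ?andbT => g.
Ltac fread := setup; move=> /[swap] -[x1 [/= -> ->]] /=.
Ltac fwrite := setup; move=> /[swap] -[z1 [z2 [/= er hz ->]]] /=.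

Lemma init_main f : List.In f main_families -> init_preserves f.
Proof.
move=> hf x y z s s' h1 h2 h3 h4 h5 h6.
have hm n a : inv E (hardy a n) (f_src f) (env E x y z (f_src1 f)) (env E x y z (f_src2 f)) s ->
    inv E (hardy a n) (f_dst f) (env E x y z (f_dst1 f)) (env E x y z (f_dst2 f)) s'.
  by move=> h; apply: (@main_preserves E _ isT f hf x y z s).
suff [a [n [hs hi]]] : exists a n, starts a n /\
    inv E (hardy a n) (f_src f) (env E x y z (f_src1 f)) (env E x y z (f_src2 f)) s.
  have := hm _ _ hi; move: s' {h6 hm hi} => [[o c] t].
  by case: (f_dst f) => //= hi; exists a, n.
move: s h5 {h6 hm} => [[o c] t].
suff : f_src f \notin [:: Kbeg; Ktbeg; Kchk; Kchkw; Kcbeg; Kcw0; Kc0] by case: (f_src f).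
have : all (fun g => f_src g \notin [:: Kbeg; Ktbeg; Kchk; Kchkw; Kcbeg; Kcw0; Kc0]) main_families by [].
elim: main_families hf => //= g l IH [->|/IH h] /andP[h7 h8] //; exact: h.
Qed.

Lemma init_init f : List.In f init_families -> init_preserves f.
Proof.
move: f; apply: init_all_preserve; rewrite /init_families /=; families; last by [].
- fread; pin y; move=> [-> -> /esym ez].
  by have [-> ->] := read_end ez lz.
- fwrite; pin y; move=> [-> -> -> et]; split => //.
    apply: (@part_write0 E t z1 z2) => //; rewrite et; split => //; constructor.
  by exists [::], x0; split => //; exists [::]; split => //; constructor.
- fread; pin y; move=> [-> -> h1 [w [r [h2 h3 h4 h5]]]]; split => //.
  have [yE'|yE'] : y = E \/ y < E by lia.
    subst y; have [er h6] := out_end h3; right; rewrite h2 er cats0 h5; split => //.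
  have [r' [er h6]] := out_read h3 yE'; left; exists w, r'; rewrite -er; split => //.
  by rewrite rcons_path h4 /ascends h5.
- fwrite; pin y; move=> [-> -> h1 [[w [r [h2 h3 h4 h5]]]|[h2 h3 h4 h5]]]; last by lia.
  split => //; exists (rcons w y), r; rewrite cat_rcons last_rcons; split => //.
  exact: out_write h4 er hz h2.
- fwrite; pin y; move=> [-> -> h1 [[w [r [h2 h3 h4 h5]]]|[h2 h3 h4 h5]]]; first by lia.
  split => //; have [a [h6 h7]] := decode h4 lx h5.
  have [x' [h8 h9]] := part_write h3 er.
  by exists a, x'.
- fread; pin y; move=> [-> ec h1 h2]; split => //; exists 0.
  case: y0 ly ec => [|b r] //= /andP[_ hr] [<- ->]; exists r; split => //.
  by exists [::]; split => //; constructor.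
- fwrite; pin y; move=> [-> h1 h2 [n [r [h3 h4]]]]; split => //; exists n, r; split => //.
  by rewrite -[_ :: _]/(nseq n.+1 0) -rcons_nseq; apply: out_write h4 er hz _.
- fread; pin y; move=> [-> h1 h2 [n [r [h3 h4]]]]; split => //; exists n.+1.
  have [//|r' [er h5]] := out_read h4; exists r'; split => //.
  by rewrite h3 er -cat_rcons rcons_nseq.
- fread; pin y; move=> [h0 h1 [a [x' [h2 h3 h5 h6]]] [n [r [h7 h4]]]].
  have [er h] := out_end h4; exists a, n.+1; split.
    by split => //; rewrite h7 er cats0.
  (* The base case of the bound: what the check left in channel o embeds in the code of [a], whose
     own value is [M]. *)
  exists x', n.+1; split => // b m hb hx hm.
  apply: leq_trans (hardy_mono b hm) _; apply: hardy_tle => //.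
  by apply: (@emb_tle E E) => //; rewrite h3; apply: emb_trans hx h6.
Qed.

Lemma init_all f : List.In f families -> init_preserves f.
Proof.
move=> /(@List.in_app_or _ init_families _ _) [|]; first exact: init_init.
exact: init_main.
Qed.

Definition state_inv (c : pcs_config machine) : Prop :=
  init_inv c.1.1.1 c.1.1.2 c.1.2 (view c.2).

Lemma wsteps_inv (c c' : pcs_config machine) : wsteps c c' -> state_inv c -> state_inv c'.
Proof.
elim=> [{}c {}c' /wstep_act [f [x [y [z [h1 [h2 h3 h4] h5 [h6 h7 [h8 h9] [h10 h11] h12]]]]]]|//|c1 c2 c3 _ IH1 _ IH2 h].
  rewrite /state_inv h6 h7 h8 h9 h10 h11 => h.
  exact: (init_all h1 h2 h3 h4 h5 h h12).
exact/IH2/IH1.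
Qed.

End Runs.

Lemma lowwordP (w : word d.+1) : lowword w -> low d.+1 (map val w).
Proof. by move=> h; rewrite /low all_map; apply/allP => a /h. Qed.

Lemma map_dollar (w : word d.+1) : map val (rcons w (dollar d)) = map val w ++ [:: d.+1].
Proof. by rewrite map_rcons cats1. Qed.

Lemma out_dollar x (w : word d.+1) : out d.+1 [::] x (map val w) ->
  exists w', [/\ lowword w', w = rcons w' (dollar d) & map val w' = x].
Proof.
move=> [w0 [e lx _ /emb_nilI E0]]; rewrite E0 cats1 in e.
case/lastP: w e => [|w a]; first by case: x {lx}.
rewrite map_rcons => /rcons_inj [ew ea]; exists w; split => //.
  by move=> b hb; have := allP lx (val b); rewrite -ew map_f //= => /(_ isT).
by congr rcons; apply: val_inj; rewrite /= ea.
Qed.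

Lemma start_inv x y z :
  state_inv (map val x) (map val y) (map val z)
    (conf (hs_beg machine) (rcons x (dollar d)) (rcons y (dollar d)) (rcons z (dollar d))).
Proof.
by rewrite /state_inv /view /chO /chC /chT !(tnth_nth [::]) /= !map_dollar.
Qed.

Lemma in_code_ncode k a : k <= d.+2 -> height a <= k -> in_code k (code d.+1 k a).
Proof.
elim: k a => [|k IH] a kd; first by case: a => //= e r; rewrite leqn0 => /eqP; lia.
elim: a => [|e _ r IHr] /=; first by exists [::].
rewrite geq_max => /andP[he /IHr [us [h1 h2]]].
exists (code d.+1 k e :: us); split => [u|].
  by rewrite inE => /orP[/eqP->|/h1//]; apply: IH => //; apply: ltnW.
by rewrite /= -h2 cat_rcons.
Qed.

Lemma nseq_word n (w : word d.+1) : map val w = nseq n 0 -> w = nseq n ord0.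
Proof.
by move=> h; apply: (inj_map val_inj); rewrite h map_nseq.
Qed.

Lemma machine_weak : weak_hardy machine.
Proof.
rewrite /weak_hardy /safe /robust; cbv zeta.
split=> [x y z u v w hx hy hz hs|a b n m ha0 hb0 hs].
  have [lx ly lz] := And3 (lowwordP hx) (lowwordP hy) (lowwordP hz).
  have [a [n [[h1 h2 h3 h4 h5] [x' [k [h6 [h7 h8] h9]]]]]] := wsteps_inv lx ly lz hs (start_inv x y z).
  have ex : x = code d.+1 d.+1 a by apply: (inj_map val_inj); rewrite map_code.
  have ez : z = [::] by case: (z) h5.
  split => //.
  - by rewrite ex; apply: in_code_ncode.
  - by exists n; split => //; apply: nseq_word.
  move: h6 h7 h8; rewrite !(tnth_nth [::]) /=.
  move=> /out_dollar [u' [u1 u2 _]] /out_dollar [v' [v1 v2 _]] /out_dollar [w' [w1 w2 _]].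
  by exists u', v', w'.
have ha := tlt_height ha0; have hb := tlt_height hb0.
have lc c : lowword (s_code d c).
  move=> i hi; have := allP (ncode_lt d.+1 c) (val i).
  by rewrite -(@map_code d.+1) // map_f // => /(_ isT).
have ln : lowword (nseq n (ord0 : 'I_d.+2)) by move=> i /nseqP[->].
have [] // := @wsteps_inv (map val (s_code d a)) (map val (nseq n (ord0 : 'I_d.+2))) [::]
  (lowwordP (lc a)) (lowwordP ln) isT _ _ hs.
  exact: (start_inv _ _ [::]).
move=> a' [n' [[h1 h2 h3 h4 h5] [x' [k [h6 [h7 h8] h9]]]]].
rewrite map_nseq in h4; have en : n' = n by rewrite -(size_nseq n' 0) -h4 size_nseq.
rewrite map_code // in h2.
(* The decoded term [a'] has the same code as [a]; comparing them through the reflexive embedding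
   replaces an injectivity proof for codes. *)
have aa : hardy a' n' <= hardy a n.
  by rewrite en; apply: hardy_tle; rewrite -?en //; apply: (@emb_tle d.+1 d.+1) => //; rewrite h2.
apply: leq_trans aa.
move: h6 h7 h8; rewrite !(tnth_nth [::]) /=.
move=> /out_dollar [u' [_ u2 u3]] /out_dollar [v' [_ v2 v3]] _.
have {}u2 : s_code d b = u' by case/rcons_inj: u2.
have {}v2 : nseq m ord0 = v' by case/rcons_inj: v2.
have em : k = m by rewrite -(size_nseq k 0) -v3 -v2 map_nseq size_nseq.
apply: h9; [exact: hb| |by rewrite em].
by rewrite -u3 -u2 map_code.
Qed.

End Machine.

(** * Completeness *)

Lemma height_fund l n : is_limit l -> height (fund l n) <= height l.
Proof.
move=> hl; move: l hl; apply: limit_ind => [g b|g l hl IH].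
  rewrite fund_wexp_succ !height_add geq_max leq_max leqnn /=.
  by apply: leq_trans (height_mul _ _) _; rewrite /= height_add /=; lia.
by rewrite fund_wexp_limit // !height_add /=; lia.
Qed.

Section Complete.

Variable d : nat.

Notation E := d.+1.
Notation mach := (machine d).

Definition lift (k : kind) (p q : nat) (s : chans) : pcs_config mach :=
  ((k, inord p, inord q),
   [tuple map inord s.1.1; map inord s.1.2; map inord s.2]).

Definition reach k p q s k' p' q' s' := wsteps (lift k p q s) (lift k' p' q' s').

Definition next (f : family) (a : nat) (s : chans) : chans :=
  put (f_chan f) (if f_op f then rcons (get (f_chan f) s) a else behead (get (f_chan f) s)) s.

Lemma reach_refl k p q s : reach k p q s k p q s.
Proof. exact: rt_refl. Qed.

Lemma reach_trans k2 p2 q2 s2 k p q s k' p' q' s' : reach k p q s k2 p2 q2 s2 ->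
  reach k2 p2 q2 s2 k' p' q' s' -> reach k p q s k' p' q' s'.
Proof. exact: rt_trans. Qed.

Lemma In_has (T : Type) (p : pred T) (l : seq T) f : List.In f l -> p f -> has p l.
Proof. by elim: l => //= g l IH [->->|h /(IH h) ->]; rewrite ?orbT. Qed.

Lemma tnth_lift k p q s (i : 'I_3) : tnth (lift k p q s).2 i = map inord (get i s).
Proof. by move: i; apply: chanP. Qed.

Lemma get_put (i j : 'I_3) w s : get i (put j w s) = if i == j then w else get i s.
Proof. by move: i; apply: chanP; move: j; apply: chanP. Qed.

(** Lossless firing: a write takes the factorization with empty superseded part. *)
Lemma reach_step f x y z s k' p' q' s' :
  List.In f families -> x <= E -> y <= E -> z <= E -> all (holds (env E x y z)) (f_guard f) ->
  (if f_op f then True else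
     get (f_chan f) s = env E x y z (f_letter f) :: behead (get (f_chan f) s)) ->
  reach (f_dst f) (env E x y z (f_dst1 f)) (env E x y z (f_dst2 f)) (next f (env E x y z (f_letter f)) s) k' p' q' s' ->
  reach (f_src f) (env E x y z (f_src1 f)) (env E x y z (f_src2 f)) s k' p' q' s'.
Proof.
set v := env E x y z => hf xE yE zE hg ha; apply: rt_trans; apply: rt_step.
have hr : rule_of (d := d) f (inord x) (inord y) (inord z) \in pcs_rules mach.
  rewrite inE; apply/existsP; exists (inord x); apply/existsP; exists (inord y).
  apply/existsP; exists (inord z); apply: In_has hf _.
  by rewrite !inordK ?ltnS // hg eqxx.
have ev u : val_of (inord x) (inord y) (inord z) u = inord (v u) :> 'I_d.+2.
  by rewrite /val_of !inordK ?ltnS.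
move: hr; rewrite /rule_of !ev => hr.
have hj j : j != f_chan f -> get j (next f (v (f_letter f)) s) = get j s.
  by rewrite /next get_put => /negbTE ->.
have hi : get (f_chan f) (next f (v (f_letter f)) s) =
    if f_op f then rcons (get (f_chan f) s) (v (f_letter f)) else behead (get (f_chan f) s).
  by rewrite /next get_put eqxx.
rewrite /lift; case eo : (f_op f) ha hi hr => ha hi hr.
- apply: (WWrite (z := map inord (get (f_chan f) s)) (z' := [::]) hr) => //.
  + by rewrite cats0; apply: (tnth_lift Kbeg 0 0).
  + by rewrite -map_rcons -hi; apply: (tnth_lift Kbeg 0 0).
  + by move=> j /hj e; rewrite (tnth_lift Kbeg 0 0 s) (tnth_lift Kbeg 0 0 (next _ _ _)) e.
- apply: (WRead hr).
  + by rewrite (tnth_lift Kbeg 0 0 s) (tnth_lift Kbeg 0 0 (next _ _ _)) ha hi.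
  + by move=> j /hj e; rewrite (tnth_lift Kbeg 0 0 s) (tnth_lift Kbeg 0 0 (next _ _ _)) e.
Qed.

Lemma In_init f : List.In f init_families -> List.In f families.
Proof. by move=> h; apply: (@List.in_or_app _ init_families main_families); left. Qed.

Lemma In_main f : List.In f main_families -> List.In f families.
Proof. by move=> h; apply: (@List.in_or_app _ init_families main_families); right. Qed.

Lemma In_pass f : List.In f pass_families -> List.In f families.
Proof.
move=> h; apply: In_main; apply: (@List.in_or_app _ pass_families (unfold_families ++ fold_families)).
by left.
Qed.

Lemma In_unfold f : List.In f unfold_families -> List.In f families.
Proof.
move=> h; apply: In_main; apply: (@List.in_or_app _ pass_families (unfold_families ++ fold_families)).
by right; apply: (@List.in_or_app _ unfold_families fold_families); left.
Qed.

Lemma In_fold f : List.In f fold_families -> List.In f families.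
Proof.
move=> h; apply: In_main; apply: (@List.in_or_app _ pass_families (unfold_families ++ fold_families)).
by right; apply: (@List.in_or_app _ unfold_families fold_families); right.
Qed.

Lemma In_nth (T : Type) (x0 : T) (l : seq T) i : i < size l -> List.In (nth x0 l i) l.
Proof. by elim: l i => //= a l IH [|i] h; [left|right; apply: IH]. Qed.

Definition dummy := rd Kbeg Zero Zero chO Zero Kbeg Zero Zero [::].

(* Fires rule family number i of the list l, with parameters x, y and z. *)
Ltac fire_in lem l i x y z :=
  refine (@reach_step (nth dummy l i) x y z _ _ _ _ _ (lem _ (@In_nth _ dummy l i isT)) _ _ _ _ _ _);
  [try done; lia | try done; lia | try done; lia |
   rewrite /= ?addn0 ?add0n ?addn1 ?andbT; try done; lia | try done | rewrite /next /=].
Ltac fire_init i x y := fire_in In_init init_families i x y 0.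
Ltac fire_pass i x y := fire_in In_pass pass_families i x y 0.
Ltac fire_unfold i x y z := fire_in In_unfold unfold_families i x y z.
Ltac fire_fold i x y z := fire_in In_fold fold_families i x y z.

Lemma low_cons b r : low E (b :: r) -> b < E /\ low E r.
Proof. by move/andP. Qed.

Lemma run_check r l w c t : low E r -> l <= E -> path ascends l r ->
  reach Kchk l 0 (r ++ E :: w, c, t) Kchk (last l r) 0 (E :: w ++ r, c, t).
Proof.
elim: r l w => [|b r IH] l w /=; first by rewrite cats0 => _ _ _; apply: reach_refl.
move=> /low_cons[bE hr] lE /andP[h1 h2]; rewrite /ascends in h1.
fire_init 2 l b; fire_init 3 0 b.
by rewrite rcons_cat /= -(cat_rcons b w r); apply: IH => //; apply: ltnW.
Qed.

Lemma run_pass r l w c t : low E r -> l <= E -> path ascends l r ->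
  reach Ko l 0 (r ++ w, c, t) Ko (last l r) 0 (w ++ r, c, t).
Proof.
elim: r l w => [|b r IH] l w /=; first by rewrite cats0 => _ _ _; apply: reach_refl.
move=> /low_cons[bE hr] lE /andP[h1 h2]; rewrite /ascends in h1.
fire_pass 4 l b; fire_pass 5 0 b.
by rewrite rcons_cat -(cat_rcons b w r); apply: IH => //; apply: ltnW.
Qed.

Lemma run_count i j o t :
  reach Kc 0 0 (o, nseq i 0 ++ E :: nseq j 0, t) Ko E 0 (o, nseq (i + j) 0 ++ [:: E], t).
Proof.
elim: i j => [|i IH] j; last rewrite addSnnS /=.
  fire_pass 2 0 (d.+1); fire_pass 3 0 (d.+1).
  by rewrite add0n -cats1; apply: reach_refl.
fire_pass 1 0 0; fire_pass 0 0 0.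
by rewrite rcons_cat /= rcons_nseq; apply: IH.
Qed.

Lemma run_count0 i j o t :
  reach Kc0 0 0 (o, nseq i 0 ++ E :: nseq j 0, t) Ko E 0 (o, nseq (i + j) 0 ++ [:: E], t).
Proof.
elim: i j => [|i IH] j; last rewrite addSnnS /=.
  fire_init 8 0 (d.+1); fire_pass 3 0 (d.+1).
  by rewrite add0n -cats1; apply: reach_refl.
fire_init 7 0 0; fire_init 6 0 0.
by rewrite rcons_cat /= rcons_nseq; apply: IH.
Qed.

Lemma run_init x n : low E x -> path ascends E x -> E <= (last E x).+1 -> 0 < n ->
  reach Kbeg 0 0 (x ++ [:: E], nseq n 0 ++ [:: E], [:: E])
    Ko E 0 (x ++ [:: E], nseq n 0 ++ [:: E], [:: E]).
Proof.
move=> lx px ex; case: n => // n _.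
fire_init 0 0 (d.+1); fire_init 1 0 (d.+1).
apply: reach_trans (@run_check x E [::] _ _ lx (leqnn _) px) _.
have le : last E x <= E by have := mem_last E x; rewrite inE => /orP[/eqP->//|/(allP lx)/ltnW].
fire_init 2 (last (d.+1) x) (d.+1); fire_init 4 0 (d.+1).
fire_init 5 0 0; fire_init 6 0 0.
rewrite rcons_cat /= -cats1 -[[:: E; 0]]/([:: E] ++ nseq 1 0).
have := @run_count0 n 1 (x ++ [:: E]) [:: E]; rewrite addn1; exact.
Qed.

Lemma run_pass_all x c t : low E x -> path ascends E x -> E <= (last E x).+1 ->
  reach Ko E 0 (x ++ [:: E], c, t) Kow E 0 (x, c, t).
Proof.
move=> lx px ex; apply: reach_trans (@run_pass x E [:: E] _ _ lx (leqnn _) px) _.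
have le : last E x <= E by have := mem_last E x; rewrite inE => /orP[/eqP->//|/(allP lx)/ltnW].
by fire_pass 4 (last (d.+1) x) (d.+1); apply: reach_refl.
Qed.

Lemma run_final x c t : low E x -> path ascends E x -> E <= (last E x).+1 ->
  reach Ko E 0 (x ++ [:: E], c, t) Kfin 0 0 (x ++ [:: E], c, t).
Proof.
move=> lx px ex; apply: reach_trans (run_pass_all c t lx px ex) _.
by fire_pass 6 0 (d.+1); rewrite -cats1; apply: reach_refl.
Qed.

Lemma last_le x : low E x -> last E x <= E.
Proof. by move=> lx; have := mem_last E x; rewrite inE => /orP[/eqP->//|/(allP lx)/ltnW]. Qed.

Lemma run_pred x n : low E x -> path ascends E x -> E <= (last E x).+1 ->
  reach Ko E 0 (rcons x d ++ [:: E], nseq n 0 ++ [:: E], [:: E])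
    Ko E 0 (x ++ [:: E], nseq n.+1 0 ++ [:: E], [:: E]).
Proof.
move=> lx px ex; rewrite cat_rcons.
apply: reach_trans (@run_pass x E _ _ _ lx (leqnn _) px) _.
have le := last_le lx.
fire_pass 7 (last (d.+1) x) d; fire_pass 8 0 (d.+1); fire_pass 9 0 (d.+1); fire_pass 10 0 0.
rewrite -cats1 rcons_cat; have := @run_count n 1 (x ++ [:: E]) [:: E]; rewrite addn1; exact.
Qed.

Lemma run_succ x n : low E x -> path ascends E x -> E <= (last E x).+1 ->
  reach Ko E 0 (x ++ [:: E], nseq n.+1 0 ++ [:: E], [:: E])
    Ko E 0 (rcons x d ++ [:: E], nseq n 0 ++ [:: E], [:: E]).
Proof.
move=> lx px ex; apply: reach_trans (@run_pass x E _ _ _ lx (leqnn _) px) _.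
have le := last_le lx.
fire_pass 11 (last (d.+1) x) (d.+1); fire_pass 12 0 d; fire_pass 13 0 (d.+1); fire_pass 14 0 0.
rewrite -cats1; have := @run_count n 0 (rcons x d ++ [:: E]) [:: E]; rewrite addn0; exact.
Qed.

(** If [w] is empty, the limit step starts when the terminator is about to be written back, hence
    only after a complete checking pass. *)
Lemma run_spot e w r c t : e <= E -> e <= last e w -> low E (w ++ r) ->
  path ascends E (w ++ r) -> E <= (last E (w ++ r)).+1 ->
  exists y o, [/\ reach Ko E 0 (w ++ r ++ [:: E], c, t) Kow y 0 (o, c, t),
    e <= y <= E & rcons o y = r ++ E :: w].
Proof.
move=> eE; case/lastP: w => [|w b] ew lw pw cw.
  by exists E, r; split; [exact: run_pass_all|rewrite eE leqnn|rewrite cats1].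
move: lw; rewrite /low all_cat all_rcons => /andP[/andP[bE lw] lr].
move: pw; rewrite cat_path rcons_path => /andP[/andP[p1 p2] p3].
exists b, ((r ++ [:: E]) ++ w); split; last by rewrite -catA /= !rcons_cat.
  rewrite cat_rcons; apply: reach_trans (@run_pass w E _ _ _ lw (leqnn _) p1) _.
  have le := last_le lw; rewrite /ascends in p2.
  by fire_pass 4 (last (d.+1) w) b; apply: reach_refl.
by rewrite (ltnW bE) andbT; move: ew; rewrite last_rcons.
Qed.

Lemma run_tail m e w c t : e.+1 + m = E ->
  reach Kz e 0 (iota e.+1 m ++ E :: w, c, t) Kow E 0 (w ++ iota e.+1 m, c, t).
Proof.
elim: m e w => [|m IH] e w /= em.
  by fire_pass 17 e (d.+1); rewrite cats0; apply: reach_refl.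
fire_pass 15 e (e.+1); fire_pass 16 0 (e.+1).
by rewrite rcons_cat /= -(cat_rcons e.+1 w); apply: IH; lia.
Qed.

Section Step.

Variable e : nat.
Hypothesis he : 0 < e < E.

Lemma run_read_exponent u l o c t : all (fun b => b < e) u -> l <= E -> path ascends l u ->
  reach Ku e l (u ++ o, c, t) Ku e (last l u) (o, c, t ++ u).
Proof.
elim: u l t => [|b u IH] l t /=; first by rewrite cats0 => _ _ _; apply: reach_refl.
move=> /andP[be hu] lE /andP[h1 h2]; rewrite /ascends in h1.
fire_unfold 1 e b l; fire_unfold 2 e b 0.
by rewrite -(cat_rcons b t u); apply: IH => //; lia.
Qed.

Lemma run_copy x o c w : low E x ->
  reach Kxr e 0 (o, c, x ++ w) Kxr e 0 (o ++ x, c, w ++ x).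
Proof.
elim: x o w => [|b x IH] o w /=; first by rewrite !cats0 => _; apply: reach_refl.
move=> /low_cons[bE hx].
fire_unfold 9 e b 0; fire_unfold 10 e b 0; fire_unfold 11 e b 0.
by rewrite rcons_cat -(cat_rcons b w x) -(cat_rcons b o x); apply: IH.
Qed.

Lemma rcons_zeros i j : rcons (nseq i 0 ++ E :: nseq j 0) 0 = nseq i 0 ++ E :: nseq j.+1 0.
Proof. by rewrite rcons_cat /= rcons_nseq. Qed.

Lemma run_spread u i j o : low E u ->
  reach Kx e 0 (o, nseq i 0 ++ E :: nseq j 0, u ++ [:: E])
    Kx e 0 (o ++ reps u e i, E :: nseq (i + j) 0, u ++ [:: E]).
Proof.
move=> lu; elim: i j o => [|i IH] j o; first by rewrite cats0; apply: reach_refl.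
rewrite addSnnS /=.
fire_unfold 7 e 0 0; fire_unfold 8 e 0 0.
apply: reach_trans (run_copy _ _ _ lu) _.
fire_unfold 12 e (d.+1) 0; fire_unfold 13 e (d.+1) 0; fire_unfold 14 e 0 0.
rewrite rcons_zeros rcons_cat -(cats1 u E).
have -> : o ++ reps u e i.+1 = (o ++ rcons u e) ++ reps u e i by rewrite -catA.
exact: IH.
Qed.

Lemma run_clear x o c : low E x -> reach Kclr e 0 (o, c, x ++ [:: E]) Kz e 0 (o, c, [:: E]).
Proof.
elim: x => [|b x IH] /=.
  by move=> _; fire_unfold 18 e (d.+1) 0; fire_unfold 19 e (d.+1) 0; apply: reach_refl.
by move=> /low_cons[bE /IH h]; fire_unfold 17 e b 0.
Qed.

Lemma run_guess v o c t : all (fun b => b < e) v ->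
  reach Kf e 0 (o, c, t) Kf e 0 (o, c, t ++ v).
Proof.
elim: v t => [|b v IH] t /=; first by rewrite cats0 => _; apply: reach_refl.
move=> /andP[be /IH h]; fire_fold 1 e b 0.
by rewrite -(cat_rcons b t v); apply: h.
Qed.

Lemma run_compare x o c w : all (fun b => b < e) x ->
  reach Kyo e 0 (x ++ o, c, x ++ w) Kyo e 0 (o, c, w ++ x).
Proof.
elim: x w => [|b x IH] w /=; first by rewrite cats0 => _; apply: reach_refl.
move=> /andP[be hx].
fire_fold 7 e b 0; fire_fold 8 e b 0; fire_fold 9 e b 0.
by rewrite rcons_cat -(cat_rcons b w x); apply: IH.
Qed.

Lemma run_match v o c : all (fun b => b < e) v ->
  reach Kyc e 0 (rcons v e ++ o, c, v ++ [:: E]) Ky e 0 (o, rcons c 0, v ++ [:: E]).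
Proof.
move=> hv; rewrite cat_rcons.
fire_fold 6 e 0 0.
apply: reach_trans (run_compare _ _ _ hv) _.
fire_fold 10 e (d.+1) 0; fire_fold 11 e (d.+1) 0; fire_fold 12 e 0 0.
by rewrite -(cats1 v); apply: reach_refl.
Qed.

Lemma run_collect v i j o : all (fun b => b < e) v ->
  reach Ky e 0 (reps v e i ++ o, nseq i 0 ++ E :: nseq j 0, v ++ [:: E])
    Ky e 0 (o, E :: nseq (i + j) 0, v ++ [:: E]).
Proof.
move=> hv; elim: i j => [|i IH] j; first exact: reach_refl.
rewrite addSnnS /=; fire_fold 5 e 0 0.
rewrite -catA; apply: reach_trans (run_match _ _ hv) _.
by rewrite rcons_zeros; apply: IH.
Qed.

Lemma run_emit v l o c w : all (fun b => b < e) v -> l <= E -> path ascends l v ->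
  reach Kg e l (o, c, v ++ w) Kg e (last l v) (o ++ v, c, w).
Proof.
elim: v l o => [|b v IH] l o /=; first by rewrite cats0 => _ _ _; apply: reach_refl.
move=> /andP[be hv] lE /andP[h1 h2]; rewrite /ascends in h1.
fire_fold 15 e b l; fire_fold 16 e b 0.
by rewrite -(cat_rcons b o v); apply: IH => //; lia.
Qed.

Variables (u w : seq nat).
Hypotheses (hu : exponent_word e u) (hw : limit_word e E w).

Notation valid x := [/\ low E x, path ascends E x & E <= (last E x).+1].

Lemma low_exponent : low E u.
Proof. by case: hu => h _ _; apply: sub_all h => i /=; lia. Qed.

Lemma run_unfold n : valid (peak e u E w) ->
  reach Ko E 0 (peak e u E w ++ [:: E], nseq n 0 ++ [:: E], [:: E])
    Ko E 0 (spread e u E w n ++ [:: E], nseq n 0 ++ [:: E], [:: E]).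
Proof.
case: (hu) (hw) => u1 u2 u3 [w1 w2 w3] [p1 p2 p3].
have [|y [o [h1 /andP[h2 h3] h4]]] := run_spot (nseq n 0 ++ [:: E]) [:: E] _ w3 p1 p2 p3; first by lia.
rewrite {1}/peak -catA; apply: reach_trans h1 _.
fire_unfold 0 e y (d.+1); rewrite h4 -!catA.
have lu : last E u <= E by apply: last_le low_exponent.
apply: reach_trans (run_read_exponent _ _ _ u1 (leqnn _) _) _.
  by apply: ascends_base u2; apply: sub_all u1 => i /=; lia.
have le : e.-1 <= last E u by case: (u) u3 => [|a l] /=; lia.
rewrite (_ : E - e = (E - e.+1).+1) /=; last by lia.
fire_unfold 3 e (e.-1) (last (d.+1) u); fire_unfold 4 e 0 0; fire_unfold 5 e (d.+1) 0; fire_unfold 6 e (d.+1) 0.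
rewrite -cats1; apply: reach_trans (@run_spread u n 0 _ low_exponent) _.
fire_unfold 15 e (d.+1) 0; fire_unfold 16 e (d.+1) 0.
apply: reach_trans (run_clear _ _ low_exponent) _.
rewrite -catA.
apply: reach_trans (run_tail _ _ _ _) _; first by lia.
fire_pass 5 0 (d.+1); by rewrite -!(cats1 _ E) addn0 /spread -!catA; apply: reach_refl.
Qed.

Lemma run_fold n : 0 < n -> valid (spread e u E w n) ->
  reach Ko E 0 (spread e u E w n ++ [:: E], nseq n 0 ++ [:: E], [:: E])
    Ko E 0 (peak e u E w ++ [:: E], nseq n 0 ++ [:: E], [:: E]).
Proof.
case: n => // n _; case: (hu) (hw) => u1 u2 u3 [w1 w2 w3] [p1 p2 p3].
have [|y [o [h1 /andP[h2 h3] h4]]] := run_spot (nseq n.+1 0 ++ [:: E]) [:: E] _ w3 p1 p2 p3; first by lia.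
rewrite {1}/spread -catA; apply: reach_trans h1 _.
fire_fold 0 e y 0; rewrite h4 -!catA.
apply: reach_trans (run_guess _ _ _ u1) _.
fire_fold 2 e (d.+1) 0; fire_fold 3 e (d.+1) 0; fire_fold 4 e 0 0.
rewrite -?catA -(cats1 u E).  apply: reach_trans (run_match _ _ u1) _.
rewrite rcons_cat -[rcons [:: E] 0]/(E :: nseq 1 0).
apply: reach_trans (run_collect _ _ _ u1) _.
fire_fold 13 e (d.+1) 0; fire_fold 14 e (d.+1) 0.
apply: reach_trans (run_emit _ _ _ u1 (leqnn _) _) _.
  by apply: ascends_base u2; apply: sub_all u1 => i /=; lia.
have lu : last E u <= E by apply: last_le low_exponent.
have le : e.-1 <= last E u by case: (u) u3 => [|a l] /=; lia.
fire_fold 17 e (d.+1) (last (d.+1) u); fire_fold 18 e (d.+1) 0; fire_fold 19 e (e.-1) 0; fire_fold 20 e 0 0.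
rewrite -catA /= !rcons_cat /=.
apply: reach_trans (run_tail _ _ _ _) _; first by lia.
fire_pass 5 0 (d.+1).
rewrite -!cats1 addn1 /peak (_ : E - e = (E - e.+1).+1) /=; last by lia.
by rewrite -!catA; apply: reach_refl.
Qed.

End Step.

Definition at_rest (a : oterm) (n : nat) : chans :=
  (ncode E a ++ [:: E], nseq n 0 ++ [:: E], [:: E]).

Lemma valid_ncode a : height a <= E ->
  [/\ low E (ncode E a), path ascends E (ncode E a) & E <= (last E (ncode E a)).+1].
Proof. by move=> h; have [p1 p2] := ncode_path h (leqnSn E); split => //; apply: ncode_lt. Qed.

(** Both directions run through the same intermediate configurations, so one induction on the Hardy
    computation serves both forms of completeness. *)
Lemma run_hardy a n m : hardy_graph a n m -> height a <= E -> 0 < n ->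
  reach Ko E 0 (at_rest a n) Ko E 0 (at_rest Tzero m) /\
  reach Ko E 0 (at_rest Tzero m) Ko E 0 (at_rest a n).
Proof.
elim=> {a n m} [n _ _|a n m _ IH|a n m la _ IH] //=; first by split; apply: reach_refl.
  rewrite height_add geq_max => /andP[ha _] _; have [h1 h2] := IH ha isT.
  have [v1 v2 v3] := valid_ncode ha.
  have e : ncode E (tadd a tone) = rcons (ncode E a) d by rewrite ncode_succ.
  split.
    by apply: reach_trans h1; rewrite /at_rest e; apply: run_pred.
  by apply: (reach_trans h2); rewrite /at_rest e; apply: run_succ.
move=> ha n0; have hf := leq_trans (height_fund n la) ha; have [h1 h2] := IH hf n0.
have va := valid_ncode ha; have vf := valid_ncode hf.
have [e [u [w [h3 h4 h5 h6 h7]]]] := limit_peak la ha.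
rewrite h6 in va; rewrite h7 in vf; split.
  by apply: reach_trans h1; rewrite /at_rest h6 h7; apply: run_unfold.
by apply: (reach_trans h2); rewrite /at_rest h6 h7; apply: run_fold.
Qed.

Lemma hardy_conf_lift (k : kind) a n :
  hardy_conf (S := machine d) (k, ord0, ord0) a n = lift k 0 0 (at_rest a n).
Proof.
have i0 : inord 0 = ord0 :> 'I_E.+1 by apply: val_inj; rewrite /= inordK.
have iE : inord E = dollar d by apply: val_inj; rewrite /= inordK.
have im (w : word E) : map inord (map val w) = w.
  by rewrite -map_comp map_id_in // => b _; apply: inord_val.
rewrite /lift /hardy_conf /conf /at_rest /= i0 !map_cat /= iE !cats1 map_nseq i0.
by rewrite -(@map_code E) // im.
Qed.

Lemma machine_complete : complete (machine d).
Proof.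
move=> a n /tlt_height ha n0; rewrite !hardy_conf_lift.
have [v1 v2 v3] := valid_ncode ha; have [h _] := run_hardy (hardyP a n) ha n0.
apply: reach_trans (run_init v1 v2 v3 n0) _; apply: (reach_trans h).
exact: (@run_final [::]).
Qed.

(** The inverse run starts from the Hardy value, which must be positive to pass the initial check of
    the counter. *)
Lemma hardy_ge a n m : hardy_graph a n m -> n <= m.
Proof. by elim=> // {}a {}n {}m _ /ltnW. Qed.

Lemma machine_inv_complete : inv_complete (machine d).
Proof.
move=> a n /tlt_height ha n0; rewrite !hardy_conf_lift.
have [v1 v2 v3] := valid_ncode ha; have [_ h] := run_hardy (hardyP a n) ha n0.
apply: reach_trans (run_final _ _ v1 v2 v3); apply: reach_trans h.
by apply: (@run_init [::]) => //; apply: leq_trans n0 (hardy_ge (hardyP a n)).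
Qed.

End Complete.

(** * Structured programs for log-space machines *)

Definition sym : finType := option (option bool).
Definition blank : sym := None.
Definition mark : sym := Some None.
Definition bit (b : bool) : sym := Some (Some b).

Section Programs.

Variables (K : nat) (Out : finType).

Notation syms := (K.-tuple sym).
Notation acts := (K.-tuple (sym * move)).
Notation effect := (move * acts * option Out)%type.

Inductive prog :=
| Act of (syms -> effect)
| Seq of prog & prog
| While of (incell unit -> syms -> bool) & prog.

(** A control state is a position in the syntax tree, so the machine is finite and independent of
    the input. In [While], [None] is the test, which costs one idle step. *)
Fixpoint pstate (p : prog) : finType :=
  match p with
  | Act _ => unit
  | Seq p q => (pstate p + pstate q)%type
  | While _ p => option (pstate p)
  end.

Fixpoint pstart (p : prog) : pstate p :=
  match p with
  | Act _ => tt
  | Seq p q => inl (pstart p)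
  | While _ p => None
  end.

Definition idle (s : syms) : effect := (Stay, [tuple (tnth s i, Stay) | i < K], None).

(* [None] is the exit of the program. *)
Fixpoint pdelta (p : prog) : pstate p -> incell unit -> syms -> option (pstate p) * effect :=
  match p with
  | Act a => fun _ _ s => (None, a s)
  | Seq p q => fun x i s =>
      match x with
      | inl x => let (y, e) := pdelta x i s in
          (Some (if y is Some y then inl y else inr (pstart q)), e)
      | inr x => let (y, e) := pdelta x i s in (omap inr y, e)
      end
  | While b p => fun x i s =>
      match x with
      | None => (if b i s then Some (Some (pstart p)) else None, idle s)
      | Some x => let (y, e) := pdelta x i s in (Some y, e)
      end
  end.

Definition program_machine (p : prog) : transducer unit Out :=
  @Transducer unit Out (option (pstate p)) sym blank K (Some (pstart p))
    (fun x i s => if x is Some x then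
       let: (y, (mv, acts, o)) := pdelta x i s in Some (y, mv, acts, o) else None).

Record mem := Mem { m_pos : nat; m_tapes : K.-tuple (nat * seq sym); m_out : seq Out }.

Definition scan (t : nat * seq sym) : sym := nth blank t.2 t.1.

Definition write (t : nat * seq sym) (a : sym * move) : nat * seq sym :=
  (match a.2 with MoveL => t.1.-1 | Stay => t.1 | MoveR => t.1.+1 end,
   set_nth blank t.2 t.1 a.1).

Variables (x : seq unit) (S : nat).

Definition scans (m : mem) : syms := map_tuple scan (m_tapes m).

Definition apply_effect (e : effect) (m : mem) : mem :=
  let: (mv, acts, o) := e in
  Mem (move_input x mv (m_pos m))
    [tuple write (tnth (m_tapes m) i) (tnth acts i) | i < K]
    (if o is Some b then rcons (m_out m) b else m_out m).

Definition fits (m : mem) : Prop := forall i, (tnth (m_tapes m) i).1 < S.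

(** The space bound is demanded at every configuration of the run, so a single induction yields both
    the output and [tm_space]. *)
Inductive runs (p : prog) : option (pstate p) -> mem -> mem -> Prop :=
| runs_done m : fits m -> runs None m m
| runs_step q q' e m m' : fits m ->
    pdelta q (read_input x (m_pos m)) (scans m) = (q', e) ->
    runs q' (apply_effect e m) m' -> runs (Some q) m m'.

Definition exec (p : prog) (m m' : mem) : Prop := runs (Some (pstart p)) m m'.

Lemma exec_act a m : fits m -> fits (apply_effect (a (scans m)) m) ->
  exec (Act a) m (apply_effect (a (scans m)) m).
Proof. by move=> h1 h2; apply: (@runs_step (Act a) tt _ _ m _ h1 erefl); apply: runs_done. Qed.

Lemma exec_seq p q m1 m2 m3 : exec p m1 m2 -> exec q m2 m3 -> exec (Seq p q) m1 m3.
Proof.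
have right y m m' : runs (p := q) y m m' -> runs (p := Seq p q) (omap inr y) m m'.
  elim=> [{}m h|{}y y' e {}m {}m' h he _ IH]; first exact: runs_done.
  by apply: (@runs_step (Seq p q) (inr y) _ e m m' h _ IH); rewrite /= he.
move=> h hq.
have left y m m' : runs (p := p) y m m' -> m' = m2 ->
    runs (p := Seq p q) (Some (if y is Some y then inl y else inr (pstart q))) m m3.
  elim=> [{}m _ ->|{}y y' e {}m {}m' hm he _ IH /IH {}IH]; first exact: right _ _ _ hq.
  by apply: (@runs_step (Seq p q) (inl y) _ e m m3 hm _ IH); rewrite /= he.
exact: left _ _ _ h erefl.
Qed.

Lemma exec_stop b p m : fits m -> ~~ b (read_input x (m_pos m)) (scans m) ->
  fits (apply_effect (idle (scans m)) m) ->
  exec (While b p) m (apply_effect (idle (scans m)) m).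
Proof.
move=> h1 /negbTE hb h2; apply: (@runs_step (While b p) None _ _ m _ h1 erefl); rewrite hb.
exact: runs_done.
Qed.

Lemma exec_loop (b : incell unit -> syms -> bool) p m m1 m2 : fits m -> b (read_input x (m_pos m)) (scans m) ->
  exec p (apply_effect (idle (scans m)) m) m1 -> exec (While b p) m1 m2 ->
  exec (While b p) m m2.
Proof.
move=> h1 hb h h2; apply: (@runs_step (While b p) None _ _ m _ h1 erefl); rewrite hb.
have body y m' m'' : runs (p := p) y m' m'' -> m'' = m1 ->
    runs (p := While b p) (Some y) m' m2.
  elim=> [{}m' _ ->|{}y y' e {}m' {}m'' hm he _ IH /IH {}IH]; first exact: h2.
  by apply: (@runs_step (While b p) (Some y) _ e m' m2 hm _ IH); rewrite /= he.
exact: body _ _ _ h erefl.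
Qed.

Lemma exec_machine p m' :
  let m0 := Mem 0 (nseq_tuple K (0, [::])) [::] in
  exec p m0 m' ->
  tm_space (program_machine p) x S /\ tm_outputs (program_machine p) x (m_out m').
Proof.
pose M := program_machine p.
pose conf (q : option (pstate p)) (m : mem) : tm_config M :=
  @TMConfig _ _ M q (m_pos m) (m_tapes m) (m_out m).
move=> m0 h.
have main q m m1 : runs (p := p) q m m1 -> forall t, tm_run M x t = Some (conf q m) ->
  (forall t' c, t <= t' -> tm_run M x t' = Some c ->
    all (fun tp : tape M => tp.1 < S) (tc_work c)) /\
  exists t', tm_run M x t' = Some (conf None m1).
  elim=> {q m m1} [m hm t ht|q q' [[mv acts] o] m m1 hm e _ IH t ht].
    split; last by exists t.
    move=> t' c /subnKC <-; case: (t' - t) => [|k].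
      rewrite addn0 ht => -[<-]; apply/allP => tp /tnthP[i ->]; exact: hm.
    (* [tm_space] speaks of all times; after halting [tm_run] is [None] for ever, so the finite run
       covers them. *)
    have -> : tm_run M x (t + k.+1) = None; last by [].
    elim: k => [|k IH]; first by rewrite addn1 /tm_run /= -/(tm_run M x t) ht.
    by rewrite addnS /tm_run /= -/(tm_run M x (t + k.+1)) IH.
  have ht1 : tm_run M x t.+1 = Some (conf q' (apply_effect (mv, acts, o) m)).
    by rewrite /tm_run /= -/(tm_run M x t) ht /= /tm_step /= e.
  have [h1 h2] := IH t.+1 ht1; split => // t' c.
  rewrite leq_eqVlt => /orP[/eqP <-|/h1]; last exact.
  by rewrite ht => -[<-]; apply/allP => tp /tnthP[i ->]; exact: hm.
have [h1 [t ht]] := main _ _ _ h 0 erefl; split; first by move=> t' c; apply: h1.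
by exists t, (conf None m').
Qed.

End Programs.

(** * Binary counters on work tapes *)

Section Counter.

Variables (K : nat) (Out : finType) (x : seq unit) (S : nat).

Notation syms := (K.-tuple sym).
Notation mem := (mem K Out).
Notation prog := (prog K Out).
Notation fits := (@fits K Out S).
Notation exec := (@exec K Out x S).

(** Content as a function on all cells: rewriting the scanned blank beyond the end lengthens the
    list without changing the tape. *)
Definition tapeis (t : nat * seq sym) (p : nat) (f : nat -> sym) : Prop :=
  t.1 = p /\ forall i, nth blank t.2 i = f i.

Definition setf (f : nat -> sym) (p : nat) (a : sym) : nat -> sym :=
  fun i => if i == p then a else f i.

Definition moved (mv : move) (p : nat) : nat :=
  match mv with MoveL => p.-1 | Stay => p | MoveR => p.+1 end.

Lemma tapeis_write t p f a mv : tapeis t p f ->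
  tapeis (write t (a, mv)) (moved mv p) (setf f p a).
Proof.
move=> [h1 h2]; split; first by rewrite /= h1.
by move=> i; rewrite /= nth_set_nth /= h1 /setf h2.
Qed.

Lemma tapeis_ext t p f g : tapeis t p f -> f =1 g -> tapeis t p g.
Proof. by move=> [h1 h2] h; split => // i; rewrite h2 h. Qed.

Lemma setf_same f p : setf f p (f p) =1 f.
Proof. by move=> i; rewrite /setf; case: eqP => [->|]. Qed.

Lemma tapeis_stay t p f : tapeis t p f -> tapeis (write t (scan t, Stay)) p f.
Proof.
move=> h; have := tapeis_write (scan t) Stay h; case: (h) => h1 h2.
by rewrite /scan h1 h2 => h3; apply: tapeis_ext h3 (setf_same _ _).
Qed.

Definition one (i : 'I_K) (g : sym -> sym * move) (mv : move) (o : option Out) : prog :=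
  Act (fun s : syms => (mv, [tuple if j == i then g (tnth s j) else (tnth s j, Stay) | j < K], o)).

Definition on (i : 'I_K) (P : pred sym) (u : incell unit) (s : syms) : bool := P (tnth s i).

Definition tape_of (m : mem) (i : 'I_K) := tnth (m_tapes m) i.

Definition frame (i : 'I_K) (m m' : mem) : Prop :=
  forall j, j != i -> forall p f, tapeis (tape_of m j) p f -> tapeis (tape_of m' j) p f.

Definition spec (i : 'I_K) (q : prog) p f p' f' : Prop :=
  forall m, fits m -> tapeis (tape_of m i) p f ->
  exists m', [/\ exec q m m', fits m', tapeis (tape_of m' i) p' f', frame i m m' &
    m_pos m' = m_pos m /\ m_out m' = m_out m].

Lemma tapeis_self t : tapeis t t.1 (nth blank t.2).
Proof. by []. Qed.

Lemma fits_frame i m m' p f : fits m -> frame i m m' -> tapeis (tape_of m' i) p f -> p < S ->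
  fits m'.
Proof.
move=> h1 h2 [h3 _] pS j; have [->|ne] := eqVneq j i; first by rewrite -/(tape_of m' i) h3.
have [e _] := h2 j ne _ _ (tapeis_self (tape_of m j)).
by rewrite -/(tape_of m' j) e; apply: h1.
Qed.

Lemma one_exec i g mv o m p f : fits m -> tapeis (tape_of m i) p f ->
  moved (g (f p)).2 p < S ->
  exists m', [/\ exec (one i g mv o) m m', fits m',
    tapeis (tape_of m' i) (moved (g (f p)).2 p) (setf f p (g (f p)).1), frame i m m' &
    m_pos m' = move_input x mv (m_pos m) /\
    m_out m' = if o is Some b then rcons (m_out m) b else m_out m].
Proof.
move=> hm ht hS.
set m' := apply_effect x (mv, [tuple if j == i then g (tnth (scans m) j) else (tnth (scans m) j, Stay) | j < K], o) m.
have h1 : tapeis (tape_of m' i) (moved (g (f p)).2 p) (setf f p (g (f p)).1).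
  rewrite /tape_of /m' /= !tnth_mktuple eqxx tnth_map -/(tape_of m i).
  have -> : scan (tape_of m i) = f p by case: ht => h1 h2; rewrite /scan h1 h2.
  by case: (g (f p)) => a mv'; apply: tapeis_write.
have h2 : frame i m m'.
  move=> j /negbTE ne p' f' h; rewrite /tape_of /m' /= !tnth_mktuple ne tnth_map.
  exact: tapeis_stay.
have h3 := fits_frame hm h2 h1 hS.
by exists m'; split => //; apply: exec_act.
Qed.

Lemma spec_one i g p f : moved (g (f p)).2 p < S ->
  spec i (one i g Stay None) p f (moved (g (f p)).2 p) (setf f p (g (f p)).1).
Proof. by move=> h m h1 h2; apply: one_exec. Qed.

Lemma spec_ext i q p f p' f' g : spec i q p f p' f' -> f' =1 g -> spec i q p f p' g.
Proof.
move=> h e m h1 h2; have [m' [h3 h4 h5 h6 h7]] := h m h1 h2.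
by exists m'; split => //; apply: tapeis_ext h5 e.
Qed.

Lemma frame_trans i m1 m2 m3 : frame i m1 m2 -> frame i m2 m3 -> frame i m1 m3.
Proof. by move=> h1 h2 j ne p f /(h1 j ne) /(h2 j ne). Qed.

Lemma spec_seq i q r p1 f1 p2 f2 p3 f3 : spec i q p1 f1 p2 f2 -> spec i r p2 f2 p3 f3 ->
  spec i (Seq q r) p1 f1 p3 f3.
Proof.
move=> hq hr m h1 h2; have [m2 [e1 h3 h4 h5 [h6 h7]]] := hq m h1 h2.
have [m3 [e2 h8 h9 h10 [h11 h12]]] := hr m2 h3 h4.
exists m3; rewrite h11 h12 h6 h7; split => //; first exact: exec_seq e1 e2.
exact: frame_trans h5 h10.
Qed.

Lemma idle_effect m : let m' := apply_effect x (idle Out (scans m)) m in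
  [/\ forall i p f, tapeis (tape_of m i) p f -> tapeis (tape_of m' i) p f,
      m_pos m' = m_pos m & m_out m' = m_out m].
Proof.
split => // i p f h; rewrite /tape_of /= !tnth_mktuple tnth_map.
exact: tapeis_stay.
Qed.

Lemma idle_fits m : fits m -> fits (apply_effect x (idle Out (scans m)) m).
Proof.
move=> h i; have [h1 _ _] := idle_effect m.
by have [e _] := h1 i _ _ (tapeis_self (tape_of m i)); rewrite -/(tape_of _ i) e; apply: h.
Qed.

Lemma scan_tape m (i : 'I_K) p f : tapeis (tape_of m i) p f -> tnth (scans m) i = f p.
Proof. by rewrite tnth_map => -[h1 h2]; rewrite /scan h1 h2. Qed.

Lemma spec_stop i (P : pred sym) q p f : ~~ P (f p) -> spec i (While (on i P) q) p f p f.
Proof.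
move=> hP m h1 h2; exists (apply_effect x (idle Out (scans m)) m).
have [h3 h4 h5] := idle_effect m; split => //; last first.
- by move=> j _ p' f'; apply: h3.
- exact: h3.
- exact: idle_fits.
- apply: exec_stop => //; [by rewrite /on (scan_tape h2)|exact: idle_fits].
Qed.

Lemma spec_loop i (P : pred sym) q p f p1 f1 p2 f2 : P (f p) -> spec i q p f p1 f1 ->
  spec i (While (on i P) q) p1 f1 p2 f2 -> spec i (While (on i P) q) p f p2 f2.
Proof.
move=> hP hq hw m h1 h2; have [g1 g2 g3] := idle_effect m.
have [m1 [e1 h3 h4 h5 [h6 h7]]] := hq _ (idle_fits h1) (g1 i _ _ h2).
have [m2 [e2 h8 h9 h10 [h11 h12]]] := hw m1 h3 h4.
exists m2; rewrite h11 h12 h6 h7; split => //.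
- by apply: exec_loop e1 e2 => //; rewrite /on (scan_tape h2).
- by apply: frame_trans h10 => j ne p' f' /g1; apply: h5.
Qed.

(* Binary numbers, least significant bit first, behind the mark in cell 0. *)
Definition cont (bs : seq bool) : nat -> sym := nth blank (mark :: map bit bs).

Lemma cont_neq bs p : cont bs p.+1 != mark.
Proof.
rewrite /cont /=; have [h|h] := ltnP p (size bs); first by rewrite (nth_map false).
by rewrite nth_default // size_map.
Qed.

Lemma cont_at u b r : cont (u ++ b :: r) (size u).+1 = bit b.
Proof. by rewrite /cont /= map_cat nth_cat size_map ltnn subnn. Qed.

Lemma cont_end u : cont u (size u).+1 = blank.
Proof. by rewrite /cont /= nth_default // size_map. Qed.

Lemma setf_cont u b r c : setf (cont (u ++ b :: r)) (size u).+1 (bit c) =1 cont (u ++ c :: r).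
Proof.
move=> [|i]; rewrite /setf /cont //= eqSS !map_cat !nth_cat size_map /=.
case: ltngtP => // [h|->]; last by rewrite subnn.
by case e : (i - size u) => [|k] //; lia.
Qed.

Lemma setf_cont_end u c : setf (cont u) (size u).+1 (bit c) =1 cont (rcons u c).
Proof.
move=> [|i]; rewrite /setf /cont //= eqSS map_rcons nth_rcons size_map.
case: ltngtP => // h; by rewrite nth_default // size_map ltnW.
Qed.

Definition back (i : 'I_K) : prog :=
  While (on i (fun s => s != mark)) (one i (fun s => (s, MoveL)) Stay None).

Lemma back_spec i p bs : p < S -> spec i (back i) p (cont bs) 0 (cont bs).
Proof.
elim: p => [|p IH] pS; first by apply: spec_stop.
apply: spec_loop (IH (ltnW pS)); first exact: cont_neq.
apply: spec_ext (setf_same _ p.+1).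
by apply: (@spec_one i (fun s => (s, MoveL)) p.+1); rewrite /= ltnW.
Qed.

Definition step_right (i : 'I_K) : prog := one i (fun s => (s, MoveR)) Stay None.

Lemma step_right_spec i p bs : p.+1 < S -> spec i (step_right i) p (cont bs) p.+1 (cont bs).
Proof.
move=> pS; apply: spec_ext (setf_same _ p).
exact: (@spec_one i (fun s => (s, MoveR)) p).
Qed.

Definition clear_ones (i : 'I_K) : prog :=
  While (on i (pred1 (bit true))) (one i (fun s => (bit false, MoveR)) Stay None).

Lemma clear_ones_spec i k r u : head false r = false -> size u + k + size r + 1 < S ->
  spec i (clear_ones i) (size u).+1 (cont (u ++ nseq k true ++ r))
    (size u + k).+1 (cont (u ++ nseq k false ++ r)).
Proof.
move=> hr; elim: k u => [|k IH] u hS.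
  rewrite addn0 /=; apply: spec_stop; case: r hr {hS} => [|b r] /=.
    by rewrite cats0 cont_end.
  by move=> ->; rewrite cont_at.
apply: (@spec_loop _ _ _ _ _ (size u).+2 (cont (rcons u false ++ nseq k true ++ r))) => /=.
- by rewrite cont_at.
- apply: spec_ext; first apply: (@spec_one i (fun s => (bit false, MoveR))); first by rewrite /=; lia.
  by move=> j; rewrite setf_cont cat_rcons.
- have := IH (rcons u false); rewrite size_rcons !cat_rcons addSnnS; apply; lia.
Qed.

Definition set_ones (i : 'I_K) : prog :=
  While (on i (fun s => s != mark)) (one i (fun s => (bit true, MoveL)) Stay None).

Lemma set_ones_spec i k r : k < S ->
  spec i (set_ones i) k (cont (nseq k false ++ r)) 0 (cont (nseq k true ++ r)).
Proof.
elim: k r => [|k IH] r hS; first by apply: spec_stop.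
have e b : nseq k.+1 b ++ r = nseq k b ++ b :: r by rewrite -addn1 nseqD -catA.
rewrite !e; apply: spec_loop (IH _ (ltnW hS)).
  by rewrite cont_neq.
apply: spec_ext; first apply: (@spec_one i (fun s => (bit true, MoveL))); first by rewrite /= ltnW.
by move=> j /=; have := setf_cont (nseq k false) false r true j; rewrite size_nseq.
Qed.

Definition skip_zeros (i : 'I_K) : prog :=
  While (on i (pred1 (bit false))) (step_right i).

(** Between operations the head rests on the least significant 1, or on the blank behind the bits if
    the number is 0. The scanned symbol alone then tells whether the counter is positive, which is
    all that [While] can see. *)
Definition rest_pos (bs : seq bool) : nat := (find id bs).+1.

Lemma skip_zeros_spec i u bs : ~~ has id u -> size (u ++ bs) + 1 < S ->
  spec i (skip_zeros i) (size u).+1 (cont (u ++ bs)) (rest_pos (u ++ bs)) (cont (u ++ bs)).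
Proof.
elim: bs u => [|b bs IH] u hu hS.
  by rewrite cats0 /rest_pos (hasNfind hu); apply: spec_stop; rewrite cont_end.
case: b hS => hS.
  have -> : rest_pos (u ++ true :: bs) = (size u).+1.
    by rewrite /rest_pos find_cat (negbTE hu) /= addn0.
  by apply: spec_stop; rewrite cont_at.
apply: (@spec_loop _ _ _ _ _ (size u).+2 (cont (u ++ false :: bs))); first by rewrite cont_at.
  by apply: step_right_spec; move: hS; rewrite size_cat /=; lia.
have hu' : ~~ has id (rcons u false) by rewrite -cats1 has_cat /= orbF.
by have := IH _ hu'; rewrite cat_rcons size_rcons; apply.
Qed.

Fixpoint bval (bs : seq bool) : nat := if bs is b :: bs then b + (bval bs).*2 else 0.

Definition inc (i : 'I_K) : prog :=
  Seq (back i) (Seq (step_right i) (Seq (clear_ones i) (one i (fun s => (bit true, Stay)) Stay None))).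

(** The head already stands on the lowest 1: it becomes 0, the zeros below become 1, and the head
    returns to the new lowest 1. Dually, [inc] ends on the bit it sets, which is the lowest 1 of the
    result. *)
Definition dec (i : 'I_K) : prog :=
  Seq (one i (fun s => (bit false, MoveL)) Stay None)
    (Seq (set_ones i) (Seq (step_right i) (skip_zeros i))).

Lemma bval_ones k r : bval (nseq k true ++ r) = (2 ^ k).-1 + 2 ^ k * bval r.
Proof.
elim: k => [|k IH] /=; first by rewrite mul1n.
have := expn_gt0 2 k; rewrite IH expnS -!muln2; lia.
Qed.

Lemma bval_zeros k r : bval (nseq k false ++ r) = 2 ^ k * bval r.
Proof. by elim: k => [|k IH] /=; [rewrite mul1n|rewrite IH expnS -!muln2; lia]. Qed.

Lemma bits_ones bs : exists k r, bs = nseq k true ++ r /\ head false r = false.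
Proof.
elim: bs => [|[] bs [k [r [-> h]]]]; first by exists 0, [::].
  by exists k.+1, r.
by exists 0, (false :: nseq k true ++ r).
Qed.

Lemma bits_zeros bs : 0 < bval bs -> exists k r, bs = nseq k false ++ true :: r.
Proof.
elim: bs => // -[] bs IH /=; first by exists 0, bs.
by rewrite add0n double_gt0 => /IH [k [r ->]]; exists k.+1, r.
Qed.

Definition counts (W : nat) (t : nat * seq sym) (n : nat) : Prop :=
  exists bs, [/\ tapeis t (rest_pos bs) (cont bs), bval bs = n & size bs <= W].

Lemma rest_pos_le bs : rest_pos bs <= (size bs).+1.
Proof. exact: find_size. Qed.

Lemma find_zeros k r : find id (nseq k false ++ r) = k + find id r.
Proof. by elim: k => //= k ->. Qed.

Lemma inc_exec W (i : 'I_K) m n : W.+2 <= S -> n.+1 < 2 ^ W -> fits m -> counts W (tape_of m i) n ->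
  exists m', [/\ exec (inc i) m m', fits m', counts W (tape_of m' i) n.+1, frame i m m' &
    m_pos m' = m_pos m /\ m_out m' = m_out m].
Proof.
move=> WS nW hm [bs [ht hv hs]]; have [k [r [E hr]]] := bits_ones bs.
have hk : k + size r = size bs by rewrite E size_cat size_nseq.
have hv' : n = (2 ^ k).-1 + 2 ^ k * bval r by rewrite -hv E bval_ones.
have p2 := expn_gt0 2 k.
pose bs' := nseq k false ++ true :: behead r.
have hs' : size bs' <= W /\ bval bs' = n.+1.
  rewrite /bs' size_cat size_nseq bval_zeros /= hv'.
  case: (r) hr hk hv' => [|b r'] /=; last by move=> -> h _; split; [lia|rewrite add0n -!muln2; lia].
  move=> _ h h'; split; last by rewrite muln0 addn0 doubleE; lia.
  (* All bits are 1, so a new bit is appended; a full width [k = W] would mean [n.+1 = 2 ^ W],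
     contrary to the hypothesis. *)
  rewrite addn1 ltn_neqAle; apply/andP; split; last by lia.
  by apply/eqP => kW; move: nW; rewrite h' kW; have := expn_gt0 2 W; lia.
have hr' : spec i (inc i) (rest_pos bs) (cont bs) (rest_pos bs') (cont bs').
  have hp := rest_pos_le bs.
  apply: spec_seq; first by apply: back_spec; lia.
  apply: spec_seq; first by apply: step_right_spec; lia.
  apply: spec_seq; first by rewrite E; apply: (@clear_ones_spec i k r [::]) => //=; lia.
  have -> : rest_pos bs' = (0 + k).+1 by rewrite /rest_pos find_zeros /= addn0.
  apply: spec_ext; first by apply: (@spec_one i (fun s => (bit true, Stay))); rewrite /=; lia.
  move=> j /=; rewrite /bs'; case: (r) hr => [|b r'] /=.
    by move=> _; have := setf_cont_end (nseq k false) true j; rewrite cats0 cats1 size_nseq.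
  by move=> ->; have := setf_cont (nseq k false) false r' true j; rewrite size_nseq.
have [m' [e1 e2 e3 e4 e5]] := hr' m hm ht.
by exists m'; split => //; exists bs'; case: hs'.
Qed.

Lemma dec_exec W (i : 'I_K) m n : W.+2 <= S -> fits m -> counts W (tape_of m i) n.+1 ->
  exists m', [/\ exec (dec i) m m', fits m', counts W (tape_of m' i) n, frame i m m' &
    m_pos m' = m_pos m /\ m_out m' = m_out m].
Proof.
move=> WS hm [bs [ht hv hs]].
have [|k [r E]] := @bits_zeros bs; first by rewrite hv.
have hk : k + (size r).+1 = size bs by rewrite E size_cat size_nseq.
have p2 := expn_gt0 2 k.
pose bs' := nseq k true ++ false :: r.
have hs' : size bs' <= W /\ bval bs' = n.
  rewrite /bs' size_cat size_nseq /= hk; split => //.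
  by move: hv; rewrite E bval_zeros bval_ones /= add0n -!muln2; lia.
have hr' : spec i (dec i) (rest_pos bs) (cont bs) (rest_pos bs') (cont bs').
  have hp := rest_pos_le bs.
  have -> : rest_pos bs = k.+1 by rewrite E /rest_pos find_zeros /= addn0.
  apply: (@spec_seq _ _ _ _ _ k (cont (nseq k false ++ false :: r))).
    apply: spec_ext; first by apply: (@spec_one i (fun s => (bit false, MoveL))); rewrite /=; lia.
    by move=> j /=; rewrite E; have := setf_cont (nseq k false) true r false j; rewrite size_nseq.
  apply: spec_seq; first by apply: set_ones_spec; lia.
  apply: spec_seq; first by apply: step_right_spec; lia.
  by apply: (@skip_zeros_spec i [::] bs') => //=; case: hs'; lia.
have [m' [e1 e2 e3 e4 e5]] := hr' m hm ht.
by exists m'; split => //; exists bs'; case: hs'.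
Qed.

Lemma counts_scan W m (i : 'I_K) n : counts W (tape_of m i) n ->
  (tnth (scans m) i == bit true) = (0 < n).
Proof.
move=> [bs [ht <- _]]; rewrite (scan_tape ht) /rest_pos; case: (posnP (bval bs)) => [h|h].
  have : all negb bs by elim: bs h {ht} => //= -[] bs IH //= /eqP; rewrite add0n double_eq0 => /eqP.
  rewrite all_predC => hn; rewrite (hasNfind hn) -{1}(cats0 bs).
  by rewrite cats0 cont_end.
have [k [r ->]] := bits_zeros h.
by have := cont_at (nseq k false) true r; rewrite size_nseq find_zeros /= addn0 => ->.
Qed.

Lemma counts_frame W i j m m' n : frame i m m' -> j != i ->
  counts W (tape_of m j) n -> counts W (tape_of m' j) n.
Proof. by move=> h ne [bs [h1 h2 h3]]; exists bs; split => //; apply: h. Qed.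

End Counter.

(** * Counter programs and their triples of store, store and output *)

Section CounterPrograms.

Variables (K' : nat) (Out : finType).

Notation K := K'.+1.
Notation prog := (prog K Out).
Notation mem := (mem K Out).

Definition upd (s : nat -> nat) (i n : nat) : nat -> nat := fun j => if j == i then n else s j.

Definition skip : prog := one ord0 (fun a => (a, Stay)) Stay None.
Definition put_sym (o : Out) : prog := one ord0 (fun a => (a, Stay)) Stay (Some o).
Definition seqs (l : seq prog) : prog := foldr (@Seq K Out) skip l.
Definition loop (l : seq 'I_K) (p : prog) : prog :=
  While (fun _ s => all (fun i => tnth s i == bit true) l) p.

Definition clear (i : 'I_K) : prog := loop [:: i] (dec Out i).
Definition copy (k i j : 'I_K) : prog :=
  Seq (loop [:: i] (Seq (dec Out i) (Seq (inc Out j) (inc Out k))))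
      (loop [:: k] (Seq (dec Out k) (inc Out i))).
Definition unary (k i : 'I_K) (o : Out) : prog :=
  Seq (loop [:: i] (Seq (dec Out i) (Seq (put_sym o) (inc Out k))))
      (loop [:: k] (Seq (dec Out k) (inc Out i))).
Definition puts (w : seq Out) : prog := seqs (map put_sym w).
Definition incs (i : 'I_K) (n : nat) : prog := iter n (Seq (inc Out i)) skip.

(** A loop can only count down to zero, so [u] holds the number of remaining rounds, [e] + 1 at
    first since the range includes both ends, while [i] counts up. *)
Definition for_upto (k e i u : 'I_K) (p : prog) : prog :=
  Seq (copy k e u) (Seq (inc Out u)
    (Seq (loop [:: u] (Seq (dec Out u) (Seq p (inc Out i)))) (clear i))).

Variables (x : seq unit) (S W B : nat).
Hypotheses (WS : W.+2 <= S) (BW : B < 2 ^ W).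

Notation exec := (@exec K Out x S).

Implicit Types (s : nat -> nat) (i j : 'I_K) (p q : prog).

Definition holds_store (m : mem) (s : nat -> nat) : Prop :=
  fits S m /\ forall i : 'I_K, counts W (tape_of m i) (s i).

Definition tri (p : prog) (s s' : nat -> nat) (w : seq Out) : Prop :=
  forall m, holds_store m s -> exists m', [/\ exec p m m', holds_store m' s',
    m_pos m' = m_pos m & m_out m' = m_out m ++ w].

Lemma tri_ext p s s' s1 s1' w : tri p s s' w -> s =1 s1 -> s' =1 s1' -> tri p s1 s1' w.
Proof.
move=> h e e' m [h1 h2]; have [|m' [h3 [h4 h5] h6 h7]] := h m.
  by split => // i; rewrite e.
by exists m'; split => //; split => // i; rewrite -e'.
Qed.

Lemma tri_frame (i : 'I_K) (p : prog) s n :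
  (forall m, fits S m -> counts W (tape_of m i) (s i) ->
    exists m', [/\ exec p m m', fits S m', counts W (tape_of m' i) n, frame i m m' &
      m_pos m' = m_pos m /\ m_out m' = m_out m]) ->
  tri p s (upd s i n) [::].
Proof.
move=> h m [h1 h2]; have [m' [h3 h4 h5 h6 [h7 h8]]] := h m h1 (h2 i).
exists m'; rewrite cats0; split => //; split => // j; rewrite /upd.
case: eqP => [/val_inj -> //|ne]; apply: counts_frame h6 _ (h2 j).
by apply/eqP => e; apply: ne; rewrite e.
Qed.

Lemma tri_inc i s : s i < B -> tri (inc Out i) s (upd s i (s i).+1) [::].
Proof.
by move=> h; apply: tri_frame => m h1 h2; apply: inc_exec => //; apply: leq_trans BW.
Qed.

Lemma tri_dec i s : 0 < s i -> tri (dec Out i) s (upd s i (s i).-1) [::].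
Proof. by move=> h; apply: tri_frame => m h1 h2; apply: dec_exec; rewrite ?prednK. Qed.

Lemma tri_one o s : tri (one ord0 (fun a => (a, Stay)) Stay o) s s (if o is Some b then [:: b] else [::]).
Proof.
move=> m [h1 h2]; have [bs [h3 h4 h5]] := h2 ord0.
have [|m' [e1 e2 e3 e4 [e5 e6]]] := @one_exec K Out x S ord0 (fun a => (a, Stay)) Stay o m _ _ h1 h3.
  by rewrite /=; have := rest_pos_le bs; lia.
exists m'; split => //; last by rewrite e6; case: (o) => [b|]; rewrite ?cats1 ?cats0.
split => // j; have [->|ne] := eqVneq j ord0; last exact: counts_frame e4 ne (h2 j).
by exists bs; split => //; apply: tapeis_ext e3 (setf_same _ _).
Qed.

Lemma tri_skip s : tri skip s s [::].
Proof. exact: tri_one. Qed.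

Lemma tri_put o s : tri (put_sym o) s s [:: o].
Proof. exact: tri_one. Qed.

Lemma tri_seq p q s1 s2 s3 v w : tri p s1 s2 v -> tri q s2 s3 w -> tri (Seq p q) s1 s3 (v ++ w).
Proof.
move=> hp hq m h1; have [m2 [e1 h2 h3 h4]] := hp m h1; have [m3 [e2 h5 h6 h7]] := hq m2 h2.
by exists m3; rewrite h6 h7 h4 catA; split => //; apply: exec_seq e1 e2.
Qed.

Lemma tri_seq0 p q s1 s2 s3 w : tri p s1 s2 [::] -> tri q s2 s3 w -> tri (Seq p q) s1 s3 w.
Proof. exact: tri_seq. Qed.

Lemma loop_test m s l : holds_store m s ->
  all (fun i => tnth (scans m) i == bit true) l = all (fun i : 'I_K => 0 < s i) l.
Proof. by move=> [_ h]; apply: eq_all => i; rewrite (counts_scan (h i)). Qed.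

Lemma idle_store m s : holds_store m s -> holds_store (apply_effect x (idle Out (scans m)) m) s.
Proof.
move=> [h1 h2]; split; first exact: idle_fits.
have [h3 _ _] := idle_effect x m.
by move=> i; have [bs [e1 e2 e3]] := h2 i; exists bs; split => //; apply: h3.
Qed.

Lemma tri_loop_stop l p s : ~~ all (fun i : 'I_K => 0 < s i) l -> tri (loop l p) s s [::].
Proof.
move=> h m hm; exists (apply_effect x (idle Out (scans m)) m).
have hi := idle_store hm; have [_ h5 h6] := idle_effect x m.
rewrite cats0; split => //; apply: exec_stop; [by case: hm|by rewrite (loop_test _ hm)|by case: hi].
Qed.

Lemma tri_loop_step l p s s1 s2 v w : all (fun i : 'I_K => 0 < s i) l ->
  tri p s s1 v -> tri (loop l p) s1 s2 w -> tri (loop l p) s s2 (v ++ w).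
Proof.
move=> h hp hl m hm; have hi := idle_store hm; have [_ h5 h6] := idle_effect x m.
have [m1 [e1 g1 g2 g3]] := hp _ hi; have [m2 [e2 g4 g5 g6]] := hl m1 g1.
exists m2; rewrite g5 g2 h5 g6 g3 h6 catA; split => //.
by apply: exec_loop e1 e2; [case: hm|rewrite (loop_test _ hm)].
Qed.

(** Here [sg k] is the loop invariant: the whole store at the moment when counter [i] equals [k]. *)
Lemma tri_loop (i : 'I_K) p n (sg : nat -> nat -> nat) (e : nat -> seq Out) :
  (forall k, k <= n -> sg k i = k) ->
  (forall k, k < n -> tri p (sg k.+1) (sg k) (e k)) ->
  tri (loop [:: i] p) (sg n) (sg 0) (flatten [seq e k | k <- rev (iota 0 n)]).
Proof.
elim: n => [|n IH] hi hp; first by apply: tri_loop_stop; rewrite /= hi.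
have -> : rev (iota 0 n.+1) = n :: rev (iota 0 n) by rewrite -(addn1 n) iotaD rev_cat.
rewrite /=.
apply: (@tri_loop_step _ _ _ (sg n)); first by rewrite /= hi.
  exact: hp.
by apply: IH => k hk; [apply: hi; apply: leqW|apply: hp; apply: leqW].
Qed.

Lemma tri_loop0 (i : 'I_K) p n (sg : nat -> nat -> nat) :
  (forall k, k <= n -> sg k i = k) ->
  (forall k, k < n -> tri p (sg k.+1) (sg k) [::]) ->
  tri (loop [:: i] p) (sg n) (sg 0) [::].
Proof.
move=> h1 h2; have := tri_loop h1 h2; suff -> : flatten [seq [::] | _ <- rev (iota 0 n)] = [::] :> seq Out by [].
by elim: (rev _).
Qed.

Ltac cases := move=> l0; rewrite /upd; repeat (case: eqP => ?); subst; try lia; try congruence.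

Lemma tri_clear i s : tri (clear i) s (upd s i 0) [::].
Proof.
have := @tri_loop0 i (dec Out i) (s i) (fun n => upd s i n) _ _.
move=> h; apply: tri_ext (h _ _) _ _ => // [k _|k hk|].
- by rewrite /upd eqxx.
- apply: tri_ext (@tri_dec i (upd s i k.+1) _) _ _ => //.
    by rewrite /upd eqxx.
  by cases.
- by cases.
Qed.

Lemma tri_copy (k i j : 'I_K) s : i != j :> nat -> i != k :> nat -> j != k :> nat ->
  s j = 0 -> s k = 0 -> s i <= B -> tri (copy k i j) s (upd s j (s i)) [::].
Proof.
move=> /eqP ij /eqP ik /eqP jk sj sk sB.
pose sg n := upd (upd (upd s i n) j (s i - n)) k (s i - n).
pose sg' n := upd (upd (upd s i (s i - n)) j (s i)) k n.
apply: (@tri_seq0 _ _ _ (sg 0)).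
  apply: tri_ext (@tri_loop0 i _ (s i) sg _ _) _ _ => // [n hn|n hn|].
  - by rewrite /sg /upd; do ?case: eqP => //; lia.
  - apply: (@tri_seq0 _ _ _ (upd (sg n.+1) i n)).
      apply: tri_ext (@tri_dec i (sg n.+1) _) _ _ => //.
        by rewrite /sg /upd; do ?case: eqP => //; lia.
      by rewrite /sg; cases.
    apply: (@tri_seq0 _ _ _ (upd (upd (sg n.+1) i n) j (s i - n))).
      apply: tri_ext (@tri_inc j (upd (sg n.+1) i n) _) _ _ => //.
        by rewrite /sg /upd; do ?case: eqP => //; lia.
      by rewrite /sg; cases.
    apply: tri_ext (@tri_inc k (upd (upd (sg n.+1) i n) j (s i - n)) _) _ _ => //.
      by rewrite /sg /upd; do ?case: eqP => //; lia.
    by rewrite /sg; cases.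
  - by rewrite /sg; cases.
apply: tri_ext (@tri_loop0 k _ (s i) sg' _ _) _ _ => // [n hn|n hn||].
- by rewrite /sg' /upd; do ?case: eqP => //; lia.
- apply: (@tri_seq0 _ _ _ (upd (sg' n.+1) k n)).
    apply: tri_ext (@tri_dec k (sg' n.+1) _) _ _ => //.
      by rewrite /sg' /upd; do ?case: eqP => //; lia.
    by rewrite /sg'; cases.
  apply: tri_ext (@tri_inc i (upd (sg' n.+1) k n) _) _ _ => //.
    by rewrite /sg' /upd; do ?case: eqP => //; lia.
  by rewrite /sg'; cases.
- by rewrite /sg /sg'; cases.
- by rewrite /sg'; cases.
Qed.

Lemma tri_unary (k i : 'I_K) o s : i != k :> nat -> s k = 0 -> s i <= B ->
  tri (unary k i o) s s (nseq (s i) o).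
Proof.
move=> /eqP ik sk sB.
pose sg n := upd (upd s i n) k (s i - n).
pose sg' n := upd (upd s i (s i - n)) k n.
have e1 : nseq (s i) o = flatten [seq [:: o] | _ <- rev (iota 0 (s i))].
  rewrite -{1}[s i](size_iota 0) -(size_rev (iota _ _)).
  by elim: (rev _) => //= a l ->.
rewrite e1 -[flatten _]cats0; apply: (@tri_seq _ _ _ (sg 0)).
  apply: tri_ext (@tri_loop i _ (s i) sg (fun _ => [:: o]) _ _) _ _ => // [n hn|n hn|].
  - by rewrite /sg /upd; do ?case: eqP => //; lia.
  - apply: (@tri_seq0 _ _ _ (upd (sg n.+1) i n)).
      apply: tri_ext (@tri_dec i (sg n.+1) _) _ _ => //.
        by rewrite /sg /upd; do ?case: eqP => //; lia.
      by rewrite /sg; cases.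
    apply: (@tri_seq _ _ _ (upd (sg n.+1) i n) _ [:: o] [::]); first exact: tri_put.
    apply: tri_ext (@tri_inc k (upd (sg n.+1) i n) _) _ _ => //.
      by rewrite /sg /upd; do ?case: eqP => //; lia.
    by rewrite /sg; cases.
  - by rewrite /sg; cases.
apply: tri_ext (@tri_loop0 k _ (s i) sg' _ _) _ _ => // [n hn|n hn||].
- by rewrite /sg' /upd; do ?case: eqP => //; lia.
- apply: (@tri_seq0 _ _ _ (upd (sg' n.+1) k n)).
    apply: tri_ext (@tri_dec k (sg' n.+1) _) _ _ => //.
      by rewrite /sg' /upd; do ?case: eqP => //; lia.
    by rewrite /sg'; cases.
  apply: tri_ext (@tri_inc i (upd (sg' n.+1) k n) _) _ _ => //.
    by rewrite /sg' /upd; do ?case: eqP => //; lia.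
  by rewrite /sg'; cases.
- by rewrite /sg /sg'; cases.
- by rewrite /sg'; cases.
Qed.

Lemma tri_seqs (l : seq prog) s (ws : seq (seq Out)) : size l = size ws ->
  (forall n, n < size l -> tri (nth skip l n) s s (nth [::] ws n)) ->
  tri (seqs l) s s (flatten ws).
Proof.
elim: l ws => [|p l IH] [|w ws] //= => [_ _|[e] h]; first exact: tri_skip.
apply: tri_seq (h 0 isT) _; apply: IH e _ => n; exact: (h n.+1).
Qed.

Lemma tri_puts w s : tri (puts w) s s w.
Proof.
by elim: w => [|o w IH]; [apply: tri_skip|apply: (@tri_seq _ _ _ s _ [:: o] w); first apply: tri_put].
Qed.

Lemma tri_incs i n s : s i + n <= B -> tri (incs i n) s (upd s i (s i + n)) [::].
Proof.
elim: n s => [|n IH] s h.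
  by rewrite /incs /=; apply: tri_ext (@tri_skip s) _ _ => //; rewrite addn0; cases.
apply: (@tri_seq0 _ _ _ (upd s i (s i).+1)); first by apply: tri_inc; lia.
apply: tri_ext (IH (upd s i (s i).+1) _) _ _ => //.
  by rewrite /upd eqxx; lia.
by rewrite /upd eqxx; cases.
Qed.

Lemma tri_for (k e i u : 'I_K) p s (w : nat -> seq Out) :
  uniq [:: (k : nat); e : nat; i : nat; u : nat] -> s k = 0 -> s i = 0 -> s u = 0 -> s e < B ->
  (forall n, n <= s e -> tri p (upd (upd s i n) u (s e - n)) (upd (upd s i n) u (s e - n)) (w n)) ->
  tri (for_upto k e i u p) s s (flatten [seq w n | n <- iota 0 (s e).+1]).
Proof.
move=> hu; have [ke ki ku [ei eu iu]] : [/\ k <> e :> nat, k <> i :> nat, k <> u :> nat &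
    [/\ e <> i :> nat, e <> u :> nat & i <> u :> nat]].
  move: hu; rewrite /= !inE !negb_or !andbT.
  by move=> /andP[/and3P[/eqP ? /eqP ? /eqP ?] /andP[/andP[/eqP ? /eqP ?] /eqP ?]].
move=> sk si su sB hp; set N := s e.
apply: (@tri_seq0 _ _ _ (upd s u N)); first by apply: tri_copy => //; [apply/eqP|apply/eqP; auto|apply/eqP; auto|apply: ltnW].
apply: (@tri_seq0 _ _ _ (upd s u N.+1)).
  apply: tri_ext (@tri_inc u (upd s u N) _) _ _ => //; first by rewrite /upd eqxx.
  by rewrite /upd eqxx; cases.
pose sg n := upd (upd s i (N.+1 - n)) u n.
have -> : [seq w n | n <- iota 0 N.+1] = [seq w (N - n) | n <- rev (iota 0 N.+1)].
  apply: (@eq_from_nth _ [::]); first by rewrite !size_map size_rev.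
  move=> j; rewrite size_map size_iota => hj.
  rewrite (nth_map 0) ?size_iota // (nth_map 0) ?size_rev ?size_iota //.
  rewrite nth_rev size_iota // !nth_iota ?size_iota; try lia.
  by congr w; lia.
rewrite -[flatten _]cats0; apply: (@tri_seq _ _ _ (sg 0)).
  apply: tri_ext (@tri_loop u _ N.+1 sg (fun n => w (N - n)) _ _) _ _ => // [n hn|n hn|].
  - by rewrite /sg /upd eqxx.
  - apply: (@tri_seq0 _ _ _ (upd (upd s i (N - n)) u n)).
      apply: tri_ext (@tri_dec u (sg n.+1) _) _ _ => //; rewrite /sg.
        by rewrite /upd eqxx.
      by cases.
    rewrite -[w _]cats0; apply: (@tri_seq _ _ _ (upd (upd s i (N - n)) u n)).
      by have := hp (N - n); rewrite subKn; [apply; rewrite leq_subr|rewrite -ltnS].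
    apply: tri_ext (@tri_inc i (upd (upd s i (N - n)) u n) _) _ _ => //; rewrite /sg.
      by rewrite /upd; do ?case: eqP => //; lia.
    by cases.
  - by rewrite /sg; cases.
by apply: tri_ext (@tri_clear i (sg 0)) _ _ => //; rewrite /sg; cases.
Qed.

End CounterPrograms.

(** * The generating program *)

Definition cE : 'I_11 := @Ordinal 11 0 isT.
Definition cX : 'I_11 := @Ordinal 11 1 isT.
Definition cY : 'I_11 := @Ordinal 11 2 isT.
Definition cZ : 'I_11 := @Ordinal 11 3 isT.
Definition cU : 'I_11 := @Ordinal 11 4 isT.
Definition cV : 'I_11 := @Ordinal 11 5 isT.
Definition cW : 'I_11 := @Ordinal 11 6 isT.
Definition cA : 'I_11 := @Ordinal 11 7 isT.
Definition cB : 'I_11 := @Ordinal 11 8 isT.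
Definition cF : 'I_11 := @Ordinal 11 9 isT.
Definition cK : 'I_11 := @Ordinal 11 10 isT.

Notation gprog := (prog 11 out_sym).

(** The eleven tapes: the top letter [cE], the parameters [cX], [cY], [cZ], their remaining rounds
    [cU], [cV], [cW], the operands [cA], [cB] of a comparison, its flag [cF], and [cK] for restoring
    a counter after copying or printing. *)
Definition counter (v : var) : option 'I_11 :=
  match v with Zero => None | X => Some cX | Y => Some cY | Z => Some cZ | Top => Some cE end.

Inductive item := Const of seq out_sym | Una of var.

Definition item_eval (e : var -> nat) (it : item) : seq out_sym :=
  match it with Const w => w | Una v => nseq (e v) (inl true) end.

Definition item_prog (it : item) : gprog :=
  match it with
  | Const w => puts 10 w
  | Una v => if counter v is Some i then unary cK i (inl true : out_sym) else skip 10 out_sym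
  end.

Definition text_eval (e : var -> nat) (t : seq item) : seq out_sym := flatten (map (item_eval e) t).
Definition text_prog (t : seq item) : gprog := seqs (map item_prog t).

Definition load (v : var) (i : 'I_11) : gprog :=
  if counter v is Some j then copy out_sym cK j i else skip 10 out_sym.

(** Both sides are decreased together until one is 0; the left one then holds the truncated
    difference, which is positive exactly when the inequality fails. The second loop lowers the flag
    in that case. *)
Definition check (a : atom) : gprog :=
  let: Atom v i w j := a in
  Seq (load v cA) (Seq (load w cB) (Seq (incs out_sym cA i) (Seq (incs out_sym cB j)
    (Seq (loop [:: cA; cB] (Seq (dec out_sym cA) (dec out_sym cB)))
      (Seq (loop [:: cA; cF] (dec out_sym cF)) (Seq (clear out_sym cA) (clear out_sym cB))))))).

(** A conditional made from a loop: the flag starts at 1, survives if all atoms hold, and is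
    decremented on entry, so the body runs at most once. *)
Definition guarded (g : seq atom) (p : gprog) : gprog :=
  Seq (inc out_sym cF) (Seq (seqs (map check g)) (loop [:: cF] (Seq (dec out_sym cF) p))).

Section Generator.

Variables (x : seq unit) (S W B : nat).
Hypotheses (WS : W.+2 <= S) (BW : B < 2 ^ W).

Notation tri := (@tri 10 out_sym x S W).

Unset Implicit Arguments.
Let tri_skip' := @tri_skip 10 out_sym x S W B WS BW.
Let tri_unary' := @tri_unary 10 out_sym x S W B WS BW.
Let tri_copy' := @tri_copy 10 out_sym x S W B WS BW.
Let tri_inc' := @tri_inc 10 out_sym x S W B WS BW.
Let tri_incs' := @tri_incs 10 out_sym x S W B WS BW.
Let tri_puts' := @tri_puts 10 out_sym x S W B WS BW.
Let tri_seqs' := @tri_seqs 10 out_sym x S W B WS BW.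
Let tri_clear' := @tri_clear 10 out_sym x S W B WS BW.
Let tri_dec' := @tri_dec 10 out_sym x S W WS.

Set Implicit Arguments.

Definition envs (s : nat -> nat) : var -> nat := env (s 0) (s 1) (s 2) (s 3).

(** The slack of 3 leaves room for the extra round of a loop up to [E] and for the increments of at
    most 1 in the atoms. *)
Definition bounded (s : nat -> nat) : Prop :=
  [/\ s 0 + 3 <= B, s 1 <= s 0, s 2 <= s 0 & s 3 <= s 0].

Implicit Types s : nat -> nat.

Ltac cases := move=> l0; rewrite /upd /=; repeat (case: eqP => ?); subst; try lia; try congruence.

Lemma tri_item s it : bounded s -> s 10 = 0 -> tri (item_prog it) s s (item_eval (envs s) it).
Proof.
move=> [b0 b1 b2 b3] sk; case: it => [w|v]; first exact: tri_puts'.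
case: v => /=; first exact: tri_skip'.
all: by apply: (tri_unary') => //=; lia.
Qed.

Lemma tri_text s t : bounded s -> s 10 = 0 -> tri (text_prog t) s s (text_eval (envs s) t).
Proof.
move=> hb sk; apply: tri_seqs' => //; first by rewrite !size_map.
move=> n; rewrite size_map => hn; rewrite !(nth_map (Const [::])) //.
exact: tri_item.
Qed.

Lemma tri_load s v (i : 'I_11) : bounded s -> s 10 = 0 -> s i = 0 -> 6 < i < 10 ->
  tri (load v i) s (upd s i (envs s v)) [::].
Proof.
move=> [b0 b1 b2 b3] sk si hi; rewrite /load; case: v => /=.
  by apply: tri_ext (tri_skip' s) _ _ => //; cases.
all: by apply: (tri_copy') => //=; lia.
Qed.

Lemma tri_check s v i w j : bounded s -> s 7 = 0 -> s 8 = 0 -> s 10 = 0 -> s 9 <= 1 ->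
  i <= 1 -> j <= 1 ->
  tri (check (Atom v i w j)) s (upd s 9 (if holds (envs s) (Atom v i w j) then s 9 else 0)) [::].
Proof.
move=> hb s7 s8 s10 s9 hi hj; rewrite /check /holds.
have ev u : envs s u <= s 0 by case: hb => b0 b1 b2 b3; case: u => /=; lia.
have b0 : s 0 + 3 <= B by case: hb.
set a := envs s v; set b := envs s w.
have ha : a <= s 0 by apply: ev.
have hb' : b <= s 0 by apply: ev.
apply: (@tri_seq0 _ _ _ _ _ _ _ _ (upd s 7 a)); first exact: tri_load.
apply: (@tri_seq0 _ _ _ _ _ _ _ _ (upd (upd s 7 a) 8 b)).
  exact: (@tri_load (upd s 7 a) w cB).
apply: (@tri_seq0 _ _ _ _ _ _ _ _ (upd (upd s 7 (a + i)) 8 b)).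
  apply: tri_ext (tri_incs'  cA i (upd (upd s 7 a) 8 b) _) _ _ => //.
    by rewrite /upd /=; lia.
  by cases.
apply: (@tri_seq0 _ _ _ _ _ _ _ _ (upd (upd s 7 (a + i)) 8 (b + j))).
  apply: tri_ext (tri_incs'  cB j (upd (upd s 7 (a + i)) 8 b) _) _ _ => //.
    by rewrite /upd /=; lia.
  by cases.
apply: (@tri_seq0 _ _ _ _ _ _ _ _ (upd (upd s 7 (a + i - (b + j))) 8 (b + j - (a + i)))).
  (* Generalizing both operands gives the simultaneous countdown for every pair of values. *)
  elim: (a + i) (b + j) => [|m IH] n.
    by apply: tri_ext (@tri_loop_stop 10 out_sym x S W _ _ (upd (upd s 7 0) 8 n) _) _ _ => //; cases.
  case: n => [|n].
    by apply: tri_ext (@tri_loop_stop 10 out_sym x S W _ _ (upd (upd s 7 m.+1) 8 0) _) _ _ => //; cases.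
  apply: (@tri_loop_step 10 out_sym x S W _ _ _ (upd (upd s 7 m) 8 n) _ [::] [::]); [by []| |apply: tri_ext (IH n) _ _ => //; cases].
  apply: (@tri_seq0 _ _ _ _ _ _ _ _ (upd (upd s 7 m) 8 n.+1)).
    by apply: tri_ext (tri_dec' cA (upd (upd s 7 m.+1) 8 n.+1) _) _ _ => //; cases.
  by apply: tri_ext (tri_dec' cB (upd (upd s 7 m) 8 n.+1) _) _ _ => //; cases.
set f := if _ then s 9 else 0.
set A := a + i - (b + j); set C := b + j - (a + i).
have fE : f = if A == 0 then s 9 else 0 by rewrite /f /A subn_eq0.
apply: (@tri_seq0 _ _ _ _ _ _ _ _ (upd (upd (upd s 7 A) 8 C) 9 f)).
  have stop n m : (n == 0) || (m == 0) ->
      tri (loop [:: cA; cF] (dec out_sym cF)) (upd (upd (upd s 7 n) 8 C) 9 m)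
        (upd (upd (upd s 7 n) 8 C) 9 m) [::].
    by move=> h; apply: tri_loop_stop => //; rewrite /= /upd /=; lia.
  rewrite fE; case: eqP => hA.
    by apply: tri_ext (stop A (s 9) _) _ _ => //; [rewrite hA|cases].
  case h9 : (s 9) s9 => [|[|//]] _.
    by apply: tri_ext (stop A 0 _) _ _ => //; [rewrite orbT|cases].
  apply: (@tri_loop_step 10 out_sym x S W _ _ _ (upd (upd (upd s 7 A) 8 C) 9 0) _ [::] [::]).
  - by rewrite /= /upd /= h9; move: hA; clearbody A; lia.
  - apply: tri_ext (tri_dec' cF (upd (upd s 7 A) 8 C) _) _ _ => //.
      by rewrite /upd /= h9.
    by rewrite /upd /= h9; cases.
  - by apply: stop; rewrite orbT.
apply: (@tri_seq0 _ _ _ _ _ _ _ _ (upd (upd (upd s 7 0) 8 C) 9 f)).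
  by apply: tri_ext (tri_clear' cA (upd (upd (upd s 7 A) 8 C) 9 f)) _ _ => //; cases.
by apply: tri_ext (tri_clear' cB (upd (upd (upd s 7 0) 8 C) 9 f)) _ _ => //; cases.
Qed.

Definition small (a : atom) : bool := let: Atom _ i _ j := a in (i <= 1) && (j <= 1).

Lemma tri_checks s g f : bounded s -> s 7 = 0 -> s 8 = 0 -> s 10 = 0 -> f <= 1 -> all small g ->
  tri (seqs (map check g)) (upd s 9 f) (upd s 9 (if all (holds (envs s)) g then f else 0)) [::].
Proof.
move=> hb s7 s8 s10; elim: g f => [|[v i w j] g IH] f hf.
  by move=> _; apply: tri_skip'.
move=> /= /andP[/andP[hi hj] hg].
set h := env _ _ _ _ v + i <= _.
apply: (@tri_seq0 _ _ _ _ _ _ _ _ (upd s 9 (if h then f else 0))).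
  apply: tri_ext (@tri_check (upd s 9 f) v i w j _ _ _ _ _ hi hj) _ _ => //.
  by rewrite /upd /=; cases.
have := IH (if h then f else 0) _ hg.
rewrite -/(envs s); case: h => /=; first exact.
by case: ifP => _; apply.
Qed.

Lemma tri_guarded s g p w : bounded s -> s 7 = 0 -> s 8 = 0 -> s 9 = 0 -> s 10 = 0 -> all small g ->
  tri p s s w -> tri (guarded g p) s s (if all (holds (envs s)) g then w else [::]).
Proof.
move=> hb s7 s8 s9 s10 hg hp; have b0 : s 0 + 3 <= B by case: hb.
apply: (@tri_seq0 _ _ _ _ _ _ _ _ (upd s 9 1)).
  apply: tri_ext (tri_inc'  cF s _) _ _ => //; rewrite /= ?s9 //; lia.
apply: (@tri_seq0 _ _ _ _ _ _ _ _ (upd s 9 (if all (holds (envs s)) g then 1 else 0))).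
  exact: tri_checks.
case: ifP => _; last by apply: tri_ext (@tri_loop_stop 10 out_sym x S W _ _ s _) _ _ => //=; rewrite ?s9 //; cases.
rewrite -[w]cats0; apply: (@tri_loop_step 10 out_sym x S W _ _ _ s).
- by [].
- apply: (@tri_seq0 _ _ _ _ _ _ _ _ s) => //.
  by apply: tri_ext (tri_dec' cF (upd s 9 1) _) _ _ => //; cases.
- by apply: tri_loop_stop => //=; rewrite s9.
Qed.

End Generator.

(** * The written form as templates with unary blocks *)

Definition state_word (k : kind) (p q : nat) : seq bool :=
  nseq (kind_index k) true ++ false :: nseq p true ++ false :: nseq q true.

Definition state_name (d : nat) (s : state d) : seq bool := state_word s.1.1 s.1.2 s.2.

Lemma state_name_inj d : injective (@state_name d).
Proof.
have aux n m u v : nseq n true ++ false :: u = nseq m true ++ false :: v -> n = m /\ u = v.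
  by elim: n m => [|n IH] [|m] //= [] => [->|/IH[-> ->]].
move=> [[k p] q] [[k' p'] q'] /aux[ek /aux[ep eq]].
have -> : k = k' by apply: (can_inj kind_indexK).
have -> : p = p' by apply: val_inj.
by have -> : q = q' by apply: val_inj; rewrite /= -(size_nseq q true) eq size_nseq.
Qed.

Definition bits_text (w : seq bool) : item := Const (map (inl : bool -> out_sym) w).
Definition end_text : item := Const [:: inr false : out_sym].

Definition name_text (k : kind) (v w : var) : seq item :=
  [:: bits_text (rcons (nseq (kind_index k) true) false); Una v; bits_text [:: false]; Una w; end_text].

Definition rule_text (f : family) : seq item :=
  name_text (f_src f) (f_src1 f) (f_src2 f) ++
  Const (write_nat (f_chan f)) :: Const (write_word [:: f_op f]) :: Una (f_letter f) :: end_text ::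
  name_text (f_dst f) (f_dst1 f) (f_dst2 f) ++ [:: Const end_record].

Definition header_text : seq item :=
  [:: Una Top; end_text; Const (write_nat 3)] ++
  name_text Kbeg Zero Zero ++ name_text Kfin Zero Zero ++ [:: Const end_record].

Lemma text_eval_cat e t u : text_eval e (t ++ u) = text_eval e t ++ text_eval e u.
Proof. by rewrite /text_eval map_cat flatten_cat. Qed.

Lemma name_textE e k v w : text_eval e (name_text k v w) = write_word (state_word k (e v) (e w)).
Proof.
rewrite /text_eval /= /write_word /state_word.
by rewrite map_rcons cat_rcons -cats1 map_cat /= map_cat /= !map_nseq -!catA /= -!catA.
Qed.

Lemma write_natE e v : text_eval e [:: Una v; end_text] = write_nat (e v).
Proof. by rewrite /text_eval /= /write_nat /write_word map_nseq cats1. Qed.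

Definition for_param (i u : 'I_11) (p : gprog) : gprog := for_upto cK cE i u p.

Definition states_prog : gprog :=
  for_param cX cU (for_param cY cV (text_prog (flatten [seq name_text k X Y | k <- kinds]))).

Definition rules_prog : gprog :=
  for_param cX cU (for_param cY cV (for_param cZ cW
    (seqs [seq guarded (f_guard f) (text_prog (rule_text f)) | f <- families]))).

Definition generator : gprog :=
  Seq (text_prog header_text) (Seq states_prog (Seq (text_prog [:: Const end_record]) rules_prog)).

Definition start_tapes : gprog :=
  seqs [seq one i (fun _ : sym => (mark, MoveR)) Stay (None : option out_sym) | i <- enum 'I_11].

Definition next_input : gprog := one ord0 (fun a => (a, Stay)) MoveR None.

Definition is_letter (i : incell unit) : bool := if i is Letter _ then true else false.

(** The input head starts on the left end marker, hence the first move; the last increment turns [d]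
    into the top letter [d.+1]. *)
Definition load_input : gprog :=
  Seq next_input (Seq (While (fun i _ => is_letter i) (Seq (inc out_sym cE) next_input)) (inc out_sym cE)).

Definition main_prog : gprog := Seq start_tapes (Seq load_input generator).

Section Run.

Variable d : nat.

Notation E := d.+1.
Notation x := (nseq d tt).
Notation B := (d + 4).
Notation W := (trunc_log 2 (d + 4)).+1.
Variable S : nat.
Hypothesis WS : W.+2 <= S.

Let BW : B < 2 ^ W.
Proof. by apply: trunc_log_ltn. Qed.

Notation tri := (@tri 10 out_sym x S W).
Notation exec := (@exec 11 out_sym x S).

Definition store (p q r u v w : nat) : nat -> nat := nth 0 [:: E; p; q; r; u; v; w].

Lemma tri_for_param (i u : 'I_11) p s (w : nat -> seq out_sym) :
  0 < i < 7 -> 0 < u < 7 -> i != u :> nat -> s 0 = E -> s 10 = 0 -> s i = 0 -> s u = 0 ->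
  (forall n, n <= E -> tri p (upd (upd s i n) u (E - n)) (upd (upd s i n) u (E - n)) (w n)) ->
  tri (for_param i u p) s s (flatten [seq w n | n <- iota 0 E.+1]).
Proof.
move=> hi hu iu sE sk si su h; rewrite -{1}sE.
apply: (@tri_for 10 out_sym x S W B WS BW) => //=; rewrite ?sE //; last by lia.
by rewrite !inE; lia.
Qed.

Ltac store_ext := do 8 (case=> [//=|]); move=> l0; rewrite /upd /store /= ?nth_nil //.

Lemma store_bounded p q r u v w : p <= E -> q <= E -> r <= E -> bounded B (store p q r u v w).
Proof. by move=> h1 h2 h3; split; rewrite /store /=; lia. Qed.

Definition states_text (e : var -> nat) : seq out_sym :=
  flatten [seq write_word (state_word k (e X) (e Y)) | k <- kinds].

Lemma text_eval_flatten e (T : Type) (f : T -> seq item) l :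
  text_eval e (flatten (map f l)) = flatten [seq text_eval e (f k) | k <- l].
Proof. by elim: l => //= a l IH; rewrite text_eval_cat IH. Qed.

Lemma tri_states : tri states_prog (store 0 0 0 0 0 0) (store 0 0 0 0 0 0)
  (flatten [seq flatten [seq states_text (env E p q 0) | q <- iota 0 E.+1] | p <- iota 0 E.+1]).
Proof.
apply: tri_for_param => // p hp.
apply: tri_ext (_ : tri _ (store p 0 0 (E - p) 0 0) (store p 0 0 (E - p) 0 0) _) _ _; try by store_ext.
apply: tri_for_param => // q hq.
apply: tri_ext (_ : tri _ (store p q 0 (E - p) (E - q) 0) (store p q 0 (E - p) (E - q) 0) _) _ _; try by store_ext.
have := @tri_text x S W B WS BW (store p q 0 (E - p) (E - q) 0)
  (flatten [seq name_text k X Y | k <- kinds]) (store_bounded _ _ _ hp hq (leq0n _)) erefl.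
rewrite text_eval_flatten /states_text.
suff -> : [seq text_eval (envs (store p q 0 (E - p) (E - q) 0)) (name_text k X Y) | k <- kinds] =
  [seq write_word (state_word k (env E p q 0 X) (env E p q 0 Y)) | k <- kinds] by [].
by apply: eq_map => k; rewrite name_textE.
Qed.

Definition rules_text (e : var -> nat) : seq out_sym :=
  flatten [seq (if all (holds e) (f_guard f) then text_eval e (rule_text f) else [::]) | f <- families].

Lemma tri_rules : tri rules_prog (store 0 0 0 0 0 0) (store 0 0 0 0 0 0)
  (flatten [seq flatten [seq flatten [seq rules_text (env E p q r) | r <- iota 0 E.+1]
    | q <- iota 0 E.+1] | p <- iota 0 E.+1]).
Proof.
apply: tri_for_param => // p hp.
apply: tri_ext (_ : tri _ (store p 0 0 (E - p) 0 0) (store p 0 0 (E - p) 0 0) _) _ _; try by store_ext.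
apply: tri_for_param => // q hq.
apply: tri_ext (_ : tri _ (store p q 0 (E - p) (E - q) 0) (store p q 0 (E - p) (E - q) 0) _) _ _; try by store_ext.
apply: tri_for_param => // r hr.
apply: tri_ext (_ : tri _ (store p q r (E - p) (E - q) (E - r)) (store p q r (E - p) (E - q) (E - r)) _) _ _; try by store_ext.
set s := store _ _ _ _ _ _.
have hs : bounded B s by apply: store_bounded.
have hg : all (fun f => all small (f_guard f)) families by [].
rewrite /rules_text -[env E p q r]/(envs s).
elim: families hg => [_|f l IH /= /andP[hf /IH {}IH]]; first exact: (@tri_skip 10 out_sym x S W B WS BW).
apply: tri_seq IH; apply: (@tri_guarded x S W B WS BW) => //.
exact: (@tri_text x S W B WS BW s (rule_text f) hs erefl).
Qed.

Definition description : seq out_sym :=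
  text_eval (env E 0 0 0) header_text ++
  flatten [seq flatten [seq states_text (env E p q 0) | q <- iota 0 E.+1] | p <- iota 0 E.+1] ++
  end_record ++
  flatten [seq flatten [seq flatten [seq rules_text (env E p q r) | r <- iota 0 E.+1]
    | q <- iota 0 E.+1] | p <- iota 0 E.+1].

Lemma tri_generator : tri generator (store 0 0 0 0 0 0) (store 0 0 0 0 0 0) description.
Proof.
have hb : bounded B (store 0 0 0 0 0 0) by apply: store_bounded.
apply: tri_seq; first exact: (tri_text x WS BW header_text hb erefl).
apply: tri_seq; first exact: tri_states.
apply: tri_seq; last exact: tri_rules.
by have := tri_text x WS BW [:: Const end_record] hb erefl.
Qed.

Notation mem := (mem 11 out_sym).

Lemma exec_start (m : mem) : fits S m -> (forall i, tapeis (tape_of m i) 0 (fun=> blank)) ->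
  m_pos m = 0 -> m_out m = [::] ->
  exists m', [/\ exec start_tapes m m', holds_store S W m' (fun=> 0), m_pos m' = 0 & m_out m' = [::]].
Proof.
move=> hm ht hp ho.
have hn l : l =i enum 'I_11 -> uniq l -> forall i, i \in l by move=> h _ i; rewrite h mem_enum.
(* Halfway through, tapes still in [l] are blank and the others already hold 0. Writing the mark and
   stepping right gives the rest position of the empty bit list. *)
suff main (l : seq 'I_11) : uniq l -> forall m : mem, fits S m ->
    (forall i, if i \in l then tapeis (tape_of m i) 0 (fun=> blank) else counts W (tape_of m i) 0) ->
    exists m', [/\ exec (seqs [seq one i (fun _ : sym => (mark, MoveR)) Stay (None : option out_sym) | i <- l]) m m',
      holds_store S W m' (fun=> 0), m_pos m' = m_pos m & m_out m' = m_out m].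
  have [|m' [h1 h2 h3 h4]] := main (enum 'I_11) (enum_uniq _) m hm.
    by move=> i; rewrite mem_enum; apply: ht.
  by exists m'; rewrite h3 h4.
elim: l {m hm ht hp ho hn} => [|i l IH] hu m hm ht.
  have [|m' [h1 h2 h3 h4]] := @tri_skip 10 out_sym x S W B WS BW (fun=> 0) m; first by split.
  by exists m'; rewrite h4 cats0.
case/andP: hu => il hu.
have hti : tapeis (tape_of m i) 0 (fun=> blank) by have := ht i; rewrite mem_head.
have [|m1 [e1 f1 t1 fr1 [p1 o1]]] := @one_exec 11 out_sym x S i (fun _ : sym => (mark, MoveR)) Stay None m _ _ hm hti.
  by rewrite /=; lia.
have [||m2 [e2 h2 p2 o2]] := IH hu m1 => //.
  move=> j; have [->|ne] := eqVneq j i.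
    rewrite (negbTE il); exists [::]; split => //.
    by apply: tapeis_ext t1 _ => -[|n]; rewrite /setf /cont //= nth_nil.
  have := ht j; rewrite inE (negbTE ne) /=; case: ifP => _; first exact: fr1.
  exact: (counts_frame fr1 ne).
by exists m2; rewrite p2 o2 p1 o1; split => //; apply: exec_seq e1 e2.
Qed.

Lemma exec_next (m : mem) s : holds_store S W m s ->
  exists m', [/\ exec next_input m m', holds_store S W m' s,
    m_pos m' = minn (m_pos m).+1 E & m_out m' = m_out m].
Proof.
move=> [h1 h2]; have [bs [h3 h4 h5]] := h2 ord0.
have [|m' [e1 e2 e3 e4 [e5 e6]]] := @one_exec 11 out_sym x S ord0 (fun a => (a, Stay)) MoveR None m _ _ h1 h3.
  by rewrite /=; have := rest_pos_le bs; lia.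
exists m'; split => //; last by rewrite e5 /= size_nseq.
split => // j; have [->|ne] := eqVneq j ord0; last exact: counts_frame e4 ne (h2 j).
by exists bs; split => //; apply: tapeis_ext e3 (setf_same _ _).
Qed.

Lemma read_inputE n : n <= d -> is_letter (read_input x n.+1) = (n < d).
Proof.
move=> hn; rewrite /read_input map_nseq; have [h|h] := ltnP n d.
  by rewrite nth_nseq h.
by rewrite nth_default // size_nseq.
Qed.

Lemma exec_count n (m : mem) : n <= d -> holds_store S W m (upd (fun=> 0) 0 n) -> m_pos m = n.+1 ->
  m_out m = [::] ->
  exists m', [/\ exec (While (fun i _ => is_letter i) (Seq (inc out_sym cE) next_input)) m m',
    holds_store S W m' (upd (fun=> 0) 0 d) & m_out m' = [::]].
Proof.
move=> hn; move e : (d - n) => k; elim: k n m hn e => [|k IH] n m hn e hm hp ho.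
  have en : n = d by lia.
  subst n; have hi := idle_store x hm; have [_ h5 h6] := idle_effect x m.
  exists (apply_effect x (idle out_sym (scans m)) m); rewrite h6; split => //.
  by apply: exec_stop; [case: hm|rewrite hp read_inputE // ltnn|case: hi].
have hi := idle_store x hm; have [_ h5 h6] := idle_effect x m.
have hB : upd (fun=> 0) 0 n cE < B by rewrite /upd /=; lia.
have [m1 [e1 s1 p1 o1]] := tri_inc x WS BW hB hi.
have [m2 [e2 s2 p2 o2]] := exec_next s1.
have [|||||m3 [e3 s3 o3]] := IH n.+1 m2; try lia.
- case: s2 => f2 c2; split => // i; have := c2 i; rewrite /upd /=.
  by case: eqP.
- by rewrite o2 o1 h6 ho.
exists m3; split => //; apply: exec_loop e3.
- by case: hm.
- by rewrite hp read_inputE //; lia.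
- exact: exec_seq e1 e2.
Qed.

Lemma exec_load (m : mem) : holds_store S W m (fun=> 0) -> m_pos m = 0 -> m_out m = [::] ->
  exists m', [/\ exec load_input m m', holds_store S W m' (store 0 0 0 0 0 0) & m_out m' = [::]].
Proof.
move=> hm hp ho; have [m1 [e1 s1 p1 o1]] := exec_next hm.
have [||||m2 [e2 s2 o2]] := @exec_count 0 m1 => //.
- by case: s1 => f1 c1; split => // i; rewrite /upd; case: eqP => _; apply: c1.
- by rewrite p1 hp; lia.
- by rewrite o1.
have hB : upd (fun=> 0) 0 d cE < B by rewrite /upd /=; lia.
have [m3 [e3 s3 p3 o3]] := tri_inc x WS BW hB s2.
exists m3; split; last by rewrite o3 o2.
  by apply: exec_seq e1 _; apply: exec_seq e2 e3.
case: s3 => f3 c3; split => // i; have := c3 i; rewrite /upd /store /=.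
by case: i => [[|[|[|[|[|[|[|i]]]]]]] hi] //=; rewrite nth_nil.
Qed.

Lemma main_run : tm_space (program_machine main_prog) x S /\
  tm_outputs (program_machine main_prog) x description.
Proof.
set m0 := Mem 0 (nseq_tuple 11 (0, [::])) [::] : mem.
have h0 i : tapeis (tape_of m0 i) 0 (fun=> blank).
  by rewrite /tape_of tnth_nseq; split => // n; rewrite nth_nil.
have f0 : fits S m0 by move=> i; rewrite tnth_nseq /=; lia.
have [m1 [e1 s1 p1 o1]] := exec_start f0 h0 erefl erefl.
have [m2 [e2 s2 o2]] := exec_load s1 p1 o1.
have [m3 [e3 s3 p3 o3]] := tri_generator s2.
have := exec_machine (exec_seq e1 (exec_seq e2 e3)).
by rewrite o3 o2.
Qed.

End Run.

(** * The output describes the system *)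

Section Description.

Variable d : nat.

Notation E := d.+1.

Definition up_to (T : Type) (f : nat -> seq T) : seq T := flatten [seq f n | n <- iota 0 E.+1].

Lemma flatten_up_to (T U : Type) (g : T -> seq U) (f : nat -> seq T) :
  flatten [seq g a | a <- up_to f] = up_to (fun n => flatten [seq g a | a <- f n]).
Proof.
rewrite /up_to; elim: (iota _ _) => //= n l IH.
by rewrite map_cat flatten_cat IH.
Qed.

Lemma up_toP (T : eqType) (f : nat -> seq T) a :
  reflect (exists2 n, n <= E & a \in f n) (a \in up_to f).
Proof.
apply: (iffP flattenP) => [[l /mapP[n hn ->] ha]|[n hn ha]].
  by exists n => //; move: hn; rewrite mem_iota.
by exists (f n) => //; apply/mapP; exists n => //; rewrite mem_iota.
Qed.

Lemma eq_up_to (T : Type) (f g : nat -> seq T) : (forall n, n <= E -> f n = g n) -> up_to f = up_to g.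
Proof.
move=> h; rewrite /up_to; congr flatten; apply/eq_in_map => n.
by rewrite mem_iota => /h.
Qed.

Definition all_states : seq (state d) :=
  up_to (fun p => up_to (fun q => [seq (k, inord p, inord q) | k <- kinds])).

(** A family that does not mention some parameter yields the same rule several times; [describes]
    compares the list with the rule set by membership, so repetitions are allowed. *)
Definition all_rules : seq (pcs_rule (state d) d.+1 3) :=
  up_to (fun p => up_to (fun q => up_to (fun r =>
    [seq rule_of f (inord p) (inord q) (inord r) |
      f <- families & all (holds (env E p q r)) (f_guard f)]))).

Lemma all_statesP : all_states =i [set: state d].
Proof.
move=> [[k p] q]; rewrite in_setT; apply/up_toP; exists p; first by rewrite -ltnS.
apply/up_toP; exists q; first by rewrite -ltnS.
by apply/mapP; exists k; rewrite ?inord_val //; case: k.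
Qed.

Lemma In_mem_map (T : Type) (U : eqType) (P : pred T) (f : T -> U) l u :
  reflect (exists t, [/\ List.In t l, P t & u = f t]) (u \in [seq f t | t <- l & P t]).
Proof.
elim: l => [|t l IH] /=; first by apply: ReflectF => -[t []].
case: ifP => Pt /=; last first.
  apply: (iffP IH) => -[t' [h1 h2 h3]]; exists t'; split; auto.
  by case: h1 => // e; rewrite -e Pt in h2.
rewrite inE; apply: (iffP orP) => [[/eqP ->|/IH[t' [h1 h2 h3]]]|[t' [[<-|h1] h2 h3]]].
- by exists t; split; auto.
- by exists t'; split; auto.
- by left; apply/eqP.
- by right; apply/IH; exists t'.
Qed.

Lemma all_rulesP : all_rules =i machine_rules d.
Proof.
move=> r; rewrite [RHS]inE; apply/up_toP/existsP => [[x hx]|[x /existsP[y /existsP[z]]]].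
  move=> /up_toP[y hy] /up_toP[z hz] /In_mem_map[f [h1 h2 ->]].
  exists (inord x); apply/existsP; exists (inord y).
  apply/existsP; exists (inord z); apply: In_has h1 _.
  by rewrite !inordK // h2 eqxx.
move=> /has_In[f [h1 /andP[h2 /eqP h3]]].
exists x; first by rewrite -ltnS.
apply/up_toP; exists y; first by rewrite -ltnS.
apply/up_toP; exists z; first by rewrite -ltnS.
by apply/In_mem_map; exists f; rewrite !inord_val.
Qed.

Lemma rule_textE f p q r : p <= E -> q <= E -> r <= E ->
  text_eval (env E p q r) (rule_text f) =
  write_rule (@state_name d) (rule_of f (inord p) (inord q) (inord r) : pcs_rule (state d) d.+1 3).
Proof.
move=> hp hq hr; have ev v : val_of (d := d) (inord p) (inord q) (inord r) v = env E p q r v :> nat.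
  by rewrite val_ofE !inordK.
have mid e a b v t : text_eval e [:: Const a, Const b, Una v, end_text & t] =
    a ++ b ++ write_nat (e v) ++ text_eval e t.
  by rewrite -write_natE /text_eval /= -!catA.
rewrite /rule_text text_eval_cat name_textE mid text_eval_cat name_textE.
by rewrite /write_rule /rule_of /state_name /= !ev.
Qed.

Lemma machine_described : describes (machine d) (description d).
Proof.
exists (@state_name d), all_states, all_rules; split.
- exact: state_name_inj.
- exact: all_statesP.
- exact: all_rulesP.
have -> : write_nat E ++ write_nat 3 ++ write_word (state_name (hs_beg (machine d))) ++
    write_word (state_name (hs_end (machine d))) ++ end_record ++
    flatten [seq write_word (state_name q) | q <- all_states] ++ end_record ++
    flatten [seq write_rule (@state_name d) r | r <- all_rules] =
  text_eval (env E 0 0 0) header_text ++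
    flatten [seq write_word (state_name q) | q <- all_states] ++ end_record ++
    flatten [seq write_rule (@state_name d) r | r <- all_rules].
  have hd e v a t : text_eval e [:: Una v, end_text, Const a & t] = write_nat (e v) ++ a ++ text_eval e t.
    by rewrite -write_natE /text_eval /= -!catA.
  rewrite -[header_text]/([:: Una Top, end_text, Const (write_nat 3) &
    name_text Kbeg Zero Zero ++ name_text Kfin Zero Zero ++ [:: Const end_record]]).
  rewrite hd (text_eval_cat _ (name_text Kbeg _ _)) (text_eval_cat _ (name_text Kfin _ _)).
  have assoc (T : Type) (a b c u v w : seq T) : a ++ b ++ c ++ u ++ v ++ w = (a ++ b ++ c ++ u ++ v) ++ w.
    by rewrite -!catA.
  by rewrite !name_textE; apply: assoc.
rewrite /description; congr (_ ++ (_ ++ (_ ++ _))).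
- rewrite /all_states flatten_up_to.
  transitivity (up_to (fun p => up_to (fun q => states_text (env E p q 0)))); first by [].
  apply: eq_up_to => p hp.
  rewrite flatten_up_to; apply: eq_up_to => q hq.
  rewrite /states_text -map_comp; congr flatten; apply: eq_map => k.
  by rewrite /state_name /= !inordK.
- rewrite /all_rules flatten_up_to.
  transitivity (up_to (fun p => up_to (fun q => up_to (fun r => rules_text (env E p q r))))).
    by [].
  apply: eq_up_to => p hp.
  rewrite flatten_up_to; apply: eq_up_to => q hq.
  rewrite flatten_up_to; apply: eq_up_to => r hr.
  rewrite /rules_text; elim: families => //= f l ->.
  by case: ifP => //= _; rewrite rule_textE.
Qed.

End Description.

Lemma machine_logspace : logspace_uniform machine.
Proof.
(* A tape uses the mark, [W] bits and one blank, where [W] is one more than the logarithm of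
   [d + 4]. That logarithm is at most 3 more than the one of [d], so log + 6 cells suffice, and this
   is at most 6 (log + 1). *)
exists (program_machine main_prog), 6 => d; set S := 6 * _.
have hS : (trunc_log 2 (d + 4)).+1.+2 <= S.
  have h : trunc_log 2 (d + 4) <= (trunc_log 2 d) + 3.
    case: d {S} => [|d]; first by [].
    have : d.+1 + 4 <= 2 ^ 3 * d.+1 by lia.
    move=> /(leq_trunc_log 2) h; apply: leq_trans h _.
    rewrite (_ : 2 ^ 3 * d.+1 = d.+1.*2.*2.*2); last by rewrite -!muln2; lia.
    by rewrite !trunc_log2_double ?double_gt0 // addn3.
  by rewrite /S; lia.
have [h1 h2] := main_run hS; split => //.
by exists (description d); split => //; apply: machine_described.
Qed.

Theorem lemma5p6 :
  exists S Sinv : forall d : nat, hardy_system d,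
    (forall d : nat, weak_hardy (S d) /\ complete (S d)) /\
    (forall d : nat, weak_hardy (Sinv d) /\ inv_complete (Sinv d)) /\
    logspace_uniform S /\ logspace_uniform Sinv.
Proof.
exists machine, machine; split=> [d|].
  by split; [apply: machine_weak|apply: machine_complete].
split=> [d|]; last by split; apply: machine_logspace.
by split; [apply: machine_weak|apply: machine_inv_complete].
Qed.
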